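(* Let $k$ be a perfect field of characteristic $p>0$ and let $G\subset\mathrm{Aut}_k\, k[[y]]$ be a finite group of order divisible by $p$ whose action is weak, i.e. $G_2=1$. The action of $G$ lifts to characteristic zero if $G$ is of one of the following three forms: (i) a cyclic group $\mathbb{Z}/p\mathbb{Z}$ of order $p$; (ii) a dihedral group $D_p=\mathbb{Z}/p\mathbb{Z}\rtimes\mathbb{Z}/2\mathbb{Z}$ of order $2p$ if $p>2$, or $(\mathbb{Z}/2\mathbb{Z})^2$ if $p=2$; (iii) the tetrahedral group $A_4=(\mathbb{Z}/2\mathbb{Z})^2\rtimes\mathbb{Z}/3\mathbb{Z}$, for $p=2$. In all other cases, the action of $G$ does not lift to characteristic $p^2$. Consequently, in all cases, the versal deformation ring $R_G$ of the local action of $G$ has characteristic in $\{0,p\}$.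
   Context: $W(k)$ is the ring of Witt vectors of $k$. $\widehat{\mathcal C}_k$ is the category of complete Noetherian local $W(k)$-algebras with residue field $k$, and $\mathcal C_k$ is its full subcategory of Artinian local $W(k)$-algebras with residue field $k$; $\mathcal M_A$ denotes the maximal ideal of $A$. For a finite group $G\subset \mathrm{Aut}_k\,k[[y]]$, the second ramification group is $G_2=\{\sigma\in G:\mathrm{ord}_y(\sigma(y)-y)>2\}$. A lift of the action of $G$ to $A$ in $\widehat{\mathcal C}_k$ is a homomorphism $G\to\mathrm{Aut}_A\,A[[y]]$ reducing modulo $\mathcal M_A$ to the given inclusion $G\subset \mathrm{Aut}_k\,k[[y]]$. The functor $D_G$ of infinitesimal deformations sends $A$ in $\mathcal C_k$ to the set of lifts to $A$ modulo conjugation by automorphisms of $A[[y]]$ that are the identity modulo $\mathcal M_A$; $R_G$ in $\widehat{\mathcal C}_k$ is its versal ring (hull, in Schlessinger's sense). The characteristic $\mathrm{car}(A)$ of a non-zero ring $A$ with $1$ is the non-negative generator of the kernel of $\mathbb{Z}\to A$. The action lifts to characteristic zero (resp. $p^2$) if it has a lift to some object of $\widehat{\mathcal C}_k$ of characteristic $0$ (resp. to some object of $\mathcal C_k$ of characteristic $p^2$). *)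

(* Defs.v *)
From HB Require Import structures.
From mathcomp Require Import all_boot all_order all_algebra.
From mathcomp Require Import all_fingroup all_solvable.
From mathcomp Require Import boolp.
From mathcomp Require Import ring.

Set Implicit Arguments.
Unset Strict Implicit.
Unset Printing Implicit Defensive.

Import GRing.Theory.
Local Open Scope ring_scope.

(* Expressions for integer polynomials with variables in V; two expressions   *)
(* denote the same polynomial when they have the same values in all rings.    *)
Inductive zpoly (V : Type) : Type :=
  | ZVar of V | ZZero | ZOne | ZOpp of zpoly V
  | ZAdd of zpoly V & zpoly V | ZMul of zpoly V & zpoly V.

Arguments ZZero {V}.
Arguments ZOne {V}.

Fixpoint zeval (V : Type) (R : comNzRingType) (e : V -> R) (t : zpoly V) : R :=
  match t with
  | ZVar v => e v
  | ZZero => 0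
  | ZOne => 1
  | ZOpp a => - zeval e a
  | ZAdd a b => zeval e a + zeval e b
  | ZMul a b => zeval e a * zeval e b
  end.

Fixpoint zsubst (V U : Type) (s : V -> zpoly U) (t : zpoly V) : zpoly U :=
  match t with
  | ZVar v => s v
  | ZZero => ZZero
  | ZOne => ZOne
  | ZOpp a => ZOpp (zsubst s a)
  | ZAdd a b => ZAdd (zsubst s a) (zsubst s b)
  | ZMul a b => ZMul (zsubst s a) (zsubst s b)
  end.

Lemma zeval_ext (V : Type) (R : comNzRingType) (e1 e2 : V -> R) t :
  e1 =1 e2 -> zeval e1 t = zeval e2 t.
Proof.
by move=> ee; elim: t => //= [a ->|a -> b ->|a -> b ->].
Qed.

Lemma zeval_subst (V U : Type) (R : comNzRingType) (e : U -> R)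
    (s : V -> zpoly U) t :
  zeval e (zsubst s t) = zeval (fun v => zeval e (s v)) t.
Proof. by elim: t => //= [a ->|a -> b ->|a -> b ->]. Qed.

Lemma zeval_morph (V : Type) (R S : comNzRingType) (f : {rmorphism R -> S})
    (e : V -> R) t :
  f (zeval e t) = zeval (fun v => f (e v)) t.
Proof.
elim: t => /= [||| a <-|a <- b <-|a <- b <-] //.
- exact: rmorph0.
- exact: rmorph1.
- exact: rmorphN.
- exact: rmorphD.
- exact: rmorphM.
Qed.

Section Derived.
Variable V : Type.
Implicit Types t : zpoly V.

Definition znat n : zpoly V := iter n (ZAdd ZOne) ZZero.
Definition zexp t n : zpoly V := iter n (ZMul t) ZOne.
Definition zsum (s : seq (zpoly V)) : zpoly V := foldr (@ZAdd V) ZZero s.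

Variables (R : comNzRingType) (e : V -> R).

Lemma zeval_nat n : zeval e (znat n) = n%:R.
Proof. by elim: n => //= n ->; rewrite mulrS. Qed.

Lemma zeval_exp t n : zeval e (zexp t n) = zeval e t ^+ n.
Proof. by elim: n => //= n ->; rewrite exprS. Qed.

Lemma zeval_sum s : zeval e (zsum s) = \sum_(t <- s) zeval e t.
Proof. by elim: s => [|t s IHs]; rewrite ?big_nil ?big_cons //= IHs. Qed.

End Derived.

Section Cong.
Variable V : Type.
Implicit Types t u v : zpoly V.

Definition zcong (c : nat) t u := exists v,
  forall (R : comNzRingType) (e : V -> R),
    zeval e t = zeval e u + c%:R * zeval e v.

Lemma zcong_eq c t u :
  (forall (R : comNzRingType) (e : V -> R), zeval e t = zeval e u) ->
  zcong c t u.
Proof. by move=> tu; exists ZZero => R e; rewrite tu /= mulr0 addr0. Qed.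

Lemma zcong_refl c t : zcong c t t.
Proof. exact: zcong_eq. Qed.

Lemma zcong_sym c t u : zcong c t u -> zcong c u t.
Proof. by case=> v tu; exists (ZOpp v) => R e; rewrite tu /=; ring. Qed.

Lemma zcong_trans c t u v : zcong c t u -> zcong c u v -> zcong c t v.
Proof.
by case=> a tu [b uv]; exists (ZAdd a b) => R e; rewrite tu uv /=; ring.
Qed.

Lemma zcong_opp c t t' : zcong c t t' -> zcong c (ZOpp t) (ZOpp t').
Proof. by case=> a tt; exists (ZOpp a) => R e /=; rewrite tt; ring. Qed.

Lemma zcong_add c t t' u u' :
  zcong c t t' -> zcong c u u' -> zcong c (ZAdd t u) (ZAdd t' u').
Proof.
by case=> a tt [b uu]; exists (ZAdd a b) => R e /=; rewrite tt uu; ring.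
Qed.

Lemma zcong_mul c t t' u u' :
  zcong c t t' -> zcong c u u' -> zcong c (ZMul t u) (ZMul t' u').
Proof.
case=> a tt [b uu].
exists (ZAdd (ZAdd (ZMul t' b) (ZMul a u')) (ZMul (znat _ c) (ZMul a b))).
by move=> R e /=; rewrite tt uu zeval_nat; ring.
Qed.

Lemma zcong_exp c t t' n : zcong c t t' -> zcong c (zexp t n) (zexp t' n).
Proof.
by move=> tt; elim: n => [|n IHn]; [exact: zcong_refl | exact: zcong_mul].
Qed.

Lemma zcong_sum c (T : Type) (s : seq T) (F G : T -> zpoly V) :
  (forall i, zcong c (F i) (G i)) ->
  zcong c (zsum (map F s)) (zsum (map G s)).
Proof.
move=> FG; elim: s => [|i s IHs]; first exact: zcong_refl.
exact: zcong_add.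
Qed.

Lemma zcong_scale c d t u :
  zcong c t u -> zcong (d * c) (ZMul (znat _ d) t) (ZMul (znat _ d) u).
Proof.
by case=> v tu; exists v => R e /=; rewrite tu zeval_nat natrM; ring.
Qed.

Lemma zcong_expS p c t u : (0 < p)%N -> (p %| c)%N ->
  zcong c t u -> zcong (p * c) (zexp t p) (zexp u p).
Proof.
move=> p_gt0 pc tu.
pose g := zsum [seq ZMul (zexp t (p.-1 - i)) (zexp u i) | i <- iota 0 p].
have [w Hw] : zcong p g ZZero.
  have H : zcong p g (zsum [seq zexp t p.-1 | i <- iota 0 p]).
    have [v tv] : zcong p t u.
      case: tu => v tv; case/dvdnP: pc => d cE.
      exists (ZMul (znat _ d) v) => R e /=.
      by rewrite tv zeval_nat cE natrM; ring.
    have {}tv : zcong p t u by exists v.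
    have : forall i, i \in iota 0 p ->
       zcong p (ZMul (zexp t (p.-1 - i)) (zexp u i)) (zexp t p.-1).
      move=> i; rewrite mem_iota add0n leq0n /= => ip.
      apply: zcong_trans (_ : zcong p (ZMul (zexp t (p.-1 - i)) (zexp t i)) _).
        apply: zcong_mul; first exact: zcong_refl.
        by apply: zcong_exp; apply: zcong_sym.
      apply: zcong_eq => R e /=; rewrite !zeval_exp -exprD subnK //.
      by rewrite -ltnS prednK.
    rewrite /g; elim: (iota 0 p) => [|i s IHs] Hs; first exact: zcong_refl.
    apply: zcong_add; first by apply: Hs; rewrite inE eqxx.
    by apply: IHs => j js; apply: Hs; rewrite inE js orbT.
  apply: zcong_trans H _; exists (zexp t p.-1) => R e.
  rewrite zeval_sum big_map big_const_seq count_predT size_iota.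
  by rewrite iter_addr_0 /= add0r mulr_natl.
case: tu => v tv; exists (ZMul v w) => R e; have := Hw R e.
rewrite !zeval_exp /= /g zeval_sum big_map => Hg.
have /eqP := subrXX (zeval e t) (zeval e u) p.
rewrite subr_eq => /eqP ->; rewrite addrC; congr (_ + _).
rewrite -(big_mkord xpredT (fun i => zeval e t ^+ (p.-1 - i) * zeval e u ^+ i)).
rewrite /index_iota subn0.
under eq_bigr => j _ do rewrite -!zeval_exp.
by rewrite Hg tv natrM /=; ring.
Qed.

End Cong.

Section Frobenius.
Variables (V : Type) (p : nat) (p_pr : prime p).
Implicit Types t u : zpoly V.

Definition zfrob : zpoly V -> zpoly V := zsubst (fun v => zexp (ZVar v) p).

Lemma zcong_expD t u :
  zcong p (zexp (ZAdd t u) p) (ZAdd (zexp t p) (zexp u p)).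
Proof.
have p_gt0 := prime_gt0 p_pr.
exists (zsum [seq ZMul (znat _ ('C(p, i.+1) %/ p))
   (ZMul (zexp t (p - i.+1)) (zexp u i.+1)) | i <- iota 0 p.-1]) => R e.
rewrite zeval_sum big_map zeval_exp /= exprDn.
rewrite -(big_mkord xpredT
  (fun i => zeval e t ^+ (p - i) * zeval e u ^+ i *+ 'C(p, i))).
have pE : p = p.-1.+1 by rewrite prednK.
rewrite {1}pE big_nat_recl // big_nat_recr //= -pE.
rewrite subn0 expr0 mulr1 bin0 subnn expr0 mul1r binn !mulr1n !zeval_exp.
rewrite -addrA; congr (_ + _); rewrite addrC; congr (_ + _).
rewrite mulr_sumr /index_iota subn0 big_seq [RHS]big_seq.
apply: eq_bigr => i; rewrite mem_iota add0n => /= ip.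
rewrite !zeval_exp zeval_nat mulrA -natrM mulnC divnK ?mulr_natl ?exprS //.
by rewrite prime_dvd_bin //= pE ltnS.
Qed.

Lemma zcong_frob t : zcong p (zfrob t) (zexp t p).
Proof.
have p_gt0 := prime_gt0 p_pr.
elim: t => /= [v||| a IHa | a IHa b IHb | a IHa b IHb].
- exact: zcong_refl.
- by apply: zcong_eq => R e; rewrite zeval_exp /= expr0n eqn0Ngt p_gt0.
- by apply: zcong_eq => R e; rewrite zeval_exp /= expr1n.
- apply: zcong_trans (zcong_opp IHa) _.
  have [p2 | p_odd] := even_prime p_pr.
    exists (ZOpp (zexp a 2)) => R e.
    by rewrite p2 /= !mulr1; ring.
  by apply: zcong_eq => R e; rewrite /= !zeval_exp /= exprNn -signr_odd p_odd mulN1r.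
- apply: zcong_trans (zcong_add IHa IHb) _.
  exact/zcong_sym/zcong_expD.
- apply: zcong_trans (zcong_mul IHa IHb) _.
  by apply: zcong_eq => R e; rewrite /= !zeval_exp exprMn.
Qed.

Lemma zcong_frobX t n : zcong (p ^ n.+1) (zexp (zfrob t) (p ^ n)) (zexp t (p ^ n.+1)).
Proof.
have p_gt0 := prime_gt0 p_pr.
elim: n => [|n IHn].
  rewrite expn0 !expn1; apply: zcong_trans (zcong_frob t).
  by apply: zcong_eq => R e; rewrite zeval_exp.
have H := zcong_expS p_gt0 (dvdn_exp (ltn0Sn n) (dvdnn p)) IHn.
rewrite -expnS in H.
apply: zcong_trans (zcong_trans H _).
  by apply: zcong_eq => R e; rewrite !zeval_exp -exprM -expnSr.
by apply: zcong_eq => R e; rewrite !zeval_exp -exprM -expnSr.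
Qed.

Lemma zcong_subst (U : Type) c (s s' : V -> zpoly U) t :
  (forall v, zcong c (s v) (s' v)) -> zcong c (zsubst s t) (zsubst s' t).
Proof.
move=> ss'; elim: t => /= [v||| a IHa | a IHa b IHb | a IHa b IHb] //.
- exact: zcong_refl.
- exact: zcong_refl.
- exact: zcong_opp.
- exact: zcong_add.
- exact: zcong_mul.
Qed.

End Frobenius.

(* the Witt polynomial w_n(x) = x_0^(p^n) + p x_1^(p^(n-1)) + ... + p^n x_n *)
Definition ghost (p n : nat) (R : comNzRingType) (x : nat -> R) : R :=
  \sum_(i < n.+1) (p ^ i)%:R * x i ^+ (p ^ (n - i)).

Section WittPolynomials.
Variables (p : nat) (p_pr : prime p) (I : Type).

Definition zghost_upto n m (x : nat -> zpoly (I * nat)) : zpoly (I * nat) :=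
  zsum [seq ZMul (znat _ (p ^ i)) (zexp (x i) (p ^ (n - i))) | i <- iota 0 m].

Lemma zeval_ghost_upto n m x (R : comNzRingType) (e : I * nat -> R) :
  zeval e (zghost_upto n m x) =
  \sum_(i < m) (p ^ i)%:R * zeval e (x i) ^+ (p ^ (n - i)).
Proof.
rewrite zeval_sum big_map -{1}[m]subn0 big_mkord.
by apply: eq_bigr => i _ /=; rewrite zeval_nat zeval_exp.
Qed.

Variable Phi : zpoly I.

Definition witt_spec n (phi : nat -> zpoly (I * nat)) :=
  forall (R : comNzRingType) (x : I * nat -> R),
    ghost p n (fun j => zeval x (phi j)) =
    zeval (fun i => ghost p n (fun j => x (i, j))) Phi.

Let zPhi n := zsubst
  (fun i => zghost_upto n n.+1 (fun j => ZVar (i, j))) Phi.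

Lemma witt_step n (phi : nat -> zpoly (I * nat)) :
  (forall m, (m < n)%N -> witt_spec m phi) ->
  zcong (p ^ n) (zPhi n) (zghost_upto n n phi).
Proof.
case: n => [|m] Hphi.
  exists (ZAdd (zPhi 0) (ZOpp (zghost_upto 0 0 phi))) => R e /=.
  by rewrite expn0; ring.
pose s i := zfrob p (zghost_upto m m.+1 (fun j => ZVar (i, j))).
apply: (zcong_trans (u := zsubst s Phi)).
  apply: zcong_subst => i; exists (ZVar (i, m.+1)) => R e.
  rewrite zeval_ghost_upto /s /zfrob zeval_subst zeval_ghost_upto big_ord_recr /=.
  rewrite subnn expn0 expr1; congr (_ + _); apply: eq_bigr => j _.
  rewrite zeval_exp /= -exprM -expnS subSn //.
  by rewrite -ltnS.
apply: (zcong_trans (u := zghost_upto m m.+1 (fun j => zfrob p (phi j)))).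
  apply: zcong_eq => R e; rewrite zeval_subst zeval_ghost_upto.
  pose e' v := e v ^+ p.
  have := Hphi m (ltnSn m) R e'; rewrite /ghost => H.
  transitivity (\sum_(i < m.+1) (p ^ i)%:R * zeval e' (phi i) ^+ (p ^ (m - i))).
    rewrite H; apply: zeval_ext => i.
    rewrite /s /zfrob zeval_subst zeval_ghost_upto; apply: eq_bigr => j _ /=.
    by rewrite zeval_exp.
  apply: eq_bigr => j _; congr (_ * _ ^+ _); rewrite /zfrob zeval_subst.
  by apply: zeval_ext => v; rewrite zeval_exp.
rewrite /zghost_upto.
have : forall i, i \in iota 0 m.+1 ->
  zcong (p ^ m.+1) (ZMul (znat (I * nat) (p ^ i)) (zexp (zfrob p (phi i)) (p ^ (m - i))))
   (ZMul (znat (I * nat) (p ^ i)) (zexp (phi i) (p ^ (m.+1 - i)))).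
  move=> i; rewrite mem_iota add0n leq0n /= ltnS => im.
  have := zcong_scale (p ^ i) (zcong_frobX p_pr (phi i) (m - i)).
  by rewrite -expnD addnS subnKC // subSn.
elim: (iota 0 m.+1) => [|i l IHl] Hs /=; first exact: zcong_refl.
apply: zcong_add; first by apply: Hs; rewrite inE eqxx.
by apply: IHl => j js; apply: Hs; rewrite inE js orbT.
Qed.

(* Witt's theorem: there are integer polynomials phi_n, in the indeterminates *)
(* X_(i,j), with w_n(phi_0, phi_1, ...) = Phi (w_n(X_(i,0), X_(i,1), ...))_i   *)
Lemma witt_polys_exist :
  exists phi : nat -> zpoly (I * nat), forall n, witt_spec n phi.
Proof.
have /choice[F HF] (sn : seq (zpoly (I * nat))) : exists t : zpoly (I * nat),
    let phi := nth ZZero sn in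
    let n := size sn in
    (forall m, (m < n)%N -> witt_spec m phi) ->
    forall (R : comNzRingType) (e : I * nat -> R),
      zeval e (zPhi n) = zeval e (zghost_upto n n phi) + (p ^ n)%:R * zeval e t.
  have [H|H] := pselect (forall m, (m < size sn)%N -> witt_spec m (nth ZZero sn)).
    by have [t Ht] := witt_step H; exists t.
  by exists ZZero => /= /H.
pose L := fix L n := if n is m.+1 then rcons (L m) (F (L m)) else [::].
pose phi n := F (L n).
have sL n : size (L n) = n by elim: n => //= n IHn; rewrite size_rcons IHn.
have nL n i : (i < n)%N -> nth ZZero (L n) i = phi i.
  elim: n => // n IHn; rewrite ltnS /= nth_rcons sL leq_eqVlt.
  by case/orP => [/eqP ->|lt_in]; rewrite ?ltnn ?eqxx // lt_in IHn.
exists phi => n; elim/ltn_ind: n => n IHn R x.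
have wE m psi : (forall j, (j <= m)%N -> psi j = phi j) ->
    witt_spec m phi -> witt_spec m psi.
  move=> E H R' y; rewrite -H; apply: eq_bigr => i _.
  by rewrite E // -ltnS.
have {HF}:= HF (L n); rewrite /= sL => HF.
have {}HF := HF (fun m mn => wE _ _ (fun j jm => nL _ _ (leq_ltn_trans jm mn)) (IHn m mn)).
have {}HF := HF R x.
rewrite /zPhi zeval_subst in HF.
rewrite (_ : zeval _ Phi = zeval x (zsubst
  (fun i => zghost_upto n n.+1 (fun j => ZVar (i, j))) Phi)); last first.
  by rewrite zeval_subst; apply: zeval_ext => i; rewrite zeval_ghost_upto.
rewrite zeval_subst HF zeval_ghost_upto /ghost big_ord_recr /= subnn expr1.
by congr (_ + _); apply: eq_bigr => i _; rewrite nL.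
Qed.

Definition witt_poly : nat -> zpoly (I * nat) := projT1 (cid witt_polys_exist).

Lemma witt_polyP n (R : comNzRingType) (x : I * nat -> R) :
  ghost p n (fun j => zeval x (witt_poly j)) =
  zeval (fun i => ghost p n (fun j => x (i, j))) Phi.
Proof. by rewrite /witt_poly; case: cid => phi /= ->. Qed.

End WittPolynomials.

Definition char_zero (R : comNzRingType) := forall n, n%:R = 0 :> R -> n = 0%N.

Lemma char_zero_cover (V : eqType) (R : comNzRingType) (e : V -> R)
    (s : seq V) :
  exists (B : idomainType) (f : {rmorphism B -> R}) (e' : V -> B),
    char_zero B /\ {in s, forall v, f (e' v) = e v}.
Proof.
elim: s => [|v s [B [f [e' [B0 fe]]]]].
  exists int, (intmul 1), (fun=> 0); split=> // n.
  by rewrite natz => /eqP; rewrite eqz_nat => /eqP.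
have cfu : commr_rmorph f (e v) by move=> a; exact: mulrC.
exists {poly B}, (horner_morph cfu), (fun w => if w == v then 'X else (e' w)%:P).
split=> [n | w].
  rewrite -[n%:R](rmorph_nat polyC) => /eqP; rewrite polyC_eq0 => /eqP.
  exact: B0.
rewrite inE; case: eqP => [-> _|_ /= /fe <-] /=; first exact: horner_morphX.
exact: horner_morphC.
Qed.

Fixpoint zvars (V : Type) (t : zpoly V) : seq V :=
  match t with
  | ZVar v => [:: v]
  | ZZero | ZOne => [::]
  | ZOpp a => zvars a
  | ZAdd a b | ZMul a b => zvars a ++ zvars b
  end.

Lemma zeval_vars (V : eqType) (R : comNzRingType) (e1 e2 : V -> R) t :
  {in zvars t, e1 =1 e2} -> zeval e1 t = zeval e2 t.
Proof.
elim: t => //= [v|a IHa|a IHa b IHb|a IHa b IHb] ee.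
- by apply: ee; rewrite inE eqxx.
- by rewrite IHa.
- by rewrite IHa ?IHb // => v vab; apply: ee; rewrite mem_cat vab ?orbT.
- by rewrite IHa ?IHb // => v vab; apply: ee; rewrite mem_cat vab ?orbT.
Qed.

Lemma zeval_char_zero (V : eqType) (t u : zpoly V) :
  (forall (B : idomainType) (e : V -> B),
     char_zero B -> zeval e t = zeval e u) ->
  forall (R : comNzRingType) (e : V -> R), zeval e t = zeval e u.
Proof.
move=> tu R e.
have [B [f [e' [B0 fe]]]] := char_zero_cover e (zvars t ++ zvars u).
have E w : {subset zvars w <= zvars t ++ zvars u} ->
    zeval e w = f (zeval e' w).
  by move=> ws; rewrite zeval_morph; apply: zeval_vars => v /ws /fe.
rewrite !E ?tu // => v vs; rewrite mem_cat vs ?orbT //.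
Qed.

Lemma ghost_inj (p : nat) (B : idomainType) (x y : nat -> B) :
  (0 < p)%N -> char_zero B ->
  (forall n, ghost p n x = ghost p n y) -> x =1 y.
Proof.
move=> p_gt0 B0 xy; elim/ltn_ind => n IHn.
have := xy n; rewrite /ghost !big_ord_recr /= subnn expn0 !expr1.
rewrite (eq_bigr (fun i : 'I_n => (p ^ i)%:R * y i ^+ (p ^ (n - i)))); last first.
  by move=> i _; rewrite IHn.
move/addrI/mulfI; apply; apply/eqP => /B0/eqP.
by rewrite expn_eq0 eqn0Ngt p_gt0.
Qed.

(* The p-typical Witt vectors. The phantom argument p_pr lets the ring         *)
(* structure depend on the primality of p. Addition, opposite and product are  *)
(* given by the universal integer polynomials of [witt_polyP], so that each    *)
(* ghost component w_n is a ring homomorphism: see [witt_ghostD].              *)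
Record witt (p : nat) (p_pr : prime p) (R : Type) :=
  Witt { witt_coef : nat -> R }.

Lemma witt_eqP (p : nat) (p_pr : prime p) (R : Type) (x y : witt p_pr R) :
  witt_coef x =1 witt_coef y -> x = y.
Proof. by case: x y => x [y] /= /funext ->. Qed.

HB.instance Definition _ (p : nat) (p_pr : prime p) (R : Type) :=
  gen_eqMixin (witt p_pr R).
HB.instance Definition _ (p : nat) (p_pr : prime p) (R : Type) :=
  gen_choiceMixin (witt p_pr R).

Section WittRing.
Variables (p : nat) (p_pr : prime p).

Definition witt_op (Phi : zpoly nat) (R : comNzRingType)
    (x : nat -> witt p_pr R) : witt p_pr R :=
  Witt p_pr (fun n =>
    zeval (fun v => witt_coef (x v.1) v.2) (witt_poly p_pr Phi n)).

Definition witt_env (R : Type) (x y : witt p_pr R) (i : nat) :=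
  if i is 0%N then x else y.

Section Ops.
Variable R : comNzRingType.
Implicit Types x y : witt p_pr R.

Definition witt0 : witt p_pr R := witt_op ZZero (fun=> Witt p_pr (fun=> 0)).
Definition witt1 : witt p_pr R := witt_op ZOne (fun=> Witt p_pr (fun=> 0)).
Definition witt_opp x := witt_op (ZOpp (ZVar 0%N)) (fun=> x).
Definition witt_add x y := witt_op (ZAdd (ZVar 0%N) (ZVar 1%N)) (witt_env x y).
Definition witt_mul x y := witt_op (ZMul (ZVar 0%N) (ZVar 1%N)) (witt_env x y).
End Ops.

Fixpoint witt_eval (R : comNzRingType) (x : nat -> witt p_pr R)
    (t : zpoly nat) : witt p_pr R :=
  match t with
  | ZVar i => x i
  | ZZero => witt0 R
  | ZOne => witt1 R
  | ZOpp a => witt_opp (witt_eval x a)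
  | ZAdd a b => witt_add (witt_eval x a) (witt_eval x b)
  | ZMul a b => witt_mul (witt_eval x a) (witt_eval x b)
  end.

Definition witt_ghost n (R : comNzRingType) (x : witt p_pr R) :=
  ghost p n (witt_coef x).

Lemma witt_ghost_op Phi n (R : comNzRingType) (x : nat -> witt p_pr R) :
  witt_ghost n (witt_op Phi x) = zeval (fun i => witt_ghost n (x i)) Phi.
Proof.
rewrite /witt_ghost /= (witt_polyP p_pr Phi n (fun v => witt_coef (x v.1) v.2)).
exact: zeval_ext.
Qed.

Lemma witt_ghost0 n R : witt_ghost n (witt0 R) = 0.
Proof. exact: witt_ghost_op. Qed.

Lemma witt_ghost1 n R : witt_ghost n (witt1 R) = 1.
Proof. exact: witt_ghost_op. Qed.

Lemma witt_ghostN n (R : comNzRingType) (x : witt p_pr R) :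
  witt_ghost n (witt_opp x) = - witt_ghost n x.
Proof. exact: witt_ghost_op. Qed.

Lemma witt_ghostD n (R : comNzRingType) (x y : witt p_pr R) :
  witt_ghost n (witt_add x y) = witt_ghost n x + witt_ghost n y.
Proof. exact: witt_ghost_op. Qed.

Lemma witt_ghostM n (R : comNzRingType) (x y : witt p_pr R) :
  witt_ghost n (witt_mul x y) = witt_ghost n x * witt_ghost n y.
Proof. exact: witt_ghost_op. Qed.

Lemma witt_ghost_eval t n (R : comNzRingType) (x : nat -> witt p_pr R) :
  witt_ghost n (witt_eval x t) = zeval (fun i => witt_ghost n (x i)) t.
Proof.
elim: t => /= [||| a <-|a <- b <-|a <- b <-] //.
- exact: witt_ghost0.
- exact: witt_ghost1.
- exact: witt_ghostN.
- exact: witt_ghostD.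
- exact: witt_ghostM.
Qed.

Lemma witt_eval_poly t n : exists q : zpoly (nat * nat),
  forall (R : comNzRingType) (x : nat -> witt p_pr R),
    witt_coef (witt_eval x t) n = zeval (fun v => witt_coef (x v.1) v.2) q.
Proof.
elim: t n => [i||| a IHa | a IHa b IHb | a IHa b IHb] n.
- by exists (ZVar (i, n)).
- exists (zsubst (fun=> ZZero) (witt_poly p_pr (@ZZero nat) n)) => R x.
  by rewrite zeval_subst.
- exists (zsubst (fun=> ZZero) (witt_poly p_pr (@ZOne nat) n)) => R x.
  by rewrite zeval_subst.
- have /choice[qa Ha] := IHa.
  exists (zsubst (fun v => qa v.2) (witt_poly p_pr (ZOpp (ZVar 0%N)) n)) => R x.
  by rewrite zeval_subst; apply: zeval_ext => v; rewrite Ha.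
- have [/choice[qa Ha] /choice[qb Hb]] := (IHa, IHb).
  exists (zsubst (fun v => if v.1 is 0%N then qa v.2 else qb v.2)
    (witt_poly p_pr (ZAdd (ZVar 0%N) (ZVar 1%N)) n)) => R x.
  by rewrite zeval_subst; apply: zeval_ext => -[[|i] j] /=; rewrite ?Ha ?Hb.
- have [/choice[qa Ha] /choice[qb Hb]] := (IHa, IHb).
  exists (zsubst (fun v => if v.1 is 0%N then qa v.2 else qb v.2)
    (witt_poly p_pr (ZMul (ZVar 0%N) (ZVar 1%N)) n)) => R x.
  by rewrite zeval_subst; apply: zeval_ext => -[[|i] j] /=; rewrite ?Ha ?Hb.
Qed.

(* every identity of commutative rings holds for the operations on witt R *)
Lemma witt_identity (t u : zpoly nat) :
  (forall (R : comNzRingType) (e : nat -> R), zeval e t = zeval e u) ->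
  forall (R : comNzRingType) (x : nat -> witt p_pr R),
    witt_eval x t = witt_eval x u.
Proof.
move=> tu R x; apply: witt_eqP => n.
have [[q Hq] [r Hr]] := (witt_eval_poly t n, witt_eval_poly u n).
rewrite Hq Hr; apply: zeval_char_zero => {x}B x B0.
pose X i := Witt p_pr (fun j => x (i, j)).
have E : witt_coef (witt_eval X t) =1 witt_coef (witt_eval X u).
  apply: (ghost_inj (prime_gt0 p_pr) B0) => m.
  by rewrite -!/(witt_ghost _ _) !witt_ghost_eval tu.
have := E n; rewrite Hq Hr => E1.
by rewrite (zeval_ext (e2 := fun v => witt_coef (X v.1) v.2)) ?E1;
  [apply: zeval_ext|]; case.
Qed.

Variable R : comNzRingType.
Implicit Types x y z : witt p_pr R.

Let env3 x y z i := if i is 0%N then x else if i is 1%N then y else z.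

Let X0 := ZVar 0%N.
Let X1 := ZVar 1%N.
Let X2 := ZVar 2%N.

Fact witt_addA : associative (@witt_add R).
Proof.
move=> x y z; apply: (@witt_identity (ZAdd X0 (ZAdd X1 X2))
  (ZAdd (ZAdd X0 X1) X2) _ R (env3 x y z)) => S e /=; ring.
Qed.

Fact witt_addC : commutative (@witt_add R).
Proof.
move=> x y; apply: (@witt_identity (ZAdd X0 X1) (ZAdd X1 X0) _ R
  (witt_env x y)) => S e /=; ring.
Qed.

Fact witt_add0 : left_id (witt0 R) (@witt_add R).
Proof.
move=> x; apply: (@witt_identity (ZAdd ZZero X0) X0 _ R (fun=> x)) => S e /=.
ring.
Qed.

Fact witt_addN : left_inverse (witt0 R) (@witt_opp R) (@witt_add R).
Proof.
move=> x; apply: (@witt_identity (ZAdd (ZOpp X0) X0) ZZero _ R (fun=> x)).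
move=> S e /=; ring.
Qed.

Fact witt_mulA : associative (@witt_mul R).
Proof.
move=> x y z; apply: (@witt_identity (ZMul X0 (ZMul X1 X2))
  (ZMul (ZMul X0 X1) X2) _ R (env3 x y z)) => S e /=; ring.
Qed.

Fact witt_mulC : commutative (@witt_mul R).
Proof.
move=> x y; apply: (@witt_identity (ZMul X0 X1) (ZMul X1 X0) _ R
  (witt_env x y)) => S e /=; ring.
Qed.

Fact witt_mul1 : left_id (witt1 R) (@witt_mul R).
Proof.
move=> x; apply: (@witt_identity (ZMul ZOne X0) X0 _ R (fun=> x)) => S e /=.
ring.
Qed.

Fact witt_mulD : left_distributive (@witt_mul R) (@witt_add R).
Proof.
move=> x y z; apply: (@witt_identity (ZMul (ZAdd X0 X1) X2)
  (ZAdd (ZMul X0 X2) (ZMul X1 X2)) _ R (env3 x y z)) => S e /=; ring.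
Qed.

Lemma witt_ghost_coef0 x : witt_ghost 0%N x = witt_coef x 0%N.
Proof. by rewrite /witt_ghost /ghost big_ord1 /= mul1r expr1. Qed.

Fact witt_1neq0 : witt1 R != witt0 R.
Proof.
apply/eqP => /(congr1 (@witt_ghost 0%N R)); rewrite witt_ghost1 witt_ghost0.
by move/eqP; rewrite oner_eq0.
Qed.

HB.instance Definition _ := GRing.isZmodule.Build (witt p_pr R)
  witt_addA witt_addC witt_add0 witt_addN.
HB.instance Definition _ := GRing.Zmodule_isComNzRing.Build (witt p_pr R)
  witt_mulA witt_mulC witt_mul1 witt_mulD witt_1neq0.

(* the reduction W(R) -> R, x |-> x_0 *)
Definition witt_red x : R := witt_coef x 0%N.

Fact witt_red_additive : zmod_morphism witt_red.
Proof.
move=> x y; rewrite /witt_red -!witt_ghost_coef0.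
by rewrite [LHS]witt_ghostD witt_ghostN.
Qed.

Fact witt_red_multiplicative : monoid_morphism witt_red.
Proof.
split=> [|x y]; rewrite /witt_red -!witt_ghost_coef0; first exact: witt_ghost1.
exact: witt_ghostM.
Qed.

HB.instance Definition _ :=
  GRing.isZmodMorphism.Build (witt p_pr R) R witt_red witt_red_additive.
HB.instance Definition _ :=
  GRing.isMonoidMorphism.Build (witt p_pr R) R witt_red witt_red_multiplicative.

End WittRing.

Record fps (A : Type) := Fps { fps_coef : nat -> A }.

Lemma fps_eqP (A : Type) (f g : fps A) : fps_coef f =1 fps_coef g -> f = g.
Proof. by case: f g => f [g] /= /funext ->. Qed.

HB.instance Definition _ (A : Type) := gen_eqMixin (fps A).
HB.instance Definition _ (A : Type) := gen_choiceMixin (fps A).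

Definition fps_map (A B : Type) (h : A -> B) (f : fps A) : fps B :=
  Fps (fun n => h (fps_coef f n)).

Section FpsRing.
Variable A : comNzRingType.
Implicit Types f g h : fps A.

Definition fps_const (a : A) : fps A := Fps (fun n => if n == 0%N then a else 0).
Definition fps_var : fps A := Fps (fun n => if n == 1%N then 1 else 0).
Definition fps_opp f : fps A := Fps (fun n => - fps_coef f n).
Definition fps_add f g : fps A := Fps (fun n => fps_coef f n + fps_coef g n).
Definition fps_mul f g : fps A :=
  Fps (fun n => \sum_(i < n.+1) fps_coef f i * fps_coef g (n - i)).
Definition fps_scale (a : A) f : fps A := Fps (fun n => a * fps_coef f n).

Fact fps_addA : associative fps_add.
Proof. by move=> f g h; apply: fps_eqP => n; apply: addrA. Qed.

Fact fps_addC : commutative fps_add.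
Proof. by move=> f g; apply: fps_eqP => n; apply: addrC. Qed.

Fact fps_add0 : left_id (fps_const 0) fps_add.
Proof. by move=> f; apply: fps_eqP => n /=; rewrite if_same add0r. Qed.

Fact fps_addN : left_inverse (fps_const 0) fps_opp fps_add.
Proof. by move=> f; apply: fps_eqP => n /=; rewrite if_same addNr. Qed.

HB.instance Definition _ :=
  GRing.isZmodule.Build (fps A) fps_addA fps_addC fps_add0 fps_addN.

Let trunc n f : {poly A} := \poly_(i < n) fps_coef f i.

Let coef_trunc n f i : (i < n)%N -> (trunc n f)`_i = fps_coef f i.
Proof. by move=> lt_in; rewrite coef_poly lt_in. Qed.

Let coef_mul_trunc n f g i : (i < n)%N ->
  fps_coef (fps_mul f g) i = (trunc n f * trunc n g)`_i.
Proof.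
move=> lt_in; rewrite coefM; apply: eq_bigr => j _.
rewrite !coef_trunc ?(leq_ltn_trans _ lt_in) ?leq_subr //.
by rewrite -ltnS.
Qed.

Fact fps_mulA : associative fps_mul.
Proof.
move=> f g h; apply: fps_eqP => n.
transitivity (trunc n.+1 f * (trunc n.+1 g * trunc n.+1 h))`_n.
  rewrite coefM; apply: eq_bigr => i _.
  by rewrite (@coef_mul_trunc n.+1) ?coef_trunc // ltnS leq_subr.
rewrite mulrA coefM; apply: eq_bigr => i _.
by rewrite (@coef_mul_trunc n.+1) ?coef_trunc // ltnS leq_subr.
Qed.

Fact fps_mulC : commutative fps_mul.
Proof.
move=> f g; apply: fps_eqP => n.
by rewrite !(@coef_mul_trunc n.+1) // mulrC.
Qed.

Fact fps_mul1 : left_id (fps_const 1) fps_mul.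
Proof.
move=> f; apply: fps_eqP => n /=.
by rewrite big_ord_recl /= mul1r subn0 big1 ?addr0 // => i _; rewrite mul0r.
Qed.

Fact fps_mulD : left_distributive fps_mul fps_add.
Proof.
move=> f g h; apply: fps_eqP => n /=; rewrite -big_split /=.
by apply: eq_bigr => i _; rewrite mulrDl.
Qed.

Fact fps_1neq0 : fps_const 1 != 0.
Proof.
by apply/eqP => /(congr1 (fun f => fps_coef f 0%N)) /eqP; rewrite oner_eq0.
Qed.

HB.instance Definition _ := GRing.Zmodule_isComNzRing.Build (fps A)
  fps_mulA fps_mulC fps_mul1 fps_mulD fps_1neq0.

Fact fps_scaleA a b f : fps_scale a (fps_scale b f) = fps_scale (a * b) f.
Proof. by apply: fps_eqP => n /=; rewrite mulrA. Qed.

Fact fps_scale1 : left_id 1 fps_scale.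
Proof. by move=> f; apply: fps_eqP => n /=; rewrite mul1r. Qed.

Fact fps_scaleDr : right_distributive fps_scale +%R.
Proof. by move=> a f g; apply: fps_eqP => n; apply: mulrDr. Qed.

Fact fps_scaleDl f : {morph fps_scale^~ f : a b / a + b}.
Proof. by move=> a b; apply: fps_eqP => n; apply: mulrDl. Qed.

HB.instance Definition _ := GRing.Zmodule_isLmodule.Build A (fps A)
  fps_scaleA fps_scale1 fps_scaleDr fps_scaleDl.

Fact fps_scaleAl (a : A) f g : a *: (f * g) = a *: f * g.
Proof.
apply: fps_eqP => n /=; rewrite mulr_sumr.
by apply: eq_bigr => i _; rewrite mulrA.
Qed.

HB.instance Definition _ := GRing.Lmodule_isLalgebra.Build A (fps A) fps_scaleAl.
HB.instance Definition _ := GRing.Lalgebra_isComAlgebra.Build A (fps A).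

Definition alg_aut (s : fps A -> fps A) :=
  [/\ linear s, monoid_morphism s & bijective s].

(* ord_y(f) > n; in particular ord_y(0) is infinite *)
Definition ord_gt n f := forall i, (i <= n)%N -> fps_coef f i = 0.

End FpsRing.

Section Actions.
Variables (A : comNzRingType) (gT : finGroupType) (rho : gT -> fps A -> fps A).

Definition fps_action :=
  (forall g, alg_aut (rho g)) /\
  (forall g h f, rho (g * h)%g f = rho g (rho h f)).

Definition faithful_action := forall g h, rho g =1 rho h -> g = h.

Definition ramification2 : {set gT} :=
  [set g | `[< ord_gt 2 (rho g (fps_var A) - fps_var A) >]].

Definition weak_action := ramification2 = 1%g.

End Actions.

Section LocalRings.
Variable A : comNzRingType.
Implicit Types (a b : A) (I : A -> Prop).

Definition max_ideal a := ~ exists b, a * b = 1.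

Definition is_ideal I :=
  [/\ I 0, forall a b, I a -> I b -> I (a + b) & forall a b, I b -> I (a * b)].

Definition ideal_gen (S : A -> Prop) a := exists s : seq (A * A),
  (forall u, u \in s -> S u.2) /\ a = \sum_(u <- s) u.1 * u.2.

Fixpoint ideal_pow I n : A -> Prop :=
  if n is m.+1 then
    ideal_gen (fun x => exists a b, [/\ I a, ideal_pow I m b & x = a * b])
  else fun=> True.

Definition local_ring := is_ideal max_ideal.

Definition noetherian := forall I, is_ideal I ->
  exists s : seq A, forall a, I a <-> ideal_gen (fun b => b \in s) a.

Definition artinian := forall J : nat -> A -> Prop,
  (forall n, is_ideal (J n)) -> (forall n a, J n.+1 a -> J n a) ->
  exists m, forall n, (m <= n)%N -> forall a, J m a -> J n a.

(* A -> lim A / M_A^n is bijective *)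
Definition complete_ring :=
  (forall a, (forall n, ideal_pow max_ideal n a) -> a = 0) /\
  (forall u : nat -> A, (forall n, ideal_pow max_ideal n (u n.+1 - u n)) ->
     exists l, forall n, ideal_pow max_ideal n (l - u n)).

(* n is the non-negative generator of the kernel of Z -> A *)
Definition has_car (n : nat) := forall m : int,
  m%:~R = 0 :> A <-> (n%:Z %| m)%Z.

End LocalRings.

Definition perfect_of_char (p : nat) (k : fieldType) :=
  p \in [pchar k] /\ forall x : k, exists y, y ^+ p = x.

(* [cln_res] identifies the residue field of A with k as W(k)-algebras; it is *)
(* surjective because W(k) -> k is. Objects of C_k are those which satisfy    *)
(* [artinian].                                                                *)
Record cln_alg (p : nat) (p_pr : prime p) (k : fieldType) := ClnAlg {
  cln_sort :> comAlgType (witt p_pr k);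
  cln_res : {rmorphism cln_sort -> k};
  cln_local : local_ring cln_sort;
  cln_noetherian : noetherian cln_sort;
  cln_complete : complete_ring cln_sort;
  cln_res_ker : forall a, cln_res a = 0 <-> max_ideal a;
  cln_res_alg : forall w : witt p_pr k, cln_res w%:A = witt_red w
}.

(* Homomorphisms of W(k)-algebras are automatically local and compatible with *)
(* the residue maps, so the morphisms of C^_k are the {lrmorphism A -> B}.    *)
Lemma cln_res_morph (p : nat) (p_pr : prime p) (k : fieldType)
    (A B : cln_alg p_pr k) (f : {lrmorphism A -> B}) (a : A) :
  cln_res B (f a) = cln_res A a.
Proof.
pose w := Witt p_pr (fun=> cln_res A a).
have ker0 : cln_res A (a - w%:A) = 0.
  by rewrite rmorphB cln_res_alg subrr.
suff : cln_res B (f (a - w%:A)) = 0.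
  rewrite !rmorphB /= rmorph_alg cln_res_alg.
  by move/eqP; rewrite subr_eq0 => /eqP.
set b := a - _ in ker0 *.
apply/eqP/negP => /negP nz.
pose w' := Witt p_pr (fun=> cln_res B (f b)).
have : ~ max_ideal (b - w'%:A).
  move/cln_res_ker; rewrite rmorphB /= ker0 cln_res_alg sub0r => /eqP.
  by rewrite oppr_eq0; apply/negP.
move/contrapT => [c /(congr1 (cln_res B \o f))] /=.
have E : cln_res B (f (b - w'%:A)) = 0.
  by rewrite (rmorphB f) (rmorphB (cln_res B)) /= rmorph_alg cln_res_alg subrr.
rewrite (rmorphM f) (rmorphM (cln_res B)) /= E mul0r !rmorph1 => /eqP.
by rewrite eq_sym oner_eq0.
Qed.

Section Deformations.
Variables (p : nat) (p_pr : prime p) (k : fieldType) (gT : finGroupType).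
Variable rho : gT -> fps k -> fps k.
Implicit Types A B R E : cln_alg p_pr k.

Definition is_lift A (rhoA : gT -> fps A -> fps A) :=
  fps_action rhoA /\
  forall g f, fps_map (cln_res A) (rhoA g f) = rho g (fps_map (cln_res A) f).

Definition lift_equiv A (rho1 rho2 : gT -> fps A -> fps A) :=
  exists psi : fps A -> fps A,
    [/\ alg_aut psi,
        forall f, fps_map (cln_res A) (psi f) = fps_map (cln_res A) f
      & forall g f, psi (rho1 g f) = rho2 g (psi f)].

Definition lifts_to_car0 := exists A,
  has_car A 0 /\ exists rhoA : gT -> fps A -> fps A, is_lift rhoA.

Definition lifts_to_carp2 := exists A, artinian A /\
  has_car A (p ^ 2) /\ exists rhoA : gT -> fps A -> fps A, is_lift rhoA.

(* For B in C^_k, B-algebra endomorphisms of B[[y]] are continuous, hence      *)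
(* determined by the image of y: there is exactly one such lift rhoB for each  *)
(* lift rhoA.                                                                  *)
Definition base_change A B (q : {lrmorphism A -> B})
    (rhoA : gT -> fps A -> fps A) (rhoB : gT -> fps B -> fps B) :=
  forall g f, rhoB g (fps_map q f) = fps_map q (rhoA g f).

(* D_G(q) maps the class of rhoA to the class of rhoB *)
Definition def_map A B (q : {lrmorphism A -> B})
    (rhoA : gT -> fps A -> fps A) (rhoB : gT -> fps B -> fps B) :=
  exists rho' : gT -> fps B -> fps B,
    [/\ is_lift rho', base_change q rhoA rho' & lift_equiv rho' rhoB].

(* An element of lim_n D_G(R / M_R^n): [fd_ring n] is R / M_R^(n+1), and      *)
(* [fd_lift n] is a representative of the n-th class.                         *)
Record formal_def R := FormalDef {
  fd_ring : nat -> cln_alg p_pr k;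
  fd_proj : forall n, {lrmorphism R -> fd_ring n};
  fd_proj_surj : forall n b, exists a, fd_proj n a = b;
  fd_proj_ker : forall n a,
    fd_proj n a = 0 <-> ideal_pow (@max_ideal R) n.+1 a;
  fd_trans : forall n, {lrmorphism fd_ring n.+1 -> fd_ring n};
  fd_transP : forall n a, fd_trans n (fd_proj n.+1 a) = fd_proj n a;
  fd_lift : forall n, gT -> fps (fd_ring n) -> fps (fd_ring n);
  fd_liftP : forall n, is_lift (@fd_lift n);
  fd_compat : forall n, def_map (fd_trans n) (@fd_lift n.+1) (@fd_lift n)
}.

Arguments fd_lift {R} xi n _ _ : rename.

(* The morphism h_R -> D_G induced by xi, on A in C_k: u : R -> A factors     *)
(* through some R / M_R^(n+1), and is sent to the image of the n-th class.    *)
Definition induced_class R (xi : formal_def R) A (u : {lrmorphism R -> A})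
    (rhoA : gT -> fps A -> fps A) :=
  exists n, exists v : {lrmorphism fd_ring xi n -> A},
    (forall a, v (fd_proj xi n a) = u a) /\ def_map v (fd_lift xi n) rhoA.

(* h_R(B) -> h_R(A) x_(D_G(A)) D_G(B) is onto for each surjection B -> A      *)
Definition formally_smooth R (xi : formal_def R) :=
  forall A B, artinian A -> artinian B ->
  forall q : {lrmorphism B -> A}, (forall a, exists b, q b = a) ->
  forall (u : {lrmorphism R -> A}) (rhoA : gT -> fps A -> fps A)
         (rhoB : gT -> fps B -> fps B),
    is_lift rhoA -> is_lift rhoB ->
    induced_class xi u rhoA -> def_map q rhoB rhoA ->
  exists u' : {lrmorphism R -> B},
    (forall a, q (u' a) = u a) /\ induced_class xi u' rhoB.

(* E is the ring k[eps] of dual numbers, as a W(k)-algebra *)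
Definition dual_numbers E :=
  exists (c : {rmorphism k -> E}) (eps : E),
    [/\ eps * eps = 0,
        forall w : witt p_pr k, w%:A = c (witt_red w)
      & forall x : E, exists! ab : k * k, x = c ab.1 + c ab.2 * eps].

Definition tangent_bijective R (xi : formal_def R) :=
  forall E, dual_numbers E ->
    (forall (u1 u2 : {lrmorphism R -> E}) (rhoE : gT -> fps E -> fps E),
       is_lift rhoE -> induced_class xi u1 rhoE -> induced_class xi u2 rhoE ->
       u1 =1 u2) /\
    (forall rhoE : gT -> fps E -> fps E, is_lift rhoE ->
       exists u : {lrmorphism R -> E}, induced_class xi u rhoE).

Definition versal_ring R :=
  exists xi : formal_def R, formally_smooth xi /\ tangent_bijective xi.

End Deformations.

Definition liftable_form (p : nat) (gT : finGroupType) : Prop :=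
  [\/ ([set: gT] \isog Zp p)%g,
      ((2 < p)%N /\ ([set: gT] \isog 'D_p.*2)%g) \/
      (p = 2%N /\ ([set: gT] \isog [set: 'Z_2 * 'Z_2])%g)
    | p = 2%N /\ ([set: gT] \isog 'Alt_('I_4))%g].

(* Main.v *)
From HB Require Import structures.
Require Import Defs.
From mathcomp Require Import all_boot all_order all_algebra.
From mathcomp Require Import all_fingroup all_solvable.
From mathcomp Require Import boolp ring zify.

Set Implicit Arguments.
Unset Strict Implicit.
Unset Printing Implicit Defensive.

(* Non-lifting. Let A be a local ring with nilpotent maximal ideal M, and let
   a lift of the action to A send y to y + D_g. Weakness says that D_g, for g
   wild, reduces to y^2 times a unit, so A[[y]]/(D_g) is free with basis 1, y
   by Weierstrass division. In such quotients the multiplier nu, defined by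
   g D = D (1 + nu), controls the orbit of y: g^p y = y becomes a relation
   between nu^(p-1) and p. Comparing coefficients kills p as soon as the wild
   group is too large, or a tame element normalises <g> with t g t^-1 = g^j and
   j^2 <> 1 in k, or, for p = 2, there are three involutions whose leading
   coefficients do not add up to 0. The groups that escape are the liftable
   forms.

   Lifting. Over k the wild part acts by homographies in a suitable coordinate
   z: z |-> z/(1+z) for order p, and z |-> z/(1+z), z/(1+cz) for the Klein
   group, a tame element acting by a scalar. The homography z |-> (z+x)/(1+z)
   has order p when sum_j C(p, 2j+1) x^j = 0, which is an Eisenstein polynomial
   over W(k) for p odd; for p = 2 suitable homographies exist over W(k) itself.
   They generate a lift to the Eisenstein extension, of characteristic 0.

   Versal ring. If the action does not lift to p <> 0, then p vanishes in each
   R/M^(n+1), hence in R. Otherwise formal smoothness along B -> k gives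
   W(k)-algebra morphisms R -> B for B running over the Artinian quotients of
   the Eisenstein extension, whose kernels intersect Z trivially. *)

(** * Recognition of the tetrahedral group *)

(** An automorphism of A[[y]] is an abstract algebra map, with no continuity assumed, so nothing can
    be computed term by term on a whole series. When M is nilpotent, algebra replaces continuity:
    each D divides a fixed power of y, and high powers of y + D are divisible by a given power of y,
    so the image of a tail is an explicit multiple of D. Everything about a wild g is thus phrased
    as a divisibility by D, and p disappears because a constant divisible by D is 0.

    For lifts of an element s of order p, the coordinate comes from the nilpotent operator s - 1 on
    k[[y]]. Its last two nonzero iterates G and t on a parameter satisfy s t = t and s G = G + t, so
    s moves t / (G + const t) by a homography; the Klein group is treated with both operators at
    once. The parameter is first made an eigenvector of a tame element, and the constant is chosen
    so that this element fixes the denominator. *)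

Section TetrahedralRecognition.
Import GroupScope.
Variables (gT : finGroupType) (P : {group gT}) (t : gT).
Hypotheses (oG : #|gT| = 12) (oP : #|P| = 4) (ot : #[t] = 3).
Hypothesis P_normal : P <| [set: gT].
Hypothesis conj_neq : forall s, s \in P -> s != 1 -> t * s * t^-1 != s.
Hypothesis conj_mul : forall s, s \in P -> s != 1 ->
  t * (t * s * t^-1) * t^-1 = s * (t * s * t^-1).
Let H := <[t]>%G.

Let tiPH : P :&: H = 1.
Proof. by apply: coprime_TIg; rewrite oP -orderE ot. Qed.

Let PH x : x \in P * H.
Proof.
suff -> : P * H = [set: gT] by [].
apply/eqP; rewrite eqEcard subsetT cardsT oG TI_cardMg //=.
by rewrite oP -orderE ot.
Qed.

Let e (i : 'I_4) : gT := nth 1 (enum P) i.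
Let rk (x : gT) : 'I_4 := inord (index x (enum P)).

Let sP : size (enum P) = 4. Proof. by rewrite -cardE. Qed.
Let eP i : e i \in P.
Proof. by rewrite -mem_enum mem_nth // sP. Qed.
Let eK i : rk (e i) = i.
Proof.
have E : index (e i) (enum P) = i by rewrite index_uniq ?sP ?enum_uniq.
by rewrite /rk E inord_val.
Qed.

Let conjP g x : x \in P -> g * x * g^-1 \in P.
Proof.
move=> xP; rewrite (_ : g * x * g^-1 = x ^ g^-1); last by rewrite conjgE invgK mulgA.
by rewrite memJ_norm // (subsetP (normal_norm P_normal)) ?in_setT.
Qed.

Let rkK x : x \in P -> e (rk x) = x.
Proof.
rewrite -mem_enum => xP; rewrite /e /rk inordK ?nth_index //.
by rewrite -sP index_mem.
Qed.

(** P is a transversal of the left cosets of H, so these four cosets are numbered by P, and G acts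
    on them by left translation. *)
Let coset_rep x := divgr P H x.

Let rep_mul g x : coset_rep (g * coset_rep x) = coset_rep (g * x).
Proof.
have -> : g * x = g * coset_rep x * remgr P H x by rewrite -mulgA -divgr_eq.
set u := g * _.
rewrite [X in _ = coset_rep (X * _)](divgr_eq P H u) -mulgA.
rewrite /coset_rep [RHS](divgrMid tiPH) ?mem_divgr //.
by rewrite groupM ?mem_remgr.
Qed.

(** The inverse turns the left action into a right one, as the composition order of permutations
    requires. *)
Let pf g (i : 'I_4) := rk (coset_rep (g^-1 * e i)).

Let pfM g h i : pf (g * h) i = pf h (pf g i).
Proof. by rewrite /pf rkK ?mem_divgr // rep_mul mulgA invMg. Qed.

Let pf1 i : pf 1 i = i.
Proof. by rewrite /pf invg1 mul1g /coset_rep divgr_id. Qed.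

Let pf_inj g : injective (pf g).
Proof. by apply: (can_inj (g := pf g^-1)) => i; rewrite -pfM mulgV pf1. Qed.

Let f g : 'S_4 := perm (@pf_inj g).

Let fM : {in [set: gT] &, {morph f : g h / g * h}}.
Proof. by move=> g h _ _; apply/permP => i; rewrite permM !permE pfM. Qed.

Canonical tetrahedral_morphism := Morphism fM.

(** An element of the kernel fixes the coset H, hence lies in H; fixing the other cosets, it
    commutes with P. But t and t^2 move every s <> 1 of P. *)
Let f_injm : 'injm tetrahedral_morphism.
Proof.
apply/subsetP => g /mker /= fg1.
have fix_e x : x \in P -> coset_rep (g^-1 * x) = x.
  move=> xP; have := congr1 (fun s : 'S_4 => e (s (rk x))) fg1.
  by rewrite perm1 permE /pf !rkK // mem_divgr.
have gH : g^-1 \in H.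
  have := fix_e 1 (group1 P); rewrite mulg1 => g1.
  by rewrite (divgr_eq P H g^-1) -/(coset_rep _) g1 mul1g mem_remgr.
have gC x : x \in P -> g * x * g^-1 = x.
  move=> xP; have gxP := conjP g xP.
  have := fix_e _ gxP; rewrite -mulgA mulKg /coset_rep (divgrMid tiPH) //.
have : g \in H by rewrite -[g]invgK groupV.
case/cycleP => n gE; apply/set1P.
have [|nz] := eqVneq (n %% 3)%N 0%N.
  by move=> n0; rewrite gE -(expg_mod_order t n) ot n0.
have [s sP' s1] : exists2 s, s \in P & s != 1.
  by apply/trivgPn; rewrite -cardG_gt1 oP.
have := gC s sP'; rewrite gE -(expg_mod_order t n) ot.
have : (n %% 3 < 3)%N by rewrite ltn_mod.
case: (n %% 3)%N nz => [|[|[|]]] // _ _.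
  by rewrite expg1 => /eqP; rewrite (negPf (conj_neq sP' s1)).
rewrite expgS expg1 invMg !mulgA => E.
have := conj_mul sP' s1; rewrite !mulgA E -!mulgA => /esym/(canRL (mulKg s)).
rewrite mulVg => E1; case/negP: s1; apply/eqP.
have <- : t^-1 * (t * (s * t^-1)) * t = s by rewrite mulKg mulgKV.
by rewrite E1 mulg1 mulVg.
Qed.

(** All signs are even: t = t^4 is a square, and [conj_mul] writes a conjugate of s as the product
    of s and another conjugate of s. Counting 12 elements does the rest. *)
Lemma tetrahedral_isog : [set: gT] \isog 'Alt_('I_4).
Proof.
pose od g := odd_perm (f g).
have odM g h : od (g * h) = od g (+) od h by rewrite /od fM ?inE // odd_permM.
have od1 : od 1 = false by rewrite /od morph1 odd_perm1.
have odC g h : od (g * h * g^-1) = od h.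
  have := odM g g^-1; rewrite mulgV od1 => /esym gV.
  rewrite !odM addbAC gV //.
have odt : od t = false.
  have -> : t = (t * t) * (t * t).
    rewrite -[LHS]mulg1 -(expg_order t) ot !expgS expg0 mulg1 !mulgA //.
  by rewrite odM addbb.
have odP s : s \in P -> od s = false.
  move=> sP'; have [->|s1] := eqVneq s 1; first exact: od1.
  have := conj_mul sP' s1 => /(congr1 od).
  by rewrite odC odC odM odC addbb.
have odH x : x \in H -> od x = false.
  case/cycleP => n ->; elim: n => [|n IHn]; first exact: od1.
  by rewrite expgS odM odt.
have sub : tetrahedral_morphism @* [set: gT] \subset 'Alt_('I_4).
  apply/subsetP => _ /morphimP[g _ _ ->]; rewrite Alt_even.
  have /mulsgP[x z xP zH ->] := PH g.
  by rewrite -/(od _) odM odP // odH.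
have cA : #|'Alt_('I_4)| = 12.
  by have := @card_Alt 'I_4; rewrite card_ord mul2n => /(_ isT) /(congr1 half); rewrite doubleK.
have <- : tetrahedral_morphism @* [set: gT] = 'Alt_('I_4).
  apply/eqP; rewrite eqEcard sub /= card_injm ?subsetT //.
  by rewrite cardsT oG cA.
exact: sub_isog.
Qed.

End TetrahedralRecognition.

Import GRing.Theory.
Local Open Scope ring_scope.

(** * Power series and ideal-adic filtrations *)

Section FpsBasics.
Variable A : comNzRingType.
Implicit Types (f g h : fps A) (a b : A).
Local Notation y := (fps_var A).

Lemma coef_fpsD f g n : fps_coef (f + g) n = fps_coef f n + fps_coef g n.
Proof. by []. Qed.
Lemma coef_fpsN f n : fps_coef (- f) n = - fps_coef f n.
Proof. by []. Qed.
Lemma coef_fpsB f g n : fps_coef (f - g) n = fps_coef f n - fps_coef g n.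
Proof. by []. Qed.
Lemma coef_fpsZ a f n : fps_coef (a *: f) n = a * fps_coef f n.
Proof. by []. Qed.
Lemma coef_fps0 n : fps_coef (0 : fps A) n = 0.
Proof. by rewrite /= if_same. Qed.
Lemma coef_fps1 n : fps_coef (1 : fps A) n = (n == 0%N)%:R.
Proof. by rewrite /=; case: eqP. Qed.
Lemma coef_fpsM f g n :
  fps_coef (f * g) n = \sum_(i < n.+1) fps_coef f i * fps_coef g (n - i).
Proof. by []. Qed.
Lemma coef_fps_sum (I : Type) (r : seq I) (P : pred I) (F : I -> fps A) n :
  fps_coef (\sum_(i <- r | P i) F i) n = \sum_(i <- r | P i) fps_coef (F i) n.
Proof.
apply: (big_morph (fun f => fps_coef f n)) => //; exact: coef_fps0.
Qed.

Lemma fps_scaleE a f : a *: f = a%:A * f.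
Proof. by rewrite -scalerAl mul1r. Qed.

Lemma fps_scaleC a f : a *: f = fps_const a * f.
Proof.
apply: fps_eqP => n; rewrite coef_fpsM big_ord_recl /= subn0 big1 ?addr0 // => i _.
by rewrite mul0r.
Qed.
Lemma fps_constD a b : fps_const (a + b) = fps_const a + fps_const b.
Proof. by apply: fps_eqP => -[|n] //=; rewrite addr0. Qed.
Lemma fps_constN a : fps_const (- a) = - fps_const a.
Proof. by apply: fps_eqP => -[|n] //=; rewrite oppr0. Qed.
Lemma fps_constM a b : fps_const (a * b) = fps_const a * fps_const b.
Proof. by rewrite -fps_scaleC; apply: fps_eqP => -[|n] //=; rewrite mulr0. Qed.

Lemma coef_fps0M f g : fps_coef (f * g) 0 = fps_coef f 0 * fps_coef g 0.
Proof. by rewrite coef_fpsM big_ord1. Qed.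
Lemma coef_fps1M f g : fps_coef (f * g) 1 =
  fps_coef f 0 * fps_coef g 1 + fps_coef f 1 * fps_coef g 0.
Proof. by rewrite coef_fpsM !big_ord_recl big_ord0 /= addr0. Qed.
Lemma coef_fps2M f g : fps_coef (f * g) 2 = fps_coef f 0 * fps_coef g 2 +
  fps_coef f 1 * fps_coef g 1 + fps_coef f 2 * fps_coef g 0.
Proof. by rewrite coef_fpsM !big_ord_recl big_ord0 /= addr0 addrA. Qed.

Lemma coef_varM f n :
  fps_coef (y * f) n = if n is m.+1 then fps_coef f m else 0.
Proof.
rewrite coef_fpsM; case: n => [|n]; first by rewrite big_ord1 /= mul0r.
rewrite big_ord_recl big_ord_recl /= mul0r add0r mul1r /bump /= subn1 /=.
by rewrite big1 ?addr0 // => i _; rewrite mul0r.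
Qed.

Lemma coef_varXM n f i :
  fps_coef (y ^+ n * f) i = if (i < n)%N then 0 else fps_coef f (i - n).
Proof.
elim: n i => [|n IHn] i; first by rewrite expr0 mul1r subn0.
by rewrite exprS -mulrA coef_varM; case: i => // i; rewrite IHn ltnS subSS.
Qed.

Lemma coef_varX n i : fps_coef (y ^+ n) i = (i == n)%:R.
Proof.
rewrite -[y ^+ n]mulr1 coef_varXM coef_fps1 subn_eq0.
by case: ltngtP => // ->; rewrite leqnn.
Qed.

Definition fps_shift n f : fps A := Fps (fun i => fps_coef f (n + i)).

Lemma fps_decomp n f :
  f = \sum_(i < n) fps_coef f i *: y ^+ i + y ^+ n * fps_shift n f.
Proof.
apply: fps_eqP => i; rewrite coef_fpsD coef_varXM coef_fps_sum.
under eq_bigr => j _ do rewrite coef_fpsZ coef_varX.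
case: ltnP => [lt_in | le_ni].
  rewrite (bigD1 (Ordinal lt_in)) //= eqxx mulr1 big1 ?addr0 // => j.
  by rewrite -val_eqE /= eq_sym => /negPf ->; rewrite mulr0.
rewrite big1 /= ?add0r ?subnKC // => j _.
by rewrite gtn_eqF ?mulr0 // (leq_trans (ltn_ord j)).
Qed.

Lemma fps_decomp_ord n f : (forall i, (i < n)%N -> fps_coef f i = 0) ->
  f = y ^+ n * fps_shift n f.
Proof.
move=> f0; rewrite {1}(fps_decomp n f) big1 ?add0r // => i _.
by rewrite f0 ?scale0r.
Qed.

Lemma fps_var_inj f g : y * f = y * g -> f = g.
Proof.
move=> fg; apply: fps_eqP => n.
by have := congr1 (fun h => fps_coef h n.+1) fg; rewrite !coef_varM.
Qed.

Lemma fps_varX_inj n f g : y ^+ n * f = y ^+ n * g -> f = g.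
Proof.
elim: n => [|n IHn]; first by rewrite !expr0 !mul1r.
by rewrite exprS -!mulrA => /fps_var_inj.
Qed.

Lemma fps_inv f b : fps_coef f 0 * b = 1 -> exists g, f * g = 1.
Proof.
move=> f0b.
pose u := fix u n : seq A :=
  if n is m.+1 then rcons (u m)
    (b * ((m == 0%N)%:R - \sum_(i < m) fps_coef f (m - i) * nth 0 (u m) i))
  else [::].
have su n : size (u n) = n by elim: n => //= n IHn; rewrite size_rcons IHn.
pose g n := b * ((n == 0%N)%:R - \sum_(i < n) fps_coef f (n - i) * nth 0 (u n) i).
have nu n i : (i < n)%N -> nth 0 (u n) i = g i.
  elim: n => // n IHn; rewrite ltnS /= nth_rcons su leq_eqVlt.
  by case/orP => [/eqP ->|lt_in]; rewrite ?ltnn ?eqxx // lt_in IHn.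
exists (Fps g); rewrite mulrC; apply: fps_eqP => n.
rewrite coef_fps1 coef_fpsM big_ord_recr /= subnn {2}/g.
rewrite mulrC mulrA f0b mul1r.
rewrite [X in _ + (_ - X)](eq_bigr (fun i : 'I_n => g i * fps_coef f (n - i))).
  by rewrite addrC subrK.
by move=> i _; rewrite nu // mulrC.
Qed.

End FpsBasics.

Ltac fps_ring := try rewrite !(fps_scaleC, fps_constD, fps_constN, fps_constM);
  repeat match goal with |- context [@fps_const ?A 1] =>
    change (@fps_const A 1) with (1 : fps A) end; ring.

Section FpsMap.
Variables (A B : comNzRingType) (r : {rmorphism A -> B}).
Implicit Types f g : fps A.

Lemma fps_mapD f g : fps_map r (f + g) = fps_map r f + fps_map r g.
Proof. by apply: fps_eqP => n /=; rewrite rmorphD. Qed.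
Lemma fps_mapN f : fps_map r (- f) = - fps_map r f.
Proof. by apply: fps_eqP => n /=; rewrite rmorphN. Qed.
Lemma fps_mapB f g : fps_map r (f - g) = fps_map r f - fps_map r g.
Proof. by rewrite fps_mapD fps_mapN. Qed.
Lemma fps_mapM f g : fps_map r (f * g) = fps_map r f * fps_map r g.
Proof.
apply: fps_eqP => n /=; rewrite rmorph_sum; apply: eq_bigr => i _.
by rewrite rmorphM.
Qed.
Lemma fps_map1 : fps_map r 1 = 1.
Proof. by apply: fps_eqP => n /=; case: eqP; rewrite ?rmorph0 ?rmorph1. Qed.
Lemma fps_mapZ a f : fps_map r (a *: f) = r a *: fps_map r f.
Proof. by apply: fps_eqP => n /=; rewrite rmorphM. Qed.
Lemma fps_map_var : fps_map r (fps_var A) = fps_var B.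
Proof. by apply: fps_eqP => n /=; case: eqP; rewrite ?rmorph0 ?rmorph1. Qed.

End FpsMap.

(** Continuity is automatic: the image of y is divisible by y, so the image of a tail y^n g is
    divisible by y^n, and each coefficient depends on finitely many terms. *)
Lemma semilinear_ext (A : comNzRingType) (k : comNzRingType) (r : {rmorphism A -> k})
    (al be : fps A -> fps k) :
  (forall f g, al (f + g) = al f + al g) -> (forall f g, be (f + g) = be f + be g) ->
  (forall a f, al (a *: f) = r a *: al f) -> (forall a f, be (a *: f) = r a *: be f) ->
  (forall f g, al (f * g) = al f * al g) -> (forall f g, be (f * g) = be f * be g) ->
  al 1 = 1 -> be 1 = 1 -> al (fps_var A) = be (fps_var A) ->
  fps_coef (al (fps_var A)) 0 = 0 -> al =1 be.
Proof.
move=> aD bD aZ bZ aM bM a1 b1 ab a0 f; apply: fps_eqP => n.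
have a00 : al 0 = 0 by have := aZ 0 0; rewrite rmorph0 !scale0r.
have b00 : be 0 = 0 by have := bZ 0 0; rewrite rmorph0 !scale0r.
have aX m : al (fps_var A ^+ m) = al (fps_var A) ^+ m.
  by elim: m => [|m IHm]; rewrite ?a1 // !exprS aM IHm.
have bX m : be (fps_var A ^+ m) = be (fps_var A) ^+ m.
  by elim: m => [|m IHm]; rewrite ?b1 // !exprS bM IHm.
rewrite (fps_decomp n.+1 f) aD bD aM bM (big_morph al aD a00) (big_morph be bD b00).
rewrite aX bX -ab; set h := al _ in a0 *.
rewrite (eq_bigr (fun i : 'I_n.+1 => be (fps_coef f i *: fps_var A ^+ i))); last first.
  by move=> i _; rewrite aZ bZ aX bX ab.
have hE : h = fps_var k * fps_shift 1 h.
  by rewrite {1}(@fps_decomp_ord _ 1 h) ?expr1 // => -[].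
by rewrite !coef_fpsD {1 2}hE exprMn -!mulrA !coef_varXM ltnSn.
Qed.

Section IdealPowers.
Variables (A : comNzRingType) (I : A -> Prop).
Local Notation pw := (ideal_pow I).

Lemma ideal_gen_ideal (P : A -> Prop) : is_ideal (ideal_gen P).
Proof.
split.
- by exists [::]; split=> [u|]; rewrite ?big_nil.
- move=> _ _ [s [sP ->]] [t [tP ->]]; exists (s ++ t); split; last by rewrite big_cat.
  by move=> u; rewrite mem_cat => /orP[/sP|/tP].
- move=> a _ [s [sP ->]]; exists [seq (a * u.1, u.2) | u <- s]; split.
    by move=> u /mapP[v /sP ? ->].
  by rewrite big_map mulr_sumr; apply: eq_bigr => u _; rewrite mulrA.
Qed.

Lemma ideal_gen_min (P J : A -> Prop) :
  is_ideal J -> (forall a, P a -> J a) -> forall a, ideal_gen P a -> J a.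
Proof.
move=> [J0 JD JM] PJ _ [s [sP ->]]; elim: s sP => [|u s IHs] sP; first by rewrite big_nil.
rewrite big_cons; apply: JD; first by apply/JM/PJ/sP; rewrite inE eqxx.
by apply: IHs => v vs; apply: sP; rewrite inE vs orbT.
Qed.

Lemma ideal_gen_incl (P : A -> Prop) a : P a -> ideal_gen P a.
Proof.
move=> Pa; exists [:: (1, a)]; split; last by rewrite big_seq1 mul1r.
by move=> u; rewrite inE => /eqP ->.
Qed.

Lemma ideal_powP n : is_ideal (pw n).
Proof. by case: n => [|n]; [split | apply: ideal_gen_ideal]. Qed.

Lemma ideal_pow0 n : pw n 0. Proof. by case: (ideal_powP n). Qed.
Lemma ideal_powD n a b : pw n a -> pw n b -> pw n (a + b).
Proof. by case: (ideal_powP n) => _ H _; apply: H. Qed.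
Lemma ideal_powM n a b : pw n b -> pw n (a * b).
Proof. by case: (ideal_powP n) => _ _; apply. Qed.
Lemma ideal_powMr n a b : pw n a -> pw n (a * b).
Proof. by rewrite mulrC; apply: ideal_powM. Qed.
Lemma ideal_powN n a : pw n a -> pw n (- a).
Proof. by rewrite -mulN1r; apply: ideal_powM. Qed.
Lemma ideal_powB n a b : pw n a -> pw n b -> pw n (a - b).
Proof. by move=> a_n b_n; apply: ideal_powD => //; apply: ideal_powN. Qed.
Lemma ideal_pow_sum (T : Type) (s : seq T) (P : pred T) (F : T -> A) n :
  (forall i, P i -> pw n (F i)) -> pw n (\sum_(i <- s | P i) F i).
Proof.
move=> FP; elim/big_rec: _ => [|i a Pi]; first exact: ideal_pow0.
by apply: ideal_powD; apply: FP.
Qed.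

Lemma ideal_powS n a b : I a -> pw n b -> pw n.+1 (a * b).
Proof. by move=> Ia b_n; apply: ideal_gen_incl; exists a, b. Qed.

Lemma ideal_pow_decr n m a : (m <= n)%N -> pw n a -> pw m a.
Proof.
move/subnK => <-; elim: (n - m)%N a => // {}n IHn a.
move=> H; apply: IHn; rewrite addSn in H.
apply: ideal_gen_min H; first exact: ideal_powP.
by move=> _ [b [c [_ c_n ->]]]; apply: ideal_powM.
Qed.

Lemma ideal_powMD n m a b : pw n a -> pw m b -> pw (n + m) (a * b).
Proof.
elim: n a => [|n IHn] a a_n b_m; first exact: ideal_powM.
apply: (@ideal_gen_min _ (fun a => pw (n.+1 + m) (a * b)) _ _ a a_n).
  split=> [|c d|c d]; first by rewrite mul0r; apply: ideal_pow0.
    by rewrite mulrDl; apply: ideal_powD.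
  by rewrite -mulrA; apply: ideal_powM.
by move=> _ [c [d [Ic d_n ->]]]; rewrite -mulrA addSn; apply/ideal_powS/IHn.
Qed.

Lemma ideal_pow1 a : is_ideal I -> pw 1 a <-> I a.
Proof.
move=> I_id; split=> [|Ia]; last by rewrite -[a]mulr1; apply: ideal_powS.
apply: ideal_gen_min => // _ [b [c [Ib _ ->]]].
by rewrite mulrC; case: I_id => _ _; apply.
Qed.

(* The ideal of A[[y]] generated by the products y^i M^(n-i) *)
Definition fps_pow n (f : fps A) := forall i, pw (n - i) (fps_coef f i).

Lemma fps_pow0 n : fps_pow n 0.
Proof. by move=> i; rewrite coef_fps0; apply: ideal_pow0. Qed.
Lemma fps_powD n f g : fps_pow n f -> fps_pow n g -> fps_pow n (f + g).
Proof. by move=> fn gn i; apply: ideal_powD. Qed.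
Lemma fps_powN n f : fps_pow n f -> fps_pow n (- f).
Proof. by move=> fn i; apply: ideal_powN. Qed.
Lemma fps_powB n f g : fps_pow n f -> fps_pow n g -> fps_pow n (f - g).
Proof. by move=> fn gn; apply: fps_powD => //; apply: fps_powN. Qed.
Lemma fps_powZ n a f : fps_pow n f -> fps_pow n (a *: f).
Proof. by move=> fn i; apply: ideal_powM. Qed.
Lemma fps_powMD n m f g : fps_pow n f -> fps_pow m g -> fps_pow (n + m) (f * g).
Proof.
move=> fn gm i; rewrite coef_fpsM; apply: ideal_pow_sum => j _.
have := ideal_powMD (fn j) (gm (i - j)%N); apply: ideal_pow_decr.
have le_ji : (j <= i)%N by rewrite -ltnS.
by rewrite -{1}(subnK le_ji) addnC; lia.
Qed.
Lemma fps_powM n f g : fps_pow n g -> fps_pow n (f * g).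
Proof. by move=> gn; rewrite -[n]add0n; apply: fps_powMD. Qed.
Lemma fps_powX n f : fps_pow 1 f -> fps_pow n (f ^+ n).
Proof. by move=> f1; elim: n => [|n IHn] //; rewrite exprS; apply: (@fps_powMD 1). Qed.
Lemma fps_pow1P f : is_ideal I -> fps_pow 1 f <-> I (fps_coef f 0).
Proof.
move=> I_id; split=> [f1|f0]; first exact/(ideal_pow1 _ I_id)/(f1 0%N).
by case=> [|i] //; apply/(ideal_pow1 _ I_id).
Qed.

End IdealPowers.

Section Endomorphisms.
Variable A : comNzRingType.
Implicit Types (f g : fps A) (s t : fps A -> fps A).

Definition fps_endo s := linear s /\ monoid_morphism s.

Lemma alg_aut_endo s : alg_aut s -> fps_endo s. Proof. by case. Qed.

Variable s : fps A -> fps A.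
Hypothesis s_endo : fps_endo s.

Lemma endoD f g : s (f + g) = s f + s g.
Proof. by case: s_endo => sl _; have := sl 1 f g; rewrite !scale1r. Qed.
Lemma endo0 : s 0 = 0.
Proof. by apply: (addrI (s 0)); rewrite -endoD !addr0. Qed.
Lemma endoZ a f : s (a *: f) = a *: s f.
Proof. by case: s_endo => sl _; have := sl a f 0; rewrite !addr0 endo0 addr0. Qed.
Lemma endoN f : s (- f) = - s f.
Proof. by rewrite -scaleN1r endoZ scaleN1r. Qed.
Lemma endoB f g : s (f - g) = s f - s g.
Proof. by rewrite endoD endoN. Qed.
Lemma endo1 : s 1 = 1. Proof. by case: s_endo => _ []. Qed.
Lemma endoM f g : s (f * g) = s f * s g.
Proof. by case: s_endo => _ [_ ->]. Qed.
Lemma endoA a : s a%:A = a%:A. Proof. by rewrite endoZ endo1. Qed.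
Lemma endoX f n : s (f ^+ n) = s f ^+ n.
Proof. by elim: n => [|n IHn]; rewrite ?endo1 // !exprS endoM IHn. Qed.
Lemma endo_sum (I : Type) (r : seq I) (P : pred I) (F : I -> fps A) :
  s (\sum_(i <- r | P i) F i) = \sum_(i <- r | P i) s (F i).
Proof. exact: (big_morph s endoD endo0). Qed.

End Endomorphisms.

Lemma fps_endo_comp (A : comNzRingType) (s t : fps A -> fps A) :
  fps_endo s -> fps_endo t -> fps_endo (s \o t).
Proof.
move=> se te; split=> [a f g|] /=.
  by rewrite (endoD te) (endoZ te) (endoD se) (endoZ se).
by split=> [|f g] /=; rewrite ?(endo1 te) ?(endo1 se) // (endoM te) (endoM se).
Qed.

Lemma fps_endo_iter (A : comNzRingType) (s : fps A -> fps A) n :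
  fps_endo s -> fps_endo (iter n s).
Proof.
by move=> se; elim: n => [|n IHn]; [do !split | apply: (fps_endo_comp se IHn)].
Qed.

(** * Weierstrass division in degree 2 over a nilpotent maximal ideal *)

Section NilpotentWeierstrass.
Variables (A : comNzRingType) (k : fieldType) (r : {rmorphism A -> k}).
Hypothesis r_unit : forall a, r a != 0 -> exists b, a * b = 1.
Local Notation M := (fun a => r a = 0).
Local Notation pw := (ideal_pow M).
Variable N : nat.
Hypothesis pwN : forall a, pw N a -> a = 0.
Implicit Types (f g D q : fps A) (a b : A).
Local Notation y := (fps_var A).

Definition pw_fps n f := forall i, pw n (fps_coef f i).

Lemma res_kerP : is_ideal M.
Proof.
split=> [|a b a0 b0|a b b0]; rewrite ?rmorph0 ?rmorphD ?rmorphM /= ?a0 ?b0 //.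
  by rewrite addr0.
by rewrite mulr0.
Qed.

Lemma pw_fps_mul n m f g : pw_fps n f -> pw_fps m g -> pw_fps (n + m) (f * g).
Proof.
move=> fn gm i; rewrite coef_fpsM; apply: ideal_pow_sum => j _.
exact: ideal_powMD.
Qed.

Lemma fps_unit f : r (fps_coef f 0) != 0 -> exists g, f * g = 1.
Proof. by case/r_unit => b /fps_inv. Qed.

(* Up to a unit, D is a distinguished polynomial of degree 2. *)
Definition dist2 D :=
  [/\ r (fps_coef D 0) = 0, r (fps_coef D 1) = 0 & r (fps_coef D 2) != 0].

(** Pairs are quantified so that one binder serves for two scalars and two series. *)
Lemma dist2_eq D : dist2 D -> exists c b E V : A * fps A,
  [/\ r c.1 = 0, r b.1 = 0, E.2 * V.2 = 1 & D = c.1%:A + b.1 *: y + y ^+ 2 * E.2].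
Proof.
case=> D0 D1 D2; have [V EV] : exists V, fps_shift 2 D * V = 1 by apply: fps_unit.
exists (fps_coef D 0, 0), (fps_coef D 1, 0), (0, fps_shift 2 D), (0, V).
split=> //=; rewrite {1}(fps_decomp 2 D) !big_ord_recl big_ord0 addr0 /=.
by rewrite expr0 expr1.
Qed.

(** By induction on n, the coefficients of q lie in M^n: in the coefficient of y^(i+2) in D q, the
    factors D_0 and D_1 lie in M, the later D_j multiply earlier coefficients of q, and D_2 is a
    unit. *)
Lemma dist2_nzd D q : dist2 D ->
  (forall i, (2 <= i)%N -> fps_coef (D * q) i = 0) -> q = 0.
Proof.
move=> [D0 D1 D2] Dq0; have [b D2b] := r_unit D2.
suff H n : pw_fps n q by apply: fps_eqP => i; rewrite coef_fps0; apply/pwN/H.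
elim: n => [|n IHn] // i; elim/ltn_ind: i => i IHi.
have := Dq0 i.+2 isT; rewrite coef_fpsM !big_ord_recl /=.
rewrite /bump /= !subSS !subn0 !addn0 !addrA.
set s := \sum_(_ < _) _ => E.
have : pw n.+1 (fps_coef D 2 * fps_coef q i).
  rewrite (_ : _ * _ = - (fps_coef D 0 * fps_coef q i.+2
     + fps_coef D 1 * fps_coef q i.+1 + s)); last first.
    apply/eqP; rewrite -subr_eq0 opprK; apply/eqP; rewrite -E; ring.
  apply/ideal_powN/ideal_powD; first by apply/ideal_powD; exact: ideal_powS.
  apply: ideal_pow_sum => j _; apply: ideal_powM; apply: IHi.
  by rewrite !add1n !subSS ltn_subrL /= (leq_ltn_trans _ (ltn_ord j)).
move/(ideal_powM b); rewrite mulrA [b * _]mulrC D2b mul1r; exact.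
Qed.

Lemma dist2_inj D f g : dist2 D -> D * f = D * g -> f = g.
Proof.
move=> DD fg; apply/eqP; rewrite -subr_eq0; apply/eqP/(dist2_nzd DD) => i _.
by rewrite mulrBr fg subrr coef_fps0.
Qed.

Lemma dist2_const D q a b : dist2 D -> D * q = a%:A + b *: y -> a = 0 /\ b = 0.
Proof.
move=> DD E; have q0 : q = 0.
  apply: (dist2_nzd DD) => -[|[|i]] // _; rewrite E coef_fpsD !coef_fpsZ /=.
  by rewrite !mulr0 addr0.
move: E; rewrite q0 mulr0 => E; split.
  have := congr1 (fun f => fps_coef f 0) E.
  by rewrite coef_fps0 coef_fpsD !coef_fpsZ /= mulr1 mulr0 addr0.
have := congr1 (fun f => fps_coef f 1) E.
by rewrite coef_fps0 coef_fpsD !coef_fpsZ /= mulr1 mulr0 add0r.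
Qed.

(** Successive approximation: y^2 E = D - c - b y turns the part of the error of degree at least 2
    into a multiple of D plus an error with one more factor in M. *)
Lemma dist2_div D f : dist2 D -> exists q a b, f = D * q + a%:A + b *: y.
Proof.
move=> /dist2_eq[[c _] [[b _] [[_ E] [[_ V] /= [c0 b0 EV DE]]]]].
suff H n : exists q a b g, pw_fps n g /\ f = D * q + a%:A + b *: y + g.
  have [q [a [b' [g [g0 ->]]]]] := H N; exists q, a, b'.
  rewrite (_ : g = 0) ?addr0 //.
  by apply: fps_eqP => i; rewrite coef_fps0; apply: pwN.
elim: n => [|n [q [a [b' [g [gn fE]]]]]].
  by exists 0, 0, 0, f; split=> //; rewrite mulr0 !scale0r !add0r.
set h := fps_shift 2 g; have gE : g = (fps_coef g 0)%:A + fps_coef g 1 *: y + y ^+ 2 * h.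
  rewrite {1}(fps_decomp 2 g) !big_ord_recl big_ord0 addr0 /=.
  by rewrite expr0 expr1.
have hn : pw_fps n h by move=> i; apply: gn.
exists (q + V * h), (a + fps_coef g 0), (b' + fps_coef g 1),
  (- (c *: (V * h)) - b *: (y * (V * h))); split.
  have Vh : pw_fps n (V * h) by rewrite -[n]add0n; apply: pw_fps_mul.
  move=> i; rewrite coef_fpsB coef_fpsN !coef_fpsZ.
  apply: ideal_powB; first by apply/ideal_powN/ideal_powS.
  apply: ideal_powS => //; rewrite coef_varM; case: i => //; exact: ideal_pow0.
rewrite fE [X in _ + X = _]gE DE !scalerDl.
have -> : y ^+ 2 * h = E * V * (y ^+ 2 * h) by rewrite EV mul1r.
rewrite [c *: (V * _)]fps_scaleE [b *: (y * _)]fps_scaleE [b *: y]fps_scaleE.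
ring.
Qed.

(** y^2 is a multiple of D plus a series m with coefficients in M, and m^N = 0. *)
Lemma dist2_var D : dist2 D -> exists q, y ^+ (2 * N) = D * q.
Proof.
move=> /dist2_eq[[c _] [[b _] [[_ E] [[_ V] /= [c0 b0 EV DE]]]]].
pose m := - (V * (c%:A + b *: y)).
have y2E : y ^+ 2 = D * V + m.
  rewrite DE /m -[LHS]mulr1 -EV; ring.
have mn n : pw_fps n (m ^+ n).
  elim: n => [|n IHn] //; rewrite exprS; apply: (@pw_fps_mul 1) => // i.
  rewrite /m coef_fpsN; apply/ideal_powN; rewrite coef_fpsM.
  apply: ideal_pow_sum => j _; apply: ideal_powM.
  apply/(ideal_pow1 _ res_kerP); rewrite coef_fpsD !coef_fpsZ.
  by rewrite rmorphD !rmorphM /= c0 b0 !mul0r addr0.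
have H n : exists q, y ^+ (2 * n) = D * q + m ^+ n.
  elim: n => [|n [q IHn]]; first by exists 0; rewrite muln0 !expr0 mulr0 add0r.
  exists (V * (D * q + m ^+ n) + m * q).
  rewrite mulnS exprD IHn {1}y2E exprS; ring.
have [q ->] := H N; exists q.
rewrite (_ : m ^+ N = 0) ?addr0 //.
by apply: fps_eqP => i; rewrite coef_fps0; apply/pwN/mn.
Qed.

End NilpotentWeierstrass.

(** * Lifts to a local ring with nilpotent maximal ideal *)

Section PowerSums.
Variable R : comNzRingType.
Implicit Type x : R.

Lemma sum_pow_bin n x :
  \sum_(j < n) (1 + x) ^+ j = \sum_(i < n) x ^+ i *+ 'C(n, i.+1).
Proof.
elim: n => [|n IHn]; first by rewrite !big_ord0.
rewrite big_ord_recr IHn /= [RHS](eq_bigr (fun i : 'I_n.+1 =>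
  x ^+ i *+ 'C(n, i.+1) + x ^+ i *+ 'C(n, i))); last first.
  by move=> i _; rewrite binS mulrnDr.
rewrite big_split /= big_ord_recr /= bin_small // mulr0n addr0; congr (_ + _).
by rewrite exprDn; apply: eq_bigr => i _; rewrite expr1n mul1r.
Qed.

(** The sum is ((1 + x)^p - 1) / x: its end terms are p and x^(p-1), and the middle ones are
    divisible by p x. *)
Lemma sum_pow_prime p x : prime p -> odd p ->
  exists F, \sum_(j < p) (1 + x) ^+ j = x ^+ p.-1 + p%:R * (1 + x * F).
Proof.
move=> p_pr p_odd; rewrite sum_pow_bin.
case: p p_pr p_odd => [|[|p]] // p_pr _.
rewrite big_ord_recr big_ord_recl /= binn mulr1n expr0 bin1.
exists (\sum_(i < p) x ^+ i *+ ('C(p.+2, i.+2) %/ p.+2)).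
rewrite addrC mulrDr mulr1; congr (_ + (_ + _)).
rewrite mulrCA !mulr_sumr; apply: eq_bigr => i _.
rewrite /bump /= add1n mulr_natl -mulrnA divnK ?mulrnAr ?exprS //.
by apply: prime_dvd_bin => //=; rewrite !ltnS.
Qed.

End PowerSums.

Section NilpotentDynamics.
Variables (A : comNzRingType) (k : fieldType) (r : {rmorphism A -> k}).
Hypothesis r_unit : forall a, r a != 0 -> exists b, a * b = 1.
Local Notation M := (fun a => r a = 0).
Local Notation pw := (ideal_pow M).
Variable N : nat.
Hypothesis pwN : forall a, pw N a -> a = 0.
Implicit Types (f g D q : fps A) (a b : A) (s t : fps A -> fps A).
Local Notation y := (fps_var A).
Local Notation dist2 := (dist2 r).
Let inj := dist2_inj r_unit pwN.

(** f lies in the ideal (M, y), so the coefficient of y^i in f^(n+N) lies in M^(n+N-i), which is 0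
    for i < n. *)
Lemma pow_var_dvd n f : r (fps_coef f 0) = 0 -> exists q, f ^+ (n + N) = y ^+ n * q.
Proof.
move=> f0; exists (fps_shift n (f ^+ (n + N))); apply: fps_decomp_ord => i lt_in.
apply: pwN; have := proj2 (fps_pow1P f (res_kerP r)) f0.
move/(fps_powX (n + N))/(_ i); apply: ideal_pow_decr.
by rewrite addnC -addnBA ?leq_addr // ltnW.
Qed.

Lemma dist2_var_add D : dist2 D -> r (fps_coef (y + D) 0) = 0.
Proof. by case=> D0 _ _; rewrite coef_fpsD rmorphD /= D0 rmorph0 addr0. Qed.

Lemma dist2_var_unif : exists L, forall D, dist2 D -> exists q, y ^+ L = D * q.
Proof. by exists (2 * N)%N => D; apply: dist2_var. Qed.

(** u is a difference quotient. As D reduces to a multiple of y^2, u agrees over k with the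
    derivative of f modulo y^2, whence its first two coefficients. *)
Lemma endo_diff s D f : fps_endo s -> s y = y + D -> dist2 D ->
  exists u, [/\ s f = f + D * u, r (fps_coef u 0) = r (fps_coef f 1)
    & r (fps_coef u 1) = r (fps_coef f 2) *+ 2].
Proof.
move=> se sy DD; pose G f := exists u, [/\ s f = f + D * u,
  r (fps_coef u 0) = r (fps_coef f 1) & r (fps_coef u 1) = r (fps_coef f 2) *+ 2].
have GD f1 f2 : G f1 -> G f2 -> G (f1 + f2).
  move=> [u [E u0 u1]] [v [F v0 v1]]; exists (u + v); split.
  - by rewrite (endoD se) E F; ring.
  - by rewrite !coef_fpsD !rmorphD /= u0 v0.
  - by rewrite !coef_fpsD !rmorphD /= u1 v1 mulrnDl.
have GZ a f1 : G f1 -> G (a *: f1).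
  move=> [u [E u0 u1]]; exists (a *: u); split.
  - by rewrite (endoZ se) E scalerDr scalerAr.
  - by rewrite !coef_fpsZ !rmorphM /= u0.
  - by rewrite !coef_fpsZ !rmorphM /= u1 mulrnAr.
have GX n : G (y ^+ n).
  elim: n => [|n [u [E u0 u1]]].
    exists 0; split; first by rewrite (endo1 se) mulr0 addr0.
      by rewrite expr0 coef_fps0 /= rmorph0.
    by rewrite expr0 coef_fps0 /= rmorph0 mul0rn.
  case: DD => D0 D1 D2.
  exists (y ^+ n + (y + D) * u); split.
  - by rewrite exprS (endoM se) sy E; ring.
  - rewrite exprS coef_varM coef_fpsD coef_fps0M coef_fpsD rmorphD rmorphM rmorphD /=.
    by rewrite D0 rmorph0 addr0 mul0r addr0.
  - rewrite exprS coef_varM coef_fpsD coef_fps1M !coef_fpsD !(rmorphD, rmorphM) /=.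
    by rewrite D0 D1 rmorph0 rmorph1 !addr0 mul0r add0r mul1r u0 mulr2n.
have [L dvd_yL] := dist2_var_unif.
have [q yE] := dvd_yL _ DD.
(* The power of y supplies a factor y^L = D q both before and after applying s; the spare y^3 keeps
   the cofactor out of degrees 0 and 1. *)
have Gtail g : G (y ^+ (L + 3 + N) * g).
  have ltL i : (i < 3)%N -> (i < L + 3 + N)%N = true by lia.
  have [q' hE] := pow_var_dvd (L + 3) (dist2_var_add DD).
  exists (y ^+ 3 * (q * q' * s g - q * y ^+ N * g)); split.
  - rewrite (endoM se) (endoX se) sy hE !exprD yE; ring.
  - by rewrite !coef_varXM ltL.
  - by rewrite !coef_varXM ltL //= rmorph0 mul0rn.
rewrite -/(G f) (fps_decomp (L + 3 + N) f); apply: (GD) => //.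
elim/big_rec: _ => [|i f1 _ Gf1]; last by apply: GD => //; apply/GZ/GX.
by rewrite -(scale0r (y ^+ 0)); apply/GZ/GX.
Qed.

(** W is the second divided difference of f at y, y + D1, y + D2, so its constant term reduces to
    f_2. Three divisors have to be extracted from a tail, hence three factors y^L. *)
Lemma endo_diff2 s1 s2 D1 D2 f u1 u2 : fps_endo s1 -> fps_endo s2 ->
  s1 y = y + D1 -> s2 y = y + D2 -> dist2 D1 -> dist2 D2 -> dist2 (D2 - D1) ->
  s1 f = f + D1 * u1 -> s2 f = f + D2 * u2 ->
  exists W, u2 = u1 + (D2 - D1) * W /\ r (fps_coef W 0) = r (fps_coef f 2).
Proof.
move=> se te sy ty DD1 DD2 DD12 sf tf; set D12 := D2 - D1 in DD12 *.
pose G f := exists u1 u2 W, [/\ s1 f = f + D1 * u1, s2 f = f + D2 * u2,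
  u2 = u1 + D12 * W, r (fps_coef u2 0) = r (fps_coef f 1)
  & r (fps_coef W 0) = r (fps_coef f 2)].
suff [v1 [v2 [W [E1 E2 E _ W0]]]] : G f.
  exists W; split=> //.
  have -> : u1 = v1 by apply: (inj DD1); apply: (addrI f); rewrite -E1 -sf.
  by rewrite -E; apply: (inj DD2); apply: (addrI f); rewrite -E2 -tf.
move: f {u1 u2 sf tf} => f.
have GD f1 f2 : G f1 -> G f2 -> G (f1 + f2).
  move=> [u1 [u2 [W [E1 E2 E u0 w0]]]] [v1 [v2 [X [F1 F2 F v0 x0]]]].
  exists (u1 + v1), (u2 + v2), (W + X); split.
  - by rewrite (endoD se) E1 F1; ring.
  - by rewrite (endoD te) E2 F2; ring.
  - by rewrite E F; ring.
  - by rewrite !coef_fpsD !rmorphD /= u0 v0.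
  - by rewrite !coef_fpsD !rmorphD /= w0 x0.
have GZ a f1 : G f1 -> G (a *: f1).
  move=> [u1 [u2 [W [E1 E2 E u0 w0]]]].
  exists (a *: u1), (a *: u2), (a *: W); split.
  - by rewrite (endoZ se) E1 scalerDr scalerAr.
  - by rewrite (endoZ te) E2 scalerDr scalerAr.
  - by rewrite E scalerDr scalerAr.
  - by rewrite !coef_fpsZ !rmorphM /= u0.
  - by rewrite !coef_fpsZ !rmorphM /= w0.
have GX n : G (y ^+ n).
  elim: n => [|n [u1 [u2 [W [E1 E2 E u0 w0]]]]].
    exists 0, 0, 0; by split; rewrite ?expr0 ?coef_fps0 ?mulr0 ?addr0 ?(endo1 se) ?(endo1 te).
  case: DD1 (DD2) => D10 _ _ [D20 D21 _].
  exists (y ^+ n + (y + D1) * u1), (y ^+ n + (y + D2) * u2), ((y + D1) * W + u2); split.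
  - by rewrite exprS (endoM se) sy E1; ring.
  - by rewrite exprS (endoM te) ty E2; ring.
  - by rewrite E /D12; ring.
  - rewrite exprS coef_varM coef_fpsD coef_fps0M coef_fpsD rmorphD rmorphM rmorphD /=.
    by rewrite D20 rmorph0 addr0 mul0r addr0.
  - rewrite exprS coef_varM coef_fpsD coef_fps0M coef_fpsD rmorphD rmorphM rmorphD /=.
    by rewrite D10 rmorph0 addr0 mul0r add0r.
have [L dvd_yL] := dist2_var_unif.
have [[q yE1] [q2 yE2] [q12 yE12]] := And3 (dvd_yL _ DD1) (dvd_yL _ DD2) (dvd_yL _ DD12).
pose n := (L + (L + (L + 3)))%N.
have Gtail g : G (y ^+ (n + N) * g).
  have [h1 hE1] := pow_var_dvd n (dist2_var_add DD1).
  have [h2 hE2] := pow_var_dvd n (dist2_var_add DD2).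
  exists (D2 * D12 * y ^+ 3 * (q * q2 * q12 * (h1 * s1 g - y ^+ N * g))).
  exists (D1 * D12 * y ^+ 3 * (q * q2 * q12 * (h2 * s2 g - y ^+ N * g))).
  exists (y ^+ 3 * (q * q2 * q12 * (D1 * (h2 * s2 g - y ^+ N * g) - D2 * (h1 * s1 g - y ^+ N * g)))).
  have ltn i : (i < 3)%N -> (i < n + N)%N = true by rewrite /n; lia.
  have nE : y ^+ n = D1 * q * (D2 * q2 * (D12 * q12 * y ^+ 3)).
    by rewrite /n !exprD {1}yE1 {1}yE2 {1}yE12.
  split.
  - by rewrite (endoM se) (endoX se) sy hE1 (exprD y n N) nE; ring.
  - by rewrite (endoM te) (endoX te) ty hE2 (exprD y n N) nE; ring.
  - ring.
  - rewrite mulrAC [_ * y ^+ 3]mulrC coef_varXM coef_varXM.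
    by rewrite ltn.
  - by rewrite !coef_varXM ltn.
rewrite (fps_decomp (n + N) f); apply: (GD) => //.
elim/big_rec: _ => [|i f1 _ Gf1]; last by apply: GD => //; apply/GZ/GX.
by rewrite -(scale0r (y ^+ 0)); apply/GZ/GX.
Qed.

Section OneMap.
Variables (s : fps A -> fps A) (D nu : fps A).
Hypotheses (se : fps_endo s) (sy : s y = y + D) (DD : dist2 D).
Hypothesis sD : s D = D * (1 + nu).

Lemma endo_iter_dvd j f : exists x, iter j s f = f + D * x.
Proof.
elim: j => [|j [x E]]; first by exists 0; rewrite mulr0 addr0.
have [u [sf _ _]] := endo_diff f se sy DD.
by exists (u + (1 + nu) * s x); rewrite /= E (endoD se) (endoM se) sf sD; ring.
Qed.

(** Being the identity modulo D, s acts on (D)/(D^2) as multiplication by 1 + nu. *)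
Lemma endo_iter_mult j v : exists x,
  iter j s (D * v) = D * ((1 + nu) ^+ j * v + D * x).
Proof.
elim: j v => [|j IHj] v; first by exists 0; rewrite expr0 mulr0 addr0 mul1r.
have [x E] := IHj v.
have [u [sv _ _]] := endo_diff ((1 + nu) ^+ j * v + D * x) se sy DD.
exists ((1 + nu) * (x + u)).
by rewrite /= E (endoM se) sD sv exprS; ring.
Qed.

(** s^m y - y telescopes to the sum of the s^j D, that is, to D times the sum of the (1 + nu)^j
    modulo D^2. *)
Lemma endo_order_sum m : iter m s y = y ->
  exists q, \sum_(j < m) (1 + nu) ^+ j = D * q.
Proof.
move=> sm.
have H n : iter n s y = y + \sum_(j < n) iter j s D.
  elim: n => [|n IHn]; first by rewrite big_ord0 addr0.
  rewrite iterSr sy big_ord_recr /= addrA -IHn.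
  exact: (endoD (fps_endo_iter n se)).
have [x Hx] : exists x, \sum_(j < m) iter j s D =
    D * (\sum_(j < m) (1 + nu) ^+ j + D * x).
  elim: (m) => [|n [x E]]; first by exists 0; rewrite !big_ord0; ring.
  have [x' E'] := endo_iter_mult n 1.
  rewrite mulr1 in E'; rewrite !big_ord_recr /= E E'.
  by exists (x + x'); ring.
exists (- x); have : D * (\sum_(j < m) (1 + nu) ^+ j + D * x) = D * 0.
  by rewrite -Hx mulr0; apply: (addrI y); rewrite -H sm addr0.
by move/(inj DD)/eqP; rewrite addr_eq0 mulrN => /eqP.
Qed.

(** t D = s^j (t y) - t y is a multiple of D. Computing t s D = s^j t D in two ways modulo D^2 then
    compares 1 + t nu with (1 + nu)^j. *)
Lemma endo_normal t j : fps_endo t -> (forall f, t (s f) = iter j s (t f)) ->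
  r (fps_coef (t D) 2) != 0 ->
  exists v q, t D = D * v /\ t nu = (1 + nu) ^+ j - 1 + D * q.
Proof.
move=> te tsj tD2.
have [v Dv] : exists v, t D = D * v.
  have [x E] := endo_iter_dvd j (t y).
  by exists x; rewrite -tsj sy (endoD te) in E; exact: (addrI _ E).
have [w vw] : exists w, v * w = 1.
  apply: (fps_unit r_unit); apply: contraNneq tD2 => v0.
  case: DD => D0 D1 _.
  by rewrite Dv coef_fps2M !rmorphD !rmorphM /= D0 D1 v0 !mul0r mulr0 !addr0.
have [x E] := endo_iter_mult j v.
exists v, (x * w); split=> //.
have : D * (v * (1 + t nu)) = D * ((1 + nu) ^+ j * v + D * x).
  by rewrite -E -Dv -tsj sD (endoM te) (endoD te) (endo1 te) Dv; ring.
move/(inj DD) => vE.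
have : w * (v * (1 + t nu)) = w * ((1 + nu) ^+ j * v + D * x) by rewrite vE.
have -> : w * (v * (1 + t nu)) = (v * w) * (1 + t nu) by ring.
have -> : w * ((1 + nu) ^+ j * v + D * x) = (v * w) * (1 + nu) ^+ j + D * (x * w) by ring.
by rewrite vw !mul1r => F; rewrite -addrA [-1 + _]addrC addrA -F; ring.
Qed.

End OneMap.

Section MultiplierBasis.
Variables (D nu : fps A).
Hypothesis DD : dist2 D.
Hypotheses (nu0 : r (fps_coef nu 0) = 0) (nu1 : r (fps_coef nu 1) != 0).

(** Since e1 is a unit, 1 and nu also form a basis modulo D. Unlike y, nu has a known image under t,
    by [endo_normal]. *)
Lemma nu_var : exists e0 e1 q, [/\ r e1 != 0 & nu = D * q + e0%:A + e1 *: y].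
Proof.
have [q [e0 [e1 E]]] := dist2_div r_unit pwN nu DD.
exists e0, e1, q; split=> //; apply: contraNneq nu1 => e10.
case: DD => D0 D1 _.
rewrite E !coef_fpsD coef_fps1M !coef_fpsZ /= !(rmorphD, rmorphM) /= D0 D1 e10 rmorph0.
by rewrite !(mulr0, mul0r) !addr0.
Qed.

Lemma nu_indep q a b : D * q = a%:A + b *: nu -> a = 0 /\ b = 0.
Proof.
have [e0 [e1 [q' [/r_unit[e1' e1K] ->]]]] := nu_var => E.
have : D * (q - b *: q') = (a + b * e0)%:A + (b * e1) *: y.
  rewrite mulrBr E !scalerDr scalerAr !scalerA scalerDl; ring.
case/(dist2_const r_unit pwN DD) => a0 b0.
have {}b0 : b = 0 by rewrite -[b]mulr1 -e1K mulrA b0 mul0r.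
by move: a0; rewrite b0 mul0r addr0.
Qed.

Lemma nu_div f : exists q a b, f = D * q + a%:A + b *: nu.
Proof.
have [e0 [e1 [q' [/r_unit[e1' e1K] E]]]] := nu_var.
have [q [a [b ->]]] := dist2_div r_unit pwN f DD.
exists (q - (b * e1') *: q'), (a - b * e1' * e0), (b * e1').
have bK : b * e1' * e1 = b by rewrite -mulrA [e1' * e1]mulrC e1K mulr1.
rewrite E !scalerDr mulrBr -!scalerAr !scalerA bK scalerBl; ring.
Qed.

End MultiplierBasis.

Lemma multiplier s D : fps_endo s -> s y = y + D -> dist2 D ->
  exists nu, [/\ s D = D * (1 + nu), r (fps_coef nu 0) = 0
    & r (fps_coef nu 1) = r (fps_coef D 2) *+ 2].
Proof.
move=> se sy DD; have [u [E u0 u1]] := endo_diff D se sy DD.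
exists u; split=> //; first by rewrite E; ring.
by rewrite u0; case: DD.
Qed.

Variable p : nat.
Hypotheses (p_pr : prime p) (rp0 : r p%:R = 0).

Lemma char_odd : odd p -> 2%:R != 0 :> k.
Proof.
move=> p_odd; have pk : p \in [pchar k] by rewrite inE p_pr -(rmorph_nat r) rp0 eqxx.
by rewrite -(dvdn_pcharf pk); rewrite dvdn_prime2 //; apply: contraL p_odd => /eqP ->.
Qed.

Lemma nonlift_normal s t D j : odd p ->
  fps_endo s -> s y = y + D -> dist2 D -> iter p s y = y ->
  fps_endo t -> (forall f, t (s f) = iter j s (t f)) ->
  r (fps_coef (t D) 2) != 0 -> 1 - j%:R ^+ 2 != 0 :> k -> p%:R = 0 :> A.
Proof.
move=> p_odd se sy DD sp te tsj tD2 j2.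
(* Modulo D, nu^2 = t' + s' nu; applying t to this relation gives t' = 0, and *)
(* then sum_(j < p) (1 + nu)^j, which vanishes, is p plus a multiple of nu.    *)
have [nu [sD nu0 nu1]] := multiplier se sy DD.
have {}nu1 : r (fps_coef nu 1) != 0.
  by case: DD => _ _ D2; rewrite nu1 -mulr_natr mulf_neq0 // char_odd.
have [v [q [tD tnu]]] := endo_normal se sy DD sD te tsj tD2.
have [q2 [t' [s' nu2]]] := nu_div DD nu1 (nu ^+ 2).
have [D0 D1 _] := DD.
have t'0 : r t' = 0.
  have := congr1 (fun f => r (fps_coef f 0)) nu2.
  rewrite expr2 coef_fps0M !coef_fpsD coef_fps0M !coef_fpsZ /= !(rmorphD, rmorphM) /=.
  by rewrite nu0 D0 !mul0r add0r mulr0 addr0 rmorph1 mulr1 => <-.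
have s'0 : r s' = 0.
  have := congr1 (fun f => r (fps_coef f 1)) nu2.
  rewrite expr2 coef_fps1M !coef_fpsD coef_fps1M !coef_fpsZ /= !(rmorphD, rmorphM) /=.
  rewrite nu0 D0 D1 !mul0r !mulr0 rmorph0 mulr0 !add0r => /esym/eqP.
  by rewrite mulf_eq0 (negPf nu1) orbF => /eqP.
(* Reducing with nu^2 = t' + s' nu, the constant term of (1 + nu)^i stays in 1 + t' A. *)
have pow i : exists al be x, r al = i%:R /\
    (1 + nu) ^+ i = 1 + al *: nu + (be * t')%:A + D * x.
  elim: i => [|i [al [be [x [al_i E]]]]].
    exists 0, 0, 0; rewrite rmorph0; split=> //.
    by rewrite mul0r !scale0r mulr0 expr0 !addr0.
  exists (1 + al + be * t' + al * s'), (be + al), (al *: q2 + x * (1 + nu)); split.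
    by rewrite !rmorphD !rmorphM /= t'0 s'0 !mulr0 !addr0 rmorph1 al_i nat1r.
  have -> : (1 + nu) ^+ i.+1 = (1 + nu) ^+ i * (1 + nu) by rewrite exprSr.
  rewrite E.
  have -> : (1 + al *: nu + (be * t')%:A + D * x) * (1 + nu) =
    1 + nu + al *: nu + al *: nu ^+ 2 + (be * t')%:A + (be * t') *: nu + D * (x * (1 + nu)).
    by fps_ring.
  by rewrite nu2; fps_ring.
have [al [be [x [al_j E]]]] := pow j.
have tnuE : t nu = al *: nu + (be * t')%:A + D * (x + q) by rewrite tnu E; fps_ring.
have t'z : t' = 0.
  have E2 : t nu ^+ 2 = D * (v * t q2) + t'%:A + s' *: t nu.
    by rewrite -(endoX te) nu2 !(endoD te) (endoM te) tD !(endoZ te) (endo1 te) mulrA.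
  (* c0 and c1 are the coordinates of (t nu)^2 - t' - s' t nu in the basis 1, nu. Here c0 is -t'
     times an element that reduces to 1 - j^2. *)
  pose c0 := al * al * t' + be * t' * (be * t') - t' - s' * (be * t').
  pose c1 := al * al * s' + (al * (be * t')) *+ 2 - s' * al.
  have [z Ez] : exists z, D * z = c0%:A + c1 *: nu.
    exists (v * t q2 + s' *: (x + q) - (al * al) *: q2 -
      (x + q) * (D * (x + q) + (al *: nu + (be * t')%:A) *+ 2)).
    have F : t nu ^+ 2 - s' *: t nu - t'%:A = D * (v * t q2) by rewrite E2; ring.
    rewrite tnuE in F.
    have G : (al * al * t')%:A = (al * al) *: (nu ^+ 2 - D * q2 - s' *: nu) :> fps A.
      by rewrite nu2; fps_ring.
    rewrite !mulrBr mulrDr -F /c0 /c1 !scalerBl scalerDl G; fps_ring.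
  have [c00 _] := nu_indep DD nu1 Ez.
  have : t' * (1 - al * al - be * (be * t') + s' * be) = 0.
    by rewrite -[RHS]oppr0 -c00 /c0; ring.
  have [b Eb] : exists b, (1 - al * al - be * (be * t') + s' * be) * b = 1.
    apply: r_unit; rewrite !(rmorphD, rmorphB, rmorphN, rmorphM) /= t'0 s'0 al_j rmorph1.
    by rewrite !(mulr0, mul0r) subr0 addr0 -expr2.
  by move/(congr1 (fun a => a * b)); rewrite -mulrA Eb mulr1 mul0r.
have [q3 Hq] := endo_order_sum se sy DD sD sp.
have [c [z Hc]] : exists c z, \sum_(j < p) (1 + nu) ^+ j = p%:R%:A + c *: nu + D * z.
  elim: (p) => [|n [c [z IHn]]].
    by exists 0, 0; rewrite big_ord0 scale0r scale0r mulr0 !addr0.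
  have [al' [be' [x' [_ E']]]] := pow n.
  exists (c + al'), (z + x'); rewrite big_ord_recr /= IHn E' t'z mulr0 scale0r.
  rewrite -natr1 !scalerDl scale1r; ring.
have : D * (q3 - z) = p%:R%:A + c *: nu by rewrite mulrBr -Hq Hc; ring.
by case/(nu_indep DD nu1).
Qed.

(** By commutation s2 is trivial modulo D1, so D2 = D1 e, where e_0 reduces to the ratio of the
    leading coefficients. The multiplier of s2 is then e nu modulo D1. Eliminating nu^(p-1) between
    the two order relations leaves p U = 0 modulo D1, with U_0 reducing to 1 - e_0^(p-1). *)
Lemma nonlift_commuting s1 s2 D1 D2 : odd p -> fps_endo s1 -> fps_endo s2 ->
  s1 y = y + D1 -> s2 y = y + D2 -> dist2 D1 -> dist2 D2 -> dist2 (D2 - D1) ->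
  iter p s1 y = y -> iter p s2 y = y -> (forall f, s1 (s2 f) = s2 (s1 f)) ->
  r (fps_coef D2 2) ^+ p.-1 != r (fps_coef D1 2) ^+ p.-1 -> p%:R = 0 :> A.
Proof.
move=> p_odd e1 e2 s1y s2y DD1 DD2 DD12 s1p s2p s12 neq.
have [nu [sD nu0 nu1]] := multiplier e1 s1y DD1.
have {}nu1 : r (fps_coef nu 1) != 0.
  by case: DD1 => _ _ D2_2; rewrite nu1 -mulr_natr mulf_neq0 // char_odd.
have [w [s2D1 w0 _]] := endo_diff D1 e2 s2y DD2.
have [D10 D11 D12] := DD1; have [D20 D21 D22] := DD2.
have [v [q [s2D1v s2nu]]] : exists v q, s2 D1 = D1 * v /\ s2 nu = (1 + nu) ^+ 1 - 1 + D1 * q.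
  apply: (endo_normal e1 s1y DD1 sD e2) => [f|]; first by rewrite /= s12.
  rewrite s2D1 coef_fpsD rmorphD coef_fps2M !rmorphD !rmorphM /= D20 D21 w0 D11.
  by rewrite !mul0r !mulr0 !addr0.
have s2triv f : exists x, s2 f = f + D1 * x.
  have [q' [a [b ->]]] := nu_div DD1 nu1 f.
  exists (v * s2 q' - q' + b *: q).
  rewrite !(endoD e2) (endoM e2) (endoA e2) (endoZ e2) s2nu s2D1v.
  rewrite expr1; fps_ring.
have [e D2E] : exists e, D2 = D1 * e.
  by have [x] := s2triv y; rewrite s2y => /addrI ->; exists x.
have eD2 : r (fps_coef D2 2) = r (fps_coef D1 2) * r (fps_coef e 0).
  by rewrite D2E coef_fps2M !rmorphD !rmorphM /= D10 D11 !mul0r !add0r.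
have [e' eK] : exists e', e * e' = 1.
  by apply: (fps_unit r_unit); apply: contraNneq D22 => e0; rewrite eD2 e0 mulr0.
have s1D1' : s1 D1 = D1 + D1 * nu by rewrite sD; ring.
have [W [wE _]] := endo_diff2 e1 e2 s1y s2y DD1 DD2 DD12 s1D1' s2D1.
have [e2' [s2e _ _]] := endo_diff e e2 s2y DD2.
pose nu2 := e * w + D1 * e2' * (1 + e * w).
have s2D2 : s2 D2 = D2 * (1 + nu2).
  by rewrite {1}D2E (endoM e2) s2e s2D1 /nu2 !D2E; ring.
have nu2E : exists x, nu2 = e * nu + D1 * x.
  exists (e * (e - 1) * W + e2' * (1 + e * w)).
  by rewrite /nu2 {1}wE D2E; ring.
have [q1 E1] := endo_order_sum e1 s1y DD1 sD s1p.
have [q2 E2] := endo_order_sum e2 s2y DD2 s2D2 s2p.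
have [F1 S1] := sum_pow_prime nu p_pr p_odd.
have [F2 S2] := sum_pow_prime (e * nu) p_pr p_odd.
have [q2' E2'] : exists q, \sum_(j < p) (1 + e * nu) ^+ j = D1 * q.
  have [x nE] := nu2E.
  have [z Hz] : exists z, \sum_(j < p) (1 + nu2) ^+ j = \sum_(j < p) (1 + e * nu) ^+ j + D1 * z.
    have P i : exists z, (1 + nu2) ^+ i = (1 + e * nu) ^+ i + D1 * z.
      elim: i => [|i [z Hz]]; first by exists 0; rewrite mulr0 addr0.
      exists ((1 + e * nu) * z + x * ((1 + e * nu) ^+ i + D1 * z)).
      by rewrite !exprS Hz nE; ring.
    elim: (p) => [|n [z IHn]]; first by exists 0; rewrite !big_ord0 mulr0 addr0.
    have [z' Hz'] := P n; exists (z + z'); rewrite !big_ord_recr /= IHn Hz'; ring.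
  by exists (e * q2 - z); rewrite mulrBr mulrA -D2E -E2 Hz; ring.
pose U := (1 + e * nu * F2) - e ^+ p.-1 * (1 + nu * F1).
have pU : p%:R * U = D1 * (q2' - e ^+ p.-1 * q1).
  rewrite (_ : D1 * _ = D1 * q2' - e ^+ p.-1 * (D1 * q1)); last by ring.
  by rewrite -E2' -E1 S2 S1 exprMn /U; ring.
have [U' UK] : exists U', U * U' = 1.
  apply: (fps_unit r_unit).
  have rU : r (fps_coef U 0) = 1 - r (fps_coef e 0) ^+ p.-1.
    rewrite /U coef_fpsB coef_fpsD !coef_fps0M coef_fpsD !coef_fps0M /= !(rmorphB, rmorphD, rmorphM) /=.
    rewrite nu0 !(mul0r, mulr0) rmorph1 !addr0 mulr1; congr (_ - _).
    by elim: p.-1 => [|i IHi]; rewrite ?rmorph1 // !exprS coef_fps0M rmorphM IHi.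
  rewrite rU subr_eq0 eq_sym; apply: contraNneq neq => e1'.
  by rewrite eD2 exprMn e1' mulr1.
have : D1 * ((q2' - e ^+ p.-1 * q1) * U') = p%:R%:A + 0 *: y.
  rewrite mulrA -pU -mulrA UK mulr1 scale0r addr0.
  by rewrite scaler_nat.
by case/(dist2_const r_unit pwN DD1).
Qed.

(** An involution sends its D to -D. Commutation gives D1 u1 = D2 u2, which the second differences
    of D1 and D2 turn into the claim multiplied by the regular element D2 - D1. *)
Lemma involution_pair s1 s2 D1 D2 : fps_endo s1 -> fps_endo s2 ->
  s1 y = y + D1 -> s2 y = y + D2 -> dist2 D1 -> dist2 D2 -> dist2 (D2 - D1) ->
  s1 (s1 y) = y -> s2 (s2 y) = y -> s1 (s2 y) = s2 (s1 y) ->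
  exists W1 W2, [/\ 2%:R = D1 * W2 + D2 * W1, r (fps_coef W1 0) = r (fps_coef D1 2)
    & r (fps_coef W2 0) = r (fps_coef D2 2)].
Proof.
move=> e1 e2 s1y s2y DD1 DD2 DD12 s11 s22 s12.
have sD s D : fps_endo s -> s y = y + D -> s (s y) = y -> s D = D + D * - 2%:R.
  move=> se sy ss; have : s (y + D) = y by rewrite -sy.
  rewrite (endoD se) sy => E; rewrite (_ : s D = y + D + s D - (y + D)); first by rewrite E; ring.
  ring.
have s1D1 := sD _ _ e1 s1y s11; have s2D2 := sD _ _ e2 s2y s22.
have [u2 [s2D1 _ _]] := endo_diff D1 e2 s2y DD2.
have [u1 [s1D2 _ _]] := endo_diff D2 e1 s1y DD1.
have [W1 [E1 W10]] := endo_diff2 e1 e2 s1y s2y DD1 DD2 DD12 s1D1 s2D1.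
have [W2 [E2 W20]] := endo_diff2 e1 e2 s1y s2y DD1 DD2 DD12 s1D2 s2D2.
exists W1, W2; split=> //; apply: (inj DD12).
have C : D1 * u1 = D2 * u2.
  move: s12; rewrite s2y s1y (endoD e1) (endoD e2) s1y s2y s1D2 s2D1 => C.
  apply: (addrI (y + D1 + D2)).
  have -> : y + D1 + D2 + D1 * u1 = y + D1 + (D2 + D1 * u1) by ring.
  by rewrite C; ring.
have u1E : u1 = - 2%:R - (D2 - D1) * W2 by rewrite E2; ring.
move: C; rewrite u1E E1 => C.
have -> : (D2 - D1) * (D1 * W2 + D2 * W1) = (D2 - D1) * 2%:R +
   (D2 * (- 2%:R + (D2 - D1) * W1) - D1 * (- 2%:R - (D2 - D1) * W2)) by ring.
by rewrite C subrr addr0.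
Qed.

(** Modulo D1, [involution_pair] gives D2 = 2 V and D3 = 2 V', so its relation between D2 and D3
    becomes 2 U = 0. The constant term of U reduces to 1 - (a_2 + a_3) / a_1, with a_i the leading
    coefficient of D_i. *)
Lemma nonlift_involutions s1 s2 s3 D1 D2 D3 :
  fps_endo s1 -> fps_endo s2 -> fps_endo s3 ->
  s1 y = y + D1 -> s2 y = y + D2 -> s3 y = y + D3 ->
  dist2 D1 -> dist2 D2 -> dist2 D3 ->
  dist2 (D2 - D1) -> dist2 (D3 - D1) -> dist2 (D3 - D2) ->
  s1 (s1 y) = y -> s2 (s2 y) = y -> s3 (s3 y) = y ->
  s1 (s2 y) = s2 (s1 y) -> s1 (s3 y) = s3 (s1 y) -> s2 (s3 y) = s3 (s2 y) ->
  r (fps_coef D1 2) != r (fps_coef D2 2) + r (fps_coef D3 2) -> 2%:R = 0 :> A.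
Proof.
move=> e1 e2 e3 s1y s2y s3y DD1 DD2 DD3 DD12 DD13 DD23 s11 s22 s33 s12 s13 s23 neq.
have [X1 [X2 [EX X10 X20]]] := involution_pair e1 e2 s1y s2y DD1 DD2 DD12 s11 s22 s12.
have [Y1 [Y3 [EY Y10 Y30]]] := involution_pair e1 e3 s1y s3y DD1 DD3 DD13 s11 s33 s13.
have [Z2 [Z3 [EZ Z20 Z30]]] := involution_pair e2 e3 s2y s3y DD2 DD3 DD23 s22 s33 s23.
have [D10 D11 D12] := DD1.
have [V XV] : exists V, X1 * V = 1 by apply: (fps_unit r_unit); rewrite X10.
have [V' YV] : exists V, Y1 * V = 1 by apply: (fps_unit r_unit); rewrite Y10.
have D2E : D2 = 2%:R * V - D1 * (X2 * V).
  by rewrite EX -[LHS]mulr1 -XV; ring.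
have D3E : D3 = 2%:R * V' - D1 * (Y3 * V').
  by rewrite EY -[LHS]mulr1 -YV; ring.
pose U := 1 - V * Z3 - V' * Z2.
have UE : D1 * (- (X2 * V * Z3) - Y3 * V' * Z2) = 2%:R * U.
  rewrite /U.
  have -> : 2%:R * (1 - V * Z3 - V' * Z2) = 2%:R - 2%:R * V * Z3 - 2%:R * V' * Z2 by ring.
  rewrite {1}EZ D2E D3E; ring.
have [U' UK] : exists U', U * U' = 1.
  apply: (fps_unit r_unit).
  have V0 : r (fps_coef D1 2) * r (fps_coef V 0) = 1.
    by rewrite -X10 -rmorphM -coef_fps0M XV rmorph1.
  have V0' : r (fps_coef D1 2) * r (fps_coef V' 0) = 1.
    by rewrite -Y10 -rmorphM -coef_fps0M YV rmorph1.
  apply: contraNneq neq => U0; rewrite -subr_eq0.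
  have -> : r (fps_coef D1 2) - (r (fps_coef D2 2) + r (fps_coef D3 2)) =
     r (fps_coef D1 2) * r (fps_coef U 0).
    rewrite /U !coef_fpsB !coef_fps0M !(rmorphB, rmorphM) /= Z30 Z20 rmorph1 !mulrBr mulr1 !mulrA.
    by rewrite V0 V0' !mul1r; ring.
  by rewrite U0 mulr0.
have : D1 * ((- (X2 * V * Z3) - Y3 * V' * Z2) * U') = 2%:R%:A + 0 *: y.
  rewrite mulrA UE -mulrA UK mulr1 scale0r addr0.
  by rewrite scaler_nat.
by case/(dist2_const r_unit pwN DD1).
Qed.

End NilpotentDynamics.

(** * Weak actions *)

Section ActionBasics.
Variables (A : comNzRingType) (gT : finGroupType) (rho : gT -> fps A -> fps A).
Hypothesis rho_act : fps_action rho.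
Implicit Types (f : fps A) (g h : gT).

Lemma fps_action_endo g : fps_endo (rho g).
Proof. by case: rho_act => /(_ g)/alg_aut_endo. Qed.

Lemma fps_actionM g h f : rho (g * h)%g f = rho g (rho h f).
Proof. by case: rho_act. Qed.

Lemma fps_action1 f : rho 1%g f = f.
Proof.
have [[/(_ 1%g)[_ _ /bij_inj inj1] _] E] := (rho_act, fps_actionM 1 1 f).
by apply: inj1; rewrite -E mulg1.
Qed.

Lemma fps_actionX g n f : rho (g ^+ n)%g f = iter n (rho g) f.
Proof. by elim: n => [|n IHn]; rewrite ?fps_action1 // expgS fps_actionM IHn. Qed.

End ActionBasics.

Section WeakAction.
Variables (p : nat) (p_pr : prime p) (k : fieldType) (pk : p \in [pchar k]).
Variables (gT : finGroupType) (rho : gT -> fps k -> fps k).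
Hypothesis rho_act : fps_action rho.
Local Notation y := (fps_var k).
Implicit Types (f : fps k) (g h s t : gT).

(** If the image of f had another constant term c, then f - c would be a unit whose image has
    constant term 0. *)
Lemma rho_coef0 g f : fps_coef (rho g f) 0 = fps_coef f 0.
Proof.
apply/eqP; rewrite eq_sym -subr_eq0; apply/negP => /negP nz.
pose c := fps_coef (rho g f) 0.
have [v hK] : exists v, (f - c%:A) * v = 1.
  apply: (@fps_inv _ _ (fps_coef f 0 - c)^-1).
  by rewrite coef_fpsB coef_fpsZ /= mulr1 divff.
have := congr1 (fun u => fps_coef (rho g u) 0) hK.
have e := fps_action_endo rho_act g; rewrite (endoM e) (endoB e) (endoA e) (endo1 e).
rewrite coef_fps0M coef_fpsB coef_fpsZ /= mulr1 subrr mul0r => /eqP.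
by rewrite eq_sym oner_eq0.
Qed.

(** theta is the tame character, the action on the tangent space; [acoef] is additive on its kernel,
    the wild subgroup. *)
Definition theta g := fps_coef (rho g y) 1.
Definition acoef g := fps_coef (rho g y) 2.

Lemma rho_var0 g : fps_coef (rho g y) 0 = 0. Proof. by rewrite rho_coef0. Qed.

Lemma fps_decomp1 f : f = (fps_coef f 0)%:A + y * fps_shift 1 f.
Proof. by rewrite {1}(fps_decomp 1 f) big_ord1 expr0 expr1. Qed.

Lemma rho_coef1 g f : fps_coef (rho g f) 1 = fps_coef f 1 * theta g.
Proof.
have e := fps_action_endo rho_act g.
rewrite (fps_decomp1 f) (endoD e) (endoM e) (endoA e) !coef_fpsD coef_varM coef_fps1M.
by rewrite !coef_fpsZ rho_var0 rho_coef0 /= mulr0 !add0r mul0r add0r mulrC.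
Qed.

Lemma rho_coef2 g f :
  fps_coef (rho g f) 2 = fps_coef f 1 * acoef g + fps_coef f 2 * theta g ^+ 2.
Proof.
have e := fps_action_endo rho_act g.
rewrite (fps_decomp1 f) (endoD e) (endoM e) (endoA e) !coef_fpsD !coef_varM coef_fps2M.
rewrite !coef_fpsZ rho_var0 rho_coef0 (rho_coef1 g (fps_shift 1 f)) /= mulr0 !add0r mul0r add0r.
rewrite /theta /acoef; ring.
Qed.

Lemma thetaM g h : theta (g * h)%g = theta g * theta h.
Proof. by rewrite {1}/theta (fps_actionM rho_act) rho_coef1 mulrC. Qed.

Lemma acoefM g h :
  acoef (g * h)%g = theta h * acoef g + acoef h * theta g ^+ 2.
Proof. by rewrite {1}/acoef (fps_actionM rho_act) rho_coef2. Qed.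

Lemma theta1 : theta 1%g = 1. Proof. by rewrite /theta (fps_action1 rho_act). Qed.
Lemma acoef1 : acoef 1%g = 0. Proof. by rewrite /acoef (fps_action1 rho_act). Qed.

Lemma theta_neq0 g : theta g != 0.
Proof.
apply/eqP => g0; have := thetaM g g^-1; rewrite g0 mul0r mulgV theta1 => /eqP.
by rewrite oner_eq0.
Qed.

Lemma thetaX g n : theta (g ^+ n)%g = theta g ^+ n.
Proof. by elim: n => [|n IHn]; rewrite ?theta1 // expgS thetaM IHn exprS. Qed.

Lemma thetaV g : theta g^-1%g = (theta g)^-1.
Proof.
by apply: (mulfI (theta_neq0 g)); rewrite -thetaM mulgV theta1 divff ?theta_neq0.
Qed.

Definition wild_set := [set g | theta g == 1].

Fact wild_group_set : group_set wild_set.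
Proof.
apply/group_setP; split=> [|g h]; rewrite !inE ?theta1 //.
by move=> /eqP tg /eqP th; rewrite thetaM tg th mulr1.
Qed.
Canonical wild_group := Group wild_group_set.
Local Notation P := wild_group.

Lemma wildP g : reflect (theta g = 1) (g \in P).
Proof. by rewrite inE; apply: eqP. Qed.

Lemma acoef_conj t g : g \in P -> acoef (t * g * t^-1)%g = theta t * acoef g.
Proof.
move/wildP => tg.
have := acoefM t t^-1; rewrite mulgV acoef1 => E.
rewrite !acoefM thetaM tg mulr1 mul1r mulrDr addrAC -E add0r thetaV.
by field; apply: theta_neq0.
Qed.

Lemma wild_normal : (P <| [set: gT])%g.
Proof.
apply/andP; split; first exact: subsetT.
apply/subsetP => t _; rewrite inE; apply/subsetP => _ /imsetP[g /wildP tg ->].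
by rewrite inE conjgE !thetaM tg mul1r thetaV mulVf ?theta_neq0.
Qed.

Hypothesis rho_weak : weak_action rho.

(** Weakness enters here: it makes [acoef] injective on P, so that P embeds in the additive group of
    k. *)
Lemma weak_eq1 g : g \in P -> acoef g = 0 -> g = 1%g.
Proof.
move=> /wildP tg ag; have : g \in ramification2 rho.
  rewrite inE; apply/asboolP => -[|[|[|i]]] // _; rewrite coef_fpsB /=.
  - by rewrite rho_var0 subr0.
  - by rewrite -/(theta g) tg subrr.
  - by rewrite -/(acoef g) ag subr0.
by rewrite rho_weak => /set1gP.
Qed.

Lemma acoefD g h : g \in P -> h \in P -> acoef (g * h)%g = acoef g + acoef h.
Proof. by move=> /wildP tg /wildP th; rewrite acoefM tg th mul1r expr1n mulr1. Qed.

Lemma acoefX g n : g \in P -> acoef (g ^+ n)%g = acoef g *+ n.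
Proof.
move=> gP; elim: n => [|n IHn]; first exact: acoef1.
by rewrite expgS acoefD ?groupX // IHn mulrS.
Qed.

Lemma acoefV g : g \in P -> acoef g^-1%g = - acoef g.
Proof.
move=> gP; apply: (addrI (acoef g)); rewrite -acoefD ?groupV // mulgV acoef1.
by rewrite subrr.
Qed.

Lemma acoef_inj : {in P &, injective acoef}.
Proof.
move=> g h gP hP E; apply/eqP; rewrite eq_mulgV1; apply/eqP/weak_eq1.
  by rewrite groupM ?groupV.
by rewrite acoefD ?groupV // acoefV // E subrr.
Qed.

Lemma wild_abelem : (p.-abelem P)%g.
Proof.
apply/abelemP => //; split.
  apply/centsP => g gP h hP; apply: acoef_inj; rewrite ?groupM //.
  by rewrite !acoefD // addrC.
move=> g gP; apply: weak_eq1; first exact: groupX.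
by rewrite acoefX // -mulr_natr (pcharf0 pk) mulr0.
Qed.

Lemma wild_expg g : g \in P -> (g ^+ p = 1)%g.
Proof. by case/abelemP: wild_abelem => // _; apply. Qed.

(** On a p-element theta has p-power order, hence is 1, because x^p - 1 = (x - 1)^p in
    characteristic p. *)
Lemma wild_sylow : (p.-Sylow([set: gT]) P)%g.
Proof.
have [Q sylQ] := Sylow_exists p [set: gT].
suff QP : Q \subset P.
  have pP := abelem_pgroup wild_abelem.
  have [Q' sylQ' PQ'] := Sylow_superset (subsetT P) pP.
  have [x _ Q'E] := Sylow_trans sylQ sylQ'.
  suff -> : P = Q' by [].
  apply/group_inj/eqP; rewrite eqEsubset PQ' Q'E /=.
  have := normal_norm wild_normal => /subsetP/(_ x (in_setT x))/normP PE.
  by rewrite -PE conjSg.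
apply/subsetP => g gQ; apply/wildP.
have [n gn] : exists n, #[g]%g = (p ^ n)%N.
  by have /p_natP[n ->] := mem_p_elt (pHall_pgroup sylQ) gQ; exists n.
have : theta g ^+ (p ^ n) = 1 by rewrite -thetaX -gn expg_order theta1.
elim: n {gn} => [|n IHn]; first by rewrite expr1.
rewrite expnSr exprM => /eqP; rewrite -subr_eq0.
have -> : (theta g ^+ (p ^ n)) ^+ p - 1 = (theta g ^+ (p ^ n) - 1) ^+ p.
  by rewrite -!(pFrobenius_autE pk) rmorphB rmorph1.
by rewrite expf_eq0 subr_eq0 => /andP[_ /eqP/IHn].
Qed.

Lemma card_wild : #|P| = (#|gT|`_p)%N.
Proof. by rewrite (card_Hall wild_sylow) cardsT. Qed.

Lemma wild_neq1 : (p %| #|gT|)%N -> exists2 g, g \in P & g != 1%g.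
Proof.
move=> pG; apply/trivgPn; rewrite -cardG_gt1 card_wild p_part_gt1.
by rewrite mem_primes p_pr pG andbT -cardsT cardG_gt0.
Qed.

Lemma acoef_neq0 g : g \in P -> g != 1%g -> acoef g != 0.
Proof. by move=> gP; apply: contraNneq => /(weak_eq1 gP) ->. Qed.

Lemma nat_roots (x : k) : x ^+ p = x -> exists j : nat, x = j%:R.
Proof.
move=> xp; have [/existsP[j /eqP ->]|/existsPn nx] := boolP [exists j : 'I_p, x == j%:R].
  by exists j.
pose q : {poly k} := 'X^p - 'X.
have sq : size q = p.+1.
  by rewrite size_polyDl ?size_polyXn // size_polyN size_polyX ltnS prime_gt1.
have := @max_poly_roots _ q (x :: [seq j%:R | j <- iota 0 p]).
rewrite sq /= size_map size_iota ltnn; move=> H; suff: false by []; apply: H.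
- by rewrite -size_poly_eq0 sq.
- rewrite /root !hornerE xp subrr eqxx /=; apply/allP => _ /mapP[j _ ->].
  rewrite /root !hornerE -!(pFrobenius_autE pk) rmorph_nat subrr eqxx //.
- rewrite map_inj_in_uniq ?iota_uniq ?andbT.
    apply/mapP => -[j]; rewrite mem_iota add0n => /= jp xj.
    by have := nx (Ordinal jp); rewrite xj eqxx.
  move=> i j; rewrite !mem_iota !add0n /= => ip jp ij.
  wlog le_ij : i j ip jp ij / (i <= j)%N.
    by move=> W; case: (leqP i j) => [|/ltnW] H; [exact: W | symmetry; exact: W].
  apply/eqP; rewrite eqn_leq le_ij /=; rewrite leqNgt; apply/negP => lt_ij.
  have : (j - i)%:R = 0 :> k by rewrite natrB // ij subrr.
  move/eqP; rewrite -(dvdn_pcharf pk) => /dvdn_leq; rewrite subn_gt0 => /(_ lt_ij).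
  by rewrite leqNgt (leq_ltn_trans (leq_subr _ _) jp).
Qed.

(** Ratios fixed by the Frobenius lie in the prime field, so [acoef] embeds P in a line over it. *)
Lemma wild_cyclic s : s \in P -> s != 1%g ->
  (forall g, g \in P -> (acoef g / acoef s) ^+ p = acoef g / acoef s) ->
  gval P = <[s]>%g.
Proof.
move=> sP s1 H; apply/eqP; rewrite eqEsubset cycle_subG sP andbT.
apply/subsetP => g gP; have [j jE] := nat_roots (H g gP).
suff -> : g = (s ^+ j)%g by apply: mem_cycle.
apply: acoef_inj; rewrite ?groupX // acoefX //.
by rewrite -mulr_natl -jE divfK // acoef_neq0.
Qed.

Lemma wild_order s : s \in P -> s != 1%g -> #[s]%g = p.
Proof. by move=> sP; apply: abelem_order_p wild_abelem sP. Qed.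

Lemma wild_conj_eq t s g : s \in P -> g \in P -> theta t * acoef s = acoef g ->
  (t * s * t^-1)%g = g.
Proof.
move=> sP gP E; apply: acoef_inj => //; last by rewrite acoef_conj.
apply/wildP; rewrite !thetaM (wildP _ sP) mulr1 thetaV divff //; exact: theta_neq0.
Qed.

Lemma wild_conj_mem t s : s \in P -> (t * s * t^-1)%g \in P.
Proof.
move/wildP => ts; apply/wildP; rewrite !thetaM ts mulr1 thetaV divff //.
exact: theta_neq0.
Qed.

Lemma wild_conj_neq1 (t s : gT) : s != 1%g -> (t * s * t^-1)%g != 1%g.
Proof. by apply: contraNneq => E; rewrite -[s](mulKg t) -[(t * s)%g](mulgKV t) E mul1g mulVg. Qed.

Lemma wild_setT : (forall t, theta t = 1) -> gval P = [set: gT].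
Proof. by move=> H; apply/setP => g; rewrite !inE H eqxx. Qed.

Lemma liftable_cyclic s : s \in P -> s != 1%g -> gval P = <[s]>%g ->
  (forall t, theta t = 1) -> liftable_form p gT.
Proof.
move=> sP s1 PE th1; constructor 1; rewrite -(wild_setT th1) PE.
have cZ : #|Zp_group p| = p by rewrite /= card_Zp ?prime_gt0.
rewrite isog_cyclic_card ?cycle_cyclic // prime_cyclic ?cZ //=.
by rewrite -orderE (wild_order sP s1) eqxx.
Qed.

Lemma liftable_odd s : odd p -> s \in P -> s != 1%g -> gval P = <[s]>%g ->
  (forall t, theta t ^+ 2 = 1) -> liftable_form p gT.
Proof.
move=> p_odd sP s1 PE th2.
have [th1|/existsNP[t0 /eqP t01]] := pselect (forall t, theta t = 1).
  exact: liftable_cyclic sP s1 PE th1.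
have {t01}t0E : theta t0 = -1.
  by have /eqP := th2 t0; rewrite sqrf_eq1 (negPf t01) => /eqP.
have two : (-1 : k) != 1.
  rewrite eq_sym -subr_eq0 opprK -(dvdn_pcharf pk (1 + 1)) dvdn_prime2 //.
  by apply: contraL p_odd => /eqP ->.
(* t0^2 lies in P, of exponent p, so t0^p squares to 1; as p is odd, theta keeps the value -1. *)
pose t := (t0 ^+ p)%g.
have tE : theta t = -1 by rewrite thetaX t0E -signr_odd p_odd.
have os := wild_order sP s1.
have t2 : (t ^+ 2 = 1)%g.
  have t02 : (t0 ^+ 2)%g \in P by apply/wildP; rewrite thetaX th2.
  by rewrite -expgM mulnC expgM wild_expg.
have t_neq1 : t != 1%g by apply: contraNneq two => t1; rewrite -tE t1 theta1.
have ot : #[t]%g = 2%N by apply: nt_prime_order.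
have stE : (t * s * t^-1 = s^-1)%g.
  by apply: wild_conj_eq; rewrite ?groupV // acoefV // tE mulN1r.
have ots : #[t * s]%g = 2%N.
  apply: nt_prime_order => //.
    rewrite expgS expg1.
    have -> : (t * s * (t * s) = (t * s * t^-1) * (t ^+ 2) * s)%g.
      by rewrite expgS expg1 !mulgA mulgKV.
    by rewrite stE t2 mulg1 mulVg.
  apply: contraNneq two => ts1; rewrite -tE -theta1 -ts1 thetaM (wildP _ sP) mulr1 //.
have GE : [set: gT] = (P * <[t]>)%g.
  apply/setP => g; rewrite inE; apply/esym/mulsgP.
  have [/wildP gP|gP] := eqVneq (theta g) 1.
    by exists g 1%g; rewrite ?group1 ?mulg1.
  have gE : theta g = -1 by have /eqP := th2 g; rewrite sqrf_eq1 (negPf gP) => /eqP.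
  exists (g * t^-1)%g t; rewrite ?cycle_id ?mulgKV //.
  by apply/wildP; rewrite thetaM thetaV gE tE divff // oppr_eq0 oner_eq0.
have oG : #|[set: gT]| = p.*2.
  rewrite GE TI_cardMg -?orderE ?ot ?PE -?orderE ?os ?muln2 //.
  apply: coprime_TIg; rewrite /= -!orderE os ot coprimen2 //.
have gen : (<<[set t; t * s]>> = [set: gT])%g.
  apply/eqP; rewrite eqEsubset subsetT GE mulG_subG PE !cycle_subG /=.
  have tG : t \in (<<[set t; t * s]>>)%g by rewrite mem_gen // !inE eqxx.
  have tsG : (t * s)%g \in (<<[set t; t * s]>>)%g by rewrite mem_gen // !inE eqxx orbT.
  by rewrite tG andbT -{1}[s](mulKg t) groupM ?groupV.
have := involutions_gen_dihedral ot ots.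
rewrite gen oG => H; constructor 2; left; split.
  by have := prime_gt1 p_pr; case: (p) p_odd => [|[|[]]].
by apply: H; rewrite -{1}[t]mulg1 (inj_eq (mulgI t)) eq_sym.
Qed.

Section CharTwo.
Hypothesis p2 : p = 2%N.
Let two0 : 2%:R = 0 :> k. Proof. by rewrite -p2 (pcharf0 pk). Qed.
Let opp2 (x : k) : - x = x.
Proof. by apply/eqP; rewrite eq_sym -subr_eq0 opprK -mulr2n -mulr_natr two0 mulr0. Qed.

Lemma wild_order2 s : s \in P -> s != 1%g -> #[s]%g = 2%N.
Proof. by move=> sP s1; rewrite (wild_order sP s1) p2. Qed.

Lemma wild_klein s1 s2 : s1 \in P -> s2 \in P -> s1 != 1%g -> s2 != 1%g -> s1 != s2 ->
  (#|P| <= 4)%N -> gval P = (<[s1]> * <[s2]>)%g /\ (<[s1]> :&: <[s2]> = 1)%g.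
Proof.
move=> P1 P2 n1 n2 n12 P4.
have [o1 o2] := (wild_order P1 n1, wild_order P2 n2).
have ti : (<[s1]> :&: <[s2]> = 1)%g.
  apply: prime_TIg; first by rewrite -orderE o1.
  apply: contra n12 => /subsetP/(_ _ (cycle_id s1)).
  by rewrite /= cycle2g ?wild_order2 // !inE (negPf n1).
split=> //; apply/eqP; rewrite eq_sym eqEcard mul_subG ?cycle_subG //=.
by rewrite TI_cardMg // -!orderE o1 o2 p2.
Qed.

(** The second conjugate h of s is one of the four elements 1, s, g, s g of P; comparing values of
    [acoef] leaves only s g. *)
Lemma theta_cube t : #|P| = 4%N -> theta t != 1 ->
  theta t ^+ 2 = 1 + theta t.
Proof.
move=> oP t1; have [s sP s1] : exists2 s, s \in P & s != 1%g.
  by apply/trivgPn; rewrite -cardG_gt1 oP.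
set w := theta t in t1 *.
have a0 := acoef_neq0 sP s1.
pose g := (t * s * t^-1)%g; pose h := (t * g * t^-1)%g.
have gP : g \in P by apply: wild_conj_mem.
have hP : h \in P by apply: wild_conj_mem.
have aE : acoef g = w * acoef s by rewrite acoef_conj.
have bE : acoef h = w ^+ 2 * acoef s by rewrite acoef_conj // aE expr2 mulrA.
have g1 : g != 1%g by apply: wild_conj_neq1.
have h1 : h != 1%g by apply: wild_conj_neq1.
have gs : s != g.
  by apply: contraNneq t1 => sg; apply/eqP/(mulIf a0); rewrite -aE -sg mul1r.
have [PE _] := wild_klein sP gP s1 g1 gs (eq_leq oP).
have : h \in P by []. rewrite {1}PE => /mulsgP[x y']; rewrite !cycle2g ?wild_order2 //.
rewrite !inE => /orP[] /eqP-> /orP[] /eqP->; rewrite ?mul1g ?mulg1 => E.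
- by rewrite E eqxx in h1.
- case/eqP: t1; apply: (mulIf (theta_neq0 t)); rewrite mul1r -/w -expr2.
  by apply: (mulIf a0); rewrite -bE -aE E.
- case/eqP: t1; apply/eqP; rewrite -subr_eq0 -sqrf_eq0 sqrrB1 opp2.
  have -> : w ^+ 2 = 1 by apply: (mulIf a0); rewrite -bE E mul1r.
  by rewrite -mulr_natr two0 mulr0 addr0 -mulr2n -mulr_natr two0 mulr0.
- by apply: (mulIf a0); rewrite -bE E acoefD // aE mulrDl mul1r.
Qed.

(** The relation bounds P by 4: any element outside 1, s1, s2 has the same [acoef] as s1 s2. If P
    has order 2, conjugation fixes s1 and theta is trivial; if it has order 4, [theta_cube] makes
    the values of theta cube roots of unity. *)
Lemma liftable_two :
  (p %| #|gT|)%N ->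
  (forall s1 s2 s3, s1 \in P -> s2 \in P -> s3 \in P -> s1 != 1%g -> s2 != 1%g ->
     s3 != 1%g -> s1 != s2 -> s1 != s3 -> s2 != s3 -> acoef s1 = acoef s2 + acoef s3) ->
  liftable_form p gT.
Proof.
move=> pG H; have [s1 P1 n1] := wild_neq1 pG.
have o1 := wild_order P1 n1.
have [PE|PE] := eqVneq (gval P) <[s1]>%g.
  apply: (liftable_cyclic P1 n1 PE) => t.
  have tP := wild_conj_mem t P1; rewrite /= PE cycle2g ?wild_order2 // !inE in tP.
  rewrite (negPf (wild_conj_neq1 t n1)) /= in tP.
  apply: (mulIf (acoef_neq0 P1 n1)); rewrite mul1r -acoef_conj //.
  by rewrite (eqP tP).
have [s2 P2 n12] : exists2 s2, s2 \in P & s2 \notin <[s1]>%g.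
  by apply/subsetPn; apply: contra PE => H'; rewrite eqEsubset H' cycle_subG.
have n2 : s2 != 1%g by apply: contraNneq n12 => ->; rewrite group1.
have {n12}n12 : s1 != s2 by apply: contraNneq n12 => <-; rewrite cycle_id.
have P4 : #|P| = 4%N.
  have sub : P \subset [:: 1%g; s1; s2; (s1 * s2)%g].
    apply/subsetP => g gP; rewrite !inE.
    have [|g1] := eqVneq g 1%g => //; have [|gs1] := eqVneq g s1 => //.
    have [|gs2] := eqVneq g s2 => //=; apply/eqP/acoef_inj; rewrite ?groupM //.
    by rewrite acoefD //; apply: H.
  apply/eqP; rewrite eqn_leq; apply/andP; split.
    exact: leq_trans (subset_leq_card sub) (card_size _).
  have ti : (<[s1]> :&: <[s2]> = 1)%g.
    apply: prime_TIg; first by rewrite -orderE o1.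
    apply: contra n12 => /subsetP/(_ _ (cycle_id s1)).
    by rewrite /= cycle2g ?wild_order2 // !inE (negPf n1).
  have := TI_cardMg ti; rewrite -!orderE o1 (wild_order P2 n2) p2 => E.
  rewrite -[4%N]/(2 * 2)%N -E.
  by apply: subset_leq_card; rewrite mul_subG ?cycle_subG.
have [PE2 _] := wild_klein P1 P2 n1 n2 n12 (eq_leq P4).
have [th1|/existsNP[t0 /eqP t01]] := pselect (forall t, theta t = 1).
  constructor 2; right; split=> //; rewrite -(wild_setT th1).
  have ab := wild_abelem; rewrite p2 in ab.
  rewrite (isog_abelem_card _ ab) P4 cardsT card_prod !card_ord /= andbT.
  have Z2 (x : 'Z_2) : (x * x = 1)%g by case: x => [[|[|]]] // i; apply: val_inj.
  apply/abelemP => //; split=> [|[x z] _].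
    by apply/centsP => -[x1 x2] _ [z1 z2] _; congr (_, _); exact: Zp_mulgC.
  by rewrite expgS expg1; congr (_, _); exact: Z2.
have w2 := theta_cube P4 t01; set w := theta t0 in w2 t01.
have w3 : w ^+ 3 = 1.
  by rewrite exprS w2 mulrDr mulr1 -expr2 w2 addrCA -mulr2n -mulr_natr two0 mulr0 addr0.
(* t0^6 = 1, and 4 is 0 modulo 2 and 1 modulo 3: the fourth power removes the wild part of t0 and
   keeps theta. *)
pose t := (t0 ^+ 4)%g.
have tE : theta t = w by rewrite thetaX exprS w3 mulr1.
have t3 : (t ^+ 3 = 1)%g.
  have t03 : (t0 ^+ 3)%g \in P by apply/wildP; rewrite thetaX.
  have e2 : (t0 ^+ 3 ^+ 2 = 1)%g.
    by rewrite -(wild_expg t03) p2.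
  by rewrite -expgM (_ : (4 * 3 = 3 * 2 * 2)%N) // !expgM e2 expg1n.
have t_neq1 : t != 1%g by apply: contraNneq t01 => t1; rewrite -tE t1 theta1.
have ot : #[t]%g = 3%N by apply: nt_prime_order.
have GE : [set: gT] = (P * <[t]>)%g.
  apply/setP => g; rewrite inE; apply/esym/mulsgP.
  suff [n En] : exists n : nat, theta g = w ^+ n.
    exists (g * t ^- n)%g (t ^+ n)%g; rewrite ?mem_cycle ?mulgKV //.
    apply/wildP; rewrite thetaM thetaV thetaX En tE divff // expf_neq0 //.
    exact: theta_neq0.
  have [->|g1] := eqVneq (theta g) 1; first by exists 0%N.
  have g2 := theta_cube P4 g1; set v := theta g in g2 *.
  have : (v - w) * (v - w ^+ 2) = 0.
    have -> : (v - w) * (v - w ^+ 2) = v ^+ 2 - v * (w + w ^+ 2) + w ^+ 3 by ring.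
    rewrite g2 w2 w3 (_ : w + (1 + w) = 1 + 2%:R * w); last by ring.
    by rewrite two0 mul0r addr0 mulr1 addrK -[1 + 1](natrD _ 1 1) two0.
  move/eqP; rewrite mulf_eq0 !subr_eq0 => /orP[] /eqP E; first by exists 1%N; rewrite expr1.
  by exists 2%N.
have oG : #|gT| = 12%N.
  rewrite -cardsT GE TI_cardMg -?orderE ?ot ?P4 //.
  by apply: coprime_TIg; rewrite P4 -orderE ot.
constructor 3; split=> //; apply: (tetrahedral_isog oG P4 ot wild_normal).
  move=> s sP nt_s; apply: contraNneq t01 => E.
  by apply/eqP/(mulIf (acoef_neq0 sP nt_s)); rewrite mul1r -{2}E acoef_conj // tE.
move=> s sP nt_s; apply: acoef_inj; first by rewrite !wild_conj_mem.
  by rewrite groupM ?wild_conj_mem.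
rewrite (acoefD sP (wild_conj_mem t sP)) !acoef_conj ?wild_conj_mem // tE mulrA -expr2 w2.
by rewrite mulrDl mul1r.
Qed.

End CharTwo.

End WeakAction.

Lemma max_ideal_res (p : nat) (p_pr : prime p) (k : fieldType) (A : cln_alg p_pr k) :
  @max_ideal A = (fun a => cln_res A a = 0).
Proof. by apply/funext => a; apply/propext; rewrite cln_res_ker. Qed.

Lemma cln_unit (p : nat) (p_pr : prime p) (k : fieldType) (A : cln_alg p_pr k) (a : A) :
  cln_res A a != 0 -> exists b, a * b = 1.
Proof.
move=> a0; apply: contrapT => H; have a0' : cln_res A a = 0 by apply/cln_res_ker.
by rewrite a0' eqxx in a0.
Qed.

(** * Only the liftable forms lift to a ring where p is nonzero *)

Section NonLifting.
Variables (p : nat) (p_pr : prime p) (k : fieldType) (pk : p \in [pchar k]).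
Variables (gT : finGroupType) (rho : gT -> fps k -> fps k).
Hypotheses (rho_act : fps_action rho) (rho_weak : weak_action rho) (pG : (p %| #|gT|)%N).
Variables (A : cln_alg p_pr k) (N : nat).
Hypothesis A_nil : forall a, ideal_pow (@max_ideal A) N a -> a = 0.
Variable rhoA : gT -> fps A -> fps A.
Hypothesis rhoA_lift : is_lift rho rhoA.

Local Notation r := (cln_res A).
Local Notation P := (wild_group rho_act).
Local Notation y := (fps_var A).
Local Notation a := (acoef rho).

Let nil a : ideal_pow (fun a => r a = 0) N a -> a = 0.
Proof. by rewrite -max_ideal_res; apply: A_nil. Qed.
Let act : fps_action rhoA. Proof. by case: rhoA_lift. Qed.
Let endo g : fps_endo (rhoA g).
Proof. exact: fps_action_endo. Qed.
Let actM g h f : rhoA (g * h)%g f = rhoA g (rhoA h f).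
Proof. exact: fps_actionM. Qed.
Let red g f : fps_map r (rhoA g f) = rho g (fps_map r f).
Proof. by case: rhoA_lift. Qed.
Let redc g f i : r (fps_coef (rhoA g f) i) = fps_coef (rho g (fps_map r f)) i.
Proof. by rewrite -red. Qed.

Let D g := rhoA g y - y.
Let DE g : rhoA g y = y + D g. Proof. by rewrite /D addrC subrK. Qed.

Let rD g i : r (fps_coef (D g) i) = fps_coef (rho g (fps_var k)) i - fps_coef (fps_var k) i.
Proof. by rewrite /D coef_fpsB rmorphB redc fps_map_var -(fps_map_var r). Qed.

Let D2 g : r (fps_coef (D g) 2) = a g.
Proof. by rewrite rD /= subr0. Qed.

Let D_dist g : g \in P -> g != 1%g -> dist2 r (D g).
Proof.
move=> gP g1; split; last by rewrite D2 (acoef_neq0 rho_weak gP).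
  by rewrite rD rho_var0 // subr0.
by rewrite rD -/(theta rho g) (wildP rho_act _ gP) subrr.
Qed.

Let D_dist2 g h : g \in P -> h \in P -> g != h -> dist2 r (D h - D g).
Proof.
move=> gP hP gh; split; rewrite coef_fpsB rmorphB.
- by rewrite (rD h) (rD g) !rho_var0 // subrr.
- rewrite (rD h) (rD g) -/(theta rho g) -/(theta rho h).
  by rewrite (wildP rho_act _ gP) (wildP rho_act _ hP) subrr.
- rewrite !D2 subr_eq0; apply: contraNneq gh => E.
  by apply/eqP; apply: (acoef_inj rho_weak gP hP).
Qed.

Let order_iter g : g \in P -> iter p (rhoA g) y = y.
Proof. by move=> gP; rewrite -fps_actionX // (wild_expg p_pr pk rho_weak gP) fps_action1. Qed.

Let wild_comm g h : g \in P -> h \in P -> (g * h = h * g)%g.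
Proof.
move=> gP hP; have /abelemP[//|/centsP C _] := wild_abelem p_pr pk rho_act rho_weak.
exact: C.
Qed.

(** Each failure of a numerical condition in [liftable_two], [wild_cyclic] or [liftable_odd]
    triggers one of the vanishing results for p. Asking only p <> 0 covers both characteristic p^2
    and the quotients of a versal ring. *)
Lemma nilpotent_lift_form : p%:R != 0 :> A -> liftable_form p gT.
Proof.
move=> p0; have rp0 : r p%:R = 0 by rewrite rmorph_nat (pcharf0 pk).
have [p2|p_odd] := even_prime p_pr.
  apply: (liftable_two p_pr pk rho_weak p2 pG) => s1 s2 s3 P1 P2 P3 n1 n2 n3 n12 n13 n23.
  apply/eqP; apply: contraNT p0 => neq.
  have inv s : s \in P -> rhoA s (rhoA s y) = y.
    (* p cannot be replaced by 2, since the type of A depends on it; hence the generalisation over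
       n. *)
    move/order_iter; suff H n : n = 2%N -> iter n (rhoA s) y = y -> rhoA s (rhoA s y) = y by exact: H.
    by move=> ->.
  have comm s t : s \in P -> t \in P -> rhoA s (rhoA t y) = rhoA t (rhoA s y).
    by move=> sP tP; rewrite -!actM wild_comm.
  suff H : 2%:R = 0 :> A by apply/eqP; rewrite -[RHS]H; congr (_%:R).
  apply: (nonlift_involutions (@cln_unit _ _ _ A) nil (endo s1) (endo s2) (endo s3)
    (DE s1) (DE s2) (DE s3)); rewrite ?D2 //; auto.
have [s sP s1] := wild_neq1 p_pr pk rho_act rho_weak pG.
have PE : gval P = <[s]>%g.
  apply: (wild_cyclic p_pr pk rho_weak sP s1) => g gP.
  have as0 := acoef_neq0 rho_weak sP s1.
  have [->|g1] := eqVneq g 1%g; first by rewrite acoef1 // mul0r expr0n eqn0Ngt prime_gt0.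
  have [->|gs] := eqVneq g s; first by rewrite divff // expr1n.
  have E : a g ^+ p.-1 = a s ^+ p.-1.
    apply/eqP; apply: contraNT p0 => neq; apply/eqP.
    apply: (nonlift_commuting (@cln_unit _ _ _ A) nil p_pr rp0 p_odd (endo s) (endo g)
      (DE s) (DE g)); rewrite ?D2 //; auto.
      by apply: D_dist2 => //; rewrite eq_sym.
    by move=> f; rewrite -!actM wild_comm.
  rewrite -{1}(prednK (prime_gt0 p_pr)) exprS expr_div_n E divff ?mulr1 //.
  by rewrite expf_neq0.
apply: (liftable_odd p_pr pk rho_weak p_odd sP s1 PE) => t.
apply/eqP; apply: contraNT p0 => th2; apply/eqP.
have : (t * s * t^-1)%g \in gval P := wild_conj_mem t sP; rewrite PE => /cycleP[j tj].
have tE : theta rho t = j%:R.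
  apply: (mulIf (acoef_neq0 rho_weak sP s1)).
  by rewrite -acoef_conj // tj acoefX // mulr_natl.
apply: (nonlift_normal (@cln_unit _ _ _ A) nil p_pr rp0 p_odd (endo s) (DE s) _ _ (endo t) (j := j)); auto.
- by move=> f; rewrite -actM -fps_actionX // -actM -tj mulgKV.
- rewrite redc rho_coef2 // {2}/D fps_mapB red fps_map_var !coef_fpsB /= subr0.
  rewrite -/(theta rho s) (wildP rho_act _ sP) subrr mul0r add0r mulf_neq0 //.
    exact: (acoef_neq0 rho_weak).
  by rewrite expf_neq0 // theta_neq0.
- by rewrite -tE subr_eq0 eq_sym.
Qed.

End NonLifting.

(** * Substitutions and their inverses *)

Section Substitution.
Variables (A : comNzRingType) (M : A -> Prop).
Hypothesis M_ideal : is_ideal M.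
Local Notation pw := (ideal_pow M).
Hypothesis pw_sep : forall a, (forall n, pw n a) -> a = 0.
Hypothesis pw_complete : forall u : nat -> A, (forall n, pw n (u n.+1 - u n)) ->
  exists l, forall n, pw n (l - u n).
Implicit Types f g h : fps A.
Local Notation y := (fps_var A).
Local Notation J := (fps_pow M).

Lemma fps_pow_sep f : (forall n, J n f) -> f = 0.
Proof.
move=> fJ; apply: fps_eqP => i; rewrite coef_fps0; apply: pw_sep => n.
by have := fJ (n + i)%N i; rewrite addnK.
Qed.

Lemma fps_pow_limit (F : nat -> fps A) : (forall n, J n (F n.+1 - F n)) ->
  exists G, forall n, J n (G - F n).
Proof.
move=> FJ; have /choice[l Hl] i : exists l, forall n, pw n (l - fps_coef (F (n + i)%N) i).
  apply: (pw_complete (u := fun n => fps_coef (F (n + i)%N) i)) => n.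
  by have := FJ (n + i)%N i; rewrite addnK.
exists (Fps l) => n i; have [le_ni | le_in] := leqP n i.
  by rewrite (eqP (_ : (n - i)%N == 0%N)) // subn_eq0.
have := Hl i (n - i)%N; rewrite subnK; last exact: ltnW.
exact.
Qed.

Lemma endo_var_coef0 (s : fps A -> fps A) f : fps_endo s -> M (fps_coef (s y) 0) ->
  M (fps_coef f 0) -> M (fps_coef (s f) 0).
Proof.
move=> se sy f0; have [_ MD MM] := M_ideal.
rewrite (fps_decomp 1 f) big_ord1 expr0 expr1 (endoD se) (endoM se) (endoA se).
rewrite coef_fpsD coef_fpsZ coef_fps0M /= mulr1.
by apply: MD => //; rewrite mulrC; apply: MM.
Qed.

Lemma endo_varX_pow (s : fps A -> fps A) n f : fps_endo s -> M (fps_coef (s y) 0) ->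
  J n (s (y ^+ n * f)).
Proof.
move=> se sy; rewrite (endoM se) (endoX se) mulrC; apply/fps_powM/fps_powX.
exact/(fps_pow1P _ M_ideal).
Qed.

(** Once the image of y has its constant term in M, an endomorphism is continuous for the (M,
    y)-adic topology, so its values on polynomials determine it. *)
Lemma endo_eq (s t : fps A -> fps A) : fps_endo s -> fps_endo t -> s y = t y ->
  M (fps_coef (s y) 0) -> forall f, s f = t f.
Proof.
move=> se te st sy f; apply/eqP; rewrite -subr_eq0; apply/eqP/fps_pow_sep => n.
rewrite (fps_decomp n f) (endoD se) (endoD te) (endo_sum se) (endo_sum te).
rewrite (eq_bigr (fun i : 'I_n => t (fps_coef f i *: y ^+ i))); last first.
  by move=> i _; rewrite (endoZ se) (endoZ te) (endoX se) (endoX te) st.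
rewrite addrAC opprD addrA subrr add0r addrC; apply: fps_powB; apply: endo_varX_pow => //.
by rewrite -st.
Qed.

(** s f is the limit of the values at h of the truncations of f. Uniqueness of limits, in [sE],
    reduces each algebra law to a congruence between truncations. *)
Lemma subst_exists h : M (fps_coef h 0) -> exists s, fps_endo s /\ s y = h.
Proof.
move=> h0; have hJ n : J n (h ^+ n) by apply/fps_powX/(fps_pow1P _ M_ideal).
pose tr n f : {poly A} := \poly_(i < n) fps_coef f i.
pose ev : {poly A} -> fps A := horner_alg h.
have evJ n (q : {poly A}) : (forall i, (i < n)%N -> q`_i = 0) -> J n (ev q).
  move=> q0; rewrite (_ : q = drop_poly n q * 'X^n); last first.
    rewrite -{1}(poly_take_drop n q) (_ : take_poly n q = 0) ?add0r //.
    by apply/polyP => i; rewrite coef_take_poly coef0; case: ifP => // /q0.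
  rewrite /ev rmorphM rmorphXn /= horner_algX; exact: fps_powM.
have /choice[s Hs] f : exists G, forall n, J n (G - ev (tr n f)).
  apply: fps_pow_limit => n; rewrite -rmorphB; apply: evJ => i lt_in.
  by rewrite coefB !coef_poly lt_in ltnS (ltnW lt_in) subrr.
have sE f G : (forall n, J n (G - ev (tr n f))) -> s f = G.
  move=> HG; apply/eqP; rewrite -subr_eq0; apply/eqP/fps_pow_sep => n.
  rewrite (_ : s f - G = (s f - ev (tr n f)) - (G - ev (tr n f))); last by ring.
  exact: fps_powB.
exists s; split; last first.
  apply: sE => -[|[|n]] //.
    apply: fps_powB; first by apply/(fps_pow1P _ M_ideal).
    by apply: evJ => -[|i] //; rewrite coef_poly.
  rewrite (_ : tr n.+2 y = 'X) ?/ev ?horner_algX ?subrr; first exact: fps_pow0.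
  apply/polyP => i; rewrite coef_poly coefX /=.
  by case: eqP => [->|] //; rewrite if_same.
split=> [a f g|].
  apply: sE => n; rewrite (_ : tr n _ = a *: tr n f + tr n g); last first.
    apply/polyP => i; rewrite coefD coefZ !coef_poly; case: ifP => // _.
    by rewrite mulr0 addr0.
  rewrite /ev rmorphD -mul_polyC rmorphM /= horner_algC.
  rewrite (_ : _ - _ = a *: (s f - ev (tr n f)) + (s g - ev (tr n g))).
    by apply: fps_powD => //; apply: fps_powZ.
  by rewrite scalerBr /ev [a *: horner_alg _ _]fps_scaleE; ring.
split=> [|f g]; apply: sE => n.
  case: n => [|n] //; rewrite (_ : tr n.+1 1 = 1) ?/ev ?rmorph1 ?subrr; first exact: fps_pow0.
  apply/polyP => i; rewrite coef_poly coef1 /=.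
  by case: eqP => [->|] //; rewrite if_same.
have trM : J n (ev (tr n f * tr n g - tr n (f * g))).
  apply: evJ => i lt_in; rewrite coefB coefM coef_poly lt_in coef_fpsM.
  apply/eqP; rewrite subr_eq0; apply/eqP; apply: eq_bigr => j _.
  rewrite !coef_poly (leq_ltn_trans _ lt_in) ?(leq_ltn_trans _ lt_in) ?leq_subr //.
  by rewrite -ltnS.
rewrite (_ : _ - _ = s f * (s g - ev (tr n g)) + ev (tr n g) * (s f - ev (tr n f))
   + ev (tr n f * tr n g - tr n (f * g))).
  by apply: fps_powD => //; apply: fps_powD; apply: fps_powM.
by rewrite /ev rmorphB rmorphM; ring.
Qed.

(* Compositional inverses: the coefficients of Y are determined one at a time *)
Lemma subst_inverse (s : fps A -> fps A) u : fps_endo s ->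
  fps_coef (s y) 0 = 0 -> fps_coef (s y) 1 * u = 1 ->
  exists Y, [/\ s Y = y, fps_coef Y 0 = 0 & fps_coef Y 1 * fps_coef (s y) 1 = 1].
Proof.
move=> se sy0 sy1; set Z := s y in sy0 sy1 *; have [M0 _ _] := M_ideal.
have ZE : Z = y * fps_shift 1 Z.
  by rewrite {1}(@fps_decomp_ord _ 1 Z) ?expr1 // => -[].
(* s (y^m) starts with Z_1^m y^m, and u inverts Z_1: the factor u^m makes the new term cancel the
   defect in degree m. *)
pose W := fix W n : fps A := if n is m.+1 then
  W m + (u ^+ m * fps_coef (y - s (W m)) m) *: y ^+ m else 0.
have WS n : W n.+1 = W n + (u ^+ n * fps_coef (y - s (W n)) n) *: y ^+ n by [].
have ordZ n f i : (i < n)%N -> fps_coef (s (y ^+ n * f)) i = 0.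
  by move=> lt_in; rewrite (endoM se) (endoX se) -/Z ZE exprMn -mulrA coef_varXM lt_in.
have ZX0 n : fps_coef (fps_shift 1 Z ^+ n) 0 = fps_coef Z 1 ^+ n.
  by elim: n => [|n IHn] //; rewrite !exprS coef_fps0M IHn.
have Wcoef n i : (i < n)%N -> fps_coef (y - s (W n)) i = 0.
  elim: n i => // n IHn i; rewrite ltnS leq_eqVlt WS; set c := u ^+ n * _; rewrite (endoD se) (endoZ se) (endoX se).
  rewrite -/Z opprD addrA coef_fpsB coef_fpsZ ZE exprMn coef_varXM.
  case: ltngtP => // [lt_in|->] _; first by rewrite IHn // mulr0 subr0.
  rewrite subnn ZX0 /c mulrAC -exprMn [u * _]mulrC sy1 expr1n mul1r subrr //.
pose Y : fps A := Fps (fun i => fps_coef (W i.+1) i).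
have WY n i : (i < n)%N -> fps_coef (W n) i = fps_coef Y i.
  elim: n => // n IHn; rewrite ltnS leq_eqVlt => /orP[/eqP -> //|lt_in].
  by rewrite WS coef_fpsD coef_fpsZ coef_varX ltn_eqF // mulr0 addr0 IHn.
exists Y; have sY : s Y = y.
  apply: fps_eqP => n; have := Wcoef n.+1 n (ltnSn n).
  have -> : W n.+1 = Y - y ^+ n.+1 * fps_shift n.+1 (Y - W n.+1).
    rewrite -fps_decomp_ord; first by ring.
    by move=> i lt_in; rewrite coef_fpsB WY // subrr.
  rewrite (endoB se) opprB addrA addrAC coef_fpsD ordZ // addr0 coef_fpsB => /eqP.
  by rewrite subr_eq0 => /eqP.
have Y0 : fps_coef Y 0 = 0.
  by rewrite [LHS](_ : _ = fps_coef (W 1%N) 0) // WS [W 0%N]/(0 : fps A) (endo0 se) expr0 add0r coef_fpsZ coef_fpsB !coef_fps0 subr0 mulr0 mul0r.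
have s0 f : fps_coef (s f) 0 = fps_coef f 0.
  rewrite {1}(fps_decomp 1 f) big_ord1 expr0 expr1 (endoD se) (endoM se) (endoA se).
  by rewrite coef_fpsD coef_fpsZ coef_fps0M sy0 mul0r addr0 /= mulr1.
have YE : Y = y * fps_shift 1 Y by rewrite {1}(@fps_decomp_ord _ 1 Y) ?expr1 // => -[].
split=> //; have : fps_coef (s Y) 1 = 1 by rewrite sY.
by rewrite {1}YE (endoM se) -/Z {1}ZE -mulrA coef_varM coef_fps0M s0 mulrC.
Qed.

(** [subst_inverse] only provides t with s t = id. Applied to t, it provides a right inverse of t,
    which must then be s. *)
Lemma subst_bijective Z u : fps_coef Z 0 = 0 -> fps_coef Z 1 * u = 1 ->
  exists s t, [/\ fps_endo s, fps_endo t, s y = Z, cancel s t & cancel t s].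
Proof.
move=> Z0 Z1; have [M0 _ _] := M_ideal.
have [s [se sy]] : exists s, fps_endo s /\ s y = Z by apply: subst_exists; rewrite Z0.
have [Y [sY Y0 Y1]] : exists Y, [/\ s Y = y, fps_coef Y 0 = 0 & fps_coef Y 1 * fps_coef Z 1 = 1].
  by rewrite -sy; apply: (subst_inverse se (u := u)); rewrite sy.
have [t [te ty]] : exists t, fps_endo t /\ t y = Y by apply: subst_exists; rewrite Y0.
have st f : s (t f) = f.
  apply: (@endo_eq (s \o t) id (fps_endo_comp se te)) => //=.
  - by rewrite ty sY.
  - by rewrite ty sY.
have [Y' [tY' Y'0 _]] : exists Y', [/\ t Y' = y, fps_coef Y' 0 = 0 & fps_coef Y' 1 * fps_coef Y 1 = 1].
  by rewrite -ty; apply: (subst_inverse te (u := fps_coef Z 1)); rewrite ty.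
have [t' [te' ty']] : exists t, fps_endo t /\ t y = Y' by apply: subst_exists; rewrite Y'0.
have tt' f : t (t' f) = f.
  apply: (@endo_eq (t \o t') id (fps_endo_comp te te')) => //=.
  - by rewrite ty' tY'.
  - by rewrite ty' tY'.
exists s, t; split=> // f.
by rewrite -[f in LHS]tt' st tt'.
Qed.

End Substitution.

(** * Extending a lift from a subgroup by a cyclic complement *)

Section Extension.
Variables (A : comNzRingType) (k : fieldType) (r : {rmorphism A -> k}).
Variables (gT : finGroupType) (rho : gT -> fps k -> fps k).
Hypothesis rho_act : fps_action rho.
Variable psi : fps A -> fps A.
Implicit Types (T : fps A -> fps A) (R : gT -> fps A -> fps A) (P : {group gT}).

(** psi is a change of coordinate: psi T psi^-1 is the map that lifts rho g. *)
Definition lifts_along g T := forall f, fps_map r (psi (T f)) = rho g (fps_map r (psi f)).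

Definition lift_on (P : {set gT}) R :=
  [/\ forall f, R 1%g f = f,
      {in P &, forall g h f, R (g * h)%g f = R g (R h f)},
      {in P, forall g, fps_endo (R g)}
    & {in P, forall g, lifts_along g (R g)}].

Lemma lifts_along_comp g h T T' :
  lifts_along g T -> lifts_along h T' -> lifts_along (g * h)%g (T \o T').
Proof. by move=> gT' hT' f /=; rewrite gT' hT'; case: rho_act => _ ->. Qed.

Lemma lifts_along_iter g n T : lifts_along g T -> lifts_along (g ^+ n)%g (iter n T).
Proof.
move=> gL; elim: n => [|n IHn] f; first by rewrite (fps_action1 rho_act).
by rewrite expgS; apply: (lifts_along_comp gL IHn).
Qed.

Lemma lift_on1 : lift_on 1%g (fun _ => id).
Proof.
by split=> // g /set1P -> f; rewrite (fps_action1 rho_act).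
Qed.

(** The extension sends a t^i to R a T^i: the commutation rule for T makes it multiplicative, and
    the order of T makes it independent of the exponent i. *)
Lemma lift_extend P R t T : lift_on P R -> t \in 'N(P)%g -> (P :&: <[t]> = 1)%g ->
  fps_endo T -> lifts_along t T -> (forall f, iter #[t]%g T f = f) ->
  {in P, forall a f, T (R a f) = R (t * a * t^-1)%g (T f)} ->
  exists R', [/\ lift_on (P * <[t]>)%g R', {in P, forall a, R' a =1 R a} & R' t =1 T].
Proof.
move=> [R1 RM Re Rl] tP ti Te Tl Tt TR.
have conjP n a : a \in P -> (t ^+ n * a * t ^- n)%g \in P.
  move=> aP; rewrite (_ : _ * _ = a ^ (t ^- n))%g; last by rewrite conjgE invgK mulgA.
  by rewrite memJ_norm // groupV groupX.
have TRn n a f : a \in P -> iter n T (R a f) = R (t ^+ n * a * t ^- n)%g (iter n T f).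
  elim: n => [|n IHn] aP; first by rewrite mul1g invg1 mulg1.
  by rewrite /= IHn // TR ?conjP // expgS invMg !mulgA.
have iter_mod n f : iter n T f = iter (n %% #[t]%g) T f.
  rewrite {1}(divn_eq n #[t]%g) addnC iterD; congr iter.
  by elim: (n %/ _)%N => // m IHm; rewrite mulSn iterD IHm Tt.
have iter_eq i j f : (t ^+ i = t ^+ j)%g -> iter i T f = iter j T f.
  move/eqP; rewrite eq_expg_mod_order => /eqP ij.
  by rewrite iter_mod ij -iter_mod.
have lP x : exists i, x \in <[t]>%g -> x = (t ^+ i)%g.
  by have [/cycleP[i ->]|] := boolP (x \in <[t]>%g); [exists i | exists 0%N].
have [l Hl] := choice lP.
pose R' g := R (divgr P <[t]> g) \o iter (l (remgr P <[t]> g)) T.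
have R'E a i f : a \in P -> R' (a * t ^+ i)%g f = R a (iter i T f).
  move=> aP; rewrite /R' /= (divgrMid ti) ?mem_cycle // (remgrMid ti) ?mem_cycle //.
  by congr (R a _); apply: iter_eq; rewrite -Hl ?mem_cycle.
have decomp g : g \in (P * <[t]>)%g -> exists a i, a \in P /\ g = (a * t ^+ i)%g.
  by case/mulsgP => a _ aP /cycleP[i ->] ->; exists a, i.
have ext a : a \in P -> R' a =1 R a.
  by move=> aP f; have := R'E a 0%N f aP; rewrite mulg1.
exists R'; split=> //; last first.
  by move=> f; have := R'E 1%g 1%N f (group1 P); rewrite mul1g expg1 R1.
split.
- by move=> f; rewrite ext ?group1 ?R1.
- move=> _ _ /decomp[a [i [aP ->]]] /decomp[b [j [bP ->]]] f.
  have -> : (a * t ^+ i * (b * t ^+ j) = a * (t ^+ i * b * t ^- i) * t ^+ (i + j))%g.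
    by rewrite expgD !mulgA mulgKV.
  rewrite (R'E _ (i + j)%N f (groupM aP (conjP i b bP))) (R'E a i _ aP) (R'E b j _ bP).
  by rewrite RM ?conjP // TRn // iterD.
- move=> _ /decomp[a [i [aP ->]]].
  have -> : R' (a * t ^+ i)%g = R a \o iter i T by apply/funext => f; rewrite R'E.
  by apply: fps_endo_comp; [apply: Re | apply: fps_endo_iter].
- move=> _ /decomp[a [i [aP ->]]].
  have -> : R' (a * t ^+ i)%g = R a \o iter i T by apply/funext => f; rewrite R'E.
  by apply: lifts_along_comp; [apply: Rl | apply: lifts_along_iter].
Qed.

Lemma normal_commute P R t T s : lift_on P R -> t \in 'N(P)%g -> gval P = <[s]>%g ->
  (forall f, T (R s f) = R (t * s * t^-1)%g (T f)) ->
  {in P, forall a f, T (R a f) = R (t * a * t^-1)%g (T f)}.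
Proof.
move=> RP tP PE Ts a; have sP : s \in P by rewrite PE cycle_id.
rewrite PE => /cycleP[n ->] f; case: (RP) => R1 RM _ _.
have cP n' : (t * s ^+ n' * t^-1)%g \in P.
  rewrite (_ : _ * _ = (s ^+ n') ^ (t^-1))%g; last by rewrite conjgE invgK mulgA.
  by rewrite memJ_norm ?groupV // groupX.
elim: n f => [|n IHn] f; first by rewrite mulg1 mulgV !R1.
have cs : (t * s * t^-1)%g \in P by have := cP 1%N; rewrite expg1.
rewrite expgS RM ?groupX // Ts IHn -RM //.
by congr (R _ _); rewrite !mulgA mulgKV.
Qed.

Lemma normal_commute2 P R t T s1 s2 : lift_on P R -> t \in 'N(P)%g ->
  gval P = (<[s1]> * <[s2]>)%g ->
  (forall f, T (R s1 f) = R (t * s1 * t^-1)%g (T f)) ->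
  (forall f, T (R s2 f) = R (t * s2 * t^-1)%g (T f)) ->
  {in P, forall a f, T (R a f) = R (t * a * t^-1)%g (T f)}.
Proof.
move=> RP tP PE Ts1 Ts2 a; case: (RP) => R1 RM _ _.
have P1 : s1 \in P.
  by rewrite PE; apply/mulsgP; exists s1 1%g; rewrite ?cycle_id ?group1 ?mulg1.
have P2 : s2 \in P.
  by rewrite PE; apply/mulsgP; exists 1%g s2; rewrite ?cycle_id ?group1 ?mul1g.
have cP x : x \in P -> (t * x * t^-1)%g \in P.
  move=> xP; rewrite (_ : _ * _ = x ^ (t^-1))%g; last by rewrite conjgE invgK mulgA.
  by rewrite memJ_norm ?groupV.
have step s n f : s \in P -> (forall f, T (R s f) = R (t * s * t^-1)%g (T f)) ->
   T (R (s ^+ n)%g f) = R (t * s ^+ n * t^-1)%g (T f).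
  move=> sP Ts; elim: n f => [|n IHn] f; first by rewrite mulg1 mulgV !R1.
  rewrite expgS RM ?groupX // Ts IHn -RM ?cP ?groupX //.
  by congr (R _ _); rewrite !mulgA mulgKV.
rewrite {1}PE => /mulsgP[_ _ /cycleP[i ->] /cycleP[j ->] ->] f.
rewrite RM ?groupX // !step // -RM ?cP ?groupX //.
by congr (R _ _); rewrite !mulgA mulgKV.
Qed.

End Extension.

Section LiftConj.
Variables (p : nat) (p_pr : prime p) (k : fieldType) (A : cln_alg p_pr k).
Variables (gT : finGroupType) (rho : gT -> fps k -> fps k).
Hypothesis rho_act : fps_action rho.
Local Notation r := (cln_res A).
Local Notation M := (fun a : A => r a = 0).

Lemma cln_sep (a : A) : (forall n, ideal_pow M n a) -> a = 0.
Proof. by rewrite -max_ideal_res; case: (@cln_complete _ _ _ A) => + _; apply. Qed.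

Lemma cln_cauchy (u : nat -> A) : (forall n, ideal_pow M n (u n.+1 - u n)) ->
  exists l, forall n, ideal_pow M n (l - u n).
Proof. by rewrite -max_ideal_res; case: (@cln_complete _ _ _ A) => _; apply. Qed.

Lemma lift_on_lift (psi phi : fps A -> fps A) (R : gT -> fps A -> fps A) :
  fps_endo psi -> fps_endo phi -> cancel psi phi -> cancel phi psi ->
  lift_on r rho psi [set: gT] R -> exists rhoA : gT -> fps A -> fps A, is_lift rho rhoA.
Proof.
move=> se te K1 K2 [R1 RM Re Rl].
exists (fun g => psi \o R g \o phi); split; last first.
  by move=> g f /=; rewrite Rl ?inE // K2.
split=> [g|g h f] /=; last by rewrite RM ?inE // K1.
have [] := fps_endo_comp se (fps_endo_comp (Re g (in_setT g)) te).
split=> //; exists (psi \o R g^-1%g \o phi) => f /=.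
  by rewrite K1 -RM ?inE // mulVg R1 K2.
by rewrite K1 -RM ?inE // mulgV R1 K2.
Qed.

(* psi substitutes Z for y, so that psi T psi^-1 sends Z to psi (T y). *)
Lemma lifts_along_var (psi T : fps A -> fps A) g : fps_endo psi -> fps_endo T ->
  fps_coef (psi (fps_var A)) 0 = 0 -> r (fps_coef (T (fps_var A)) 0) = 0 ->
  fps_map r (psi (T (fps_var A))) = rho g (fps_map r (psi (fps_var A))) ->
  lifts_along r rho psi g T.
Proof.
move=> se Te s0 T0 E.
have e := fps_action_endo rho_act g.
have H := @semilinear_ext A k r (fun f => fps_map r (psi (T f))) (fun f => rho g (fps_map r (psi f))).
apply: H => //=.
- by move=> f f'; rewrite (endoD Te) (endoD se) fps_mapD.
- by move=> f f'; rewrite (endoD se) fps_mapD (endoD e).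
- by move=> a f; rewrite (endoZ Te) (endoZ se) fps_mapZ.
- by move=> a f; rewrite (endoZ se) fps_mapZ (endoZ e).
- by move=> f f'; rewrite (endoM Te) (endoM se) fps_mapM.
- by move=> f f'; rewrite (endoM se) fps_mapM (endoM e).
- by rewrite (endo1 Te) (endo1 se) fps_map1.
- by rewrite (endo1 se) fps_map1 (endo1 e).
- apply: (endo_var_coef0 (res_kerP r) se) T0.
  by rewrite s0 rmorph0.
Qed.

End LiftConj.

(** * Coordinates in which the wild part of the action is homographic *)

Section FieldSeries.
Variable k : fieldType.
Implicit Types f g u v : fps k.
Local Notation y := (fps_var k).

Definition has_ord n f := (forall i, (i < n)%N -> fps_coef f i = 0) /\ fps_coef f n != 0.

Lemma has_ord_unit n f : has_ord n f -> exists e e', f = y ^+ n * e /\ e * e' = 1.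
Proof.
case=> f0 fn; have [e' eK] : exists e', fps_shift n f * e' = 1.
  by apply: (@fps_inv _ _ (fps_coef f n)^-1); rewrite /= addn0 divff.
by exists (fps_shift n f), e'; split=> //; apply: fps_decomp_ord.
Qed.

Lemma has_ord_inj n f u v : has_ord n f -> f * u = f * v -> u = v.
Proof.
move=> /has_ord_unit[e [e' [-> eK]]]; rewrite -!mulrA => /fps_varX_inj E.
by rewrite -[u]mul1r -[v]mul1r -eK mulrAC [e * u]E mulrAC.
Qed.

Lemma has_ord_div n f g : has_ord n f -> has_ord n.+1 g ->
  exists z, [/\ z * f = g, fps_coef z 0 = 0 & fps_coef z 1 != 0].
Proof.
move=> /has_ord_unit[e [e' [-> eK]]] [g0 gn].
exists (y * (fps_shift n.+1 g * e')); split.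
- rewrite [RHS](fps_decomp_ord g0) exprS.
  have -> : y * (fps_shift n.+1 g * e') * (y ^+ n * e) =
    y * y ^+ n * fps_shift n.+1 g * (e * e') by ring.
  by rewrite eK mulr1.
- by rewrite coef_varM.
- rewrite coef_varM coef_fps0M mulf_neq0 //= ?addn0 //.
  apply: contra_eq_neq (congr1 (fun f => fps_coef f 0) eK) => e'0.
  by rewrite coef_fps0M e'0 mulr0 coef_fps1 eq_sym oner_eq0.
Qed.

End FieldSeries.

Section Linearization.
Variables (p : nat) (p_pr : prime p) (k : fieldType) (pk : p \in [pchar k]).
Variables (gT : finGroupType) (rho : gT -> fps k -> fps k).
Hypothesis rho_act : fps_action rho.
Hypothesis rho_weak : weak_action rho.
Local Notation y := (fps_var k).
Local Notation P := (wild_group rho_act).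
Local Notation a := (acoef rho).
Local Notation dX s := (fun f => rho s f - f).
Implicit Types (f g h : fps k) (s t : gT).
Let endo (g : gT) := fps_action_endo rho_act g.

Let XD s f g : rho s (f + g) - (f + g) = (rho s f - f) + (rho s g - g).
Proof. by rewrite (endoD (endo s)); ring. Qed.

Lemma wild_coef1 s f : s \in P -> fps_coef (rho s f) 1 = fps_coef f 1.
Proof. by move=> sP; rewrite rho_coef1 // (wildP rho_act _ sP) mulr1. Qed.

Lemma wild_var_eq s : s \in P -> exists e, [/\ rho s y = y * e, fps_coef e 0 = 1 & fps_coef e 1 = a s].
Proof.
move=> sP; exists (fps_shift 1 (rho s y)); split=> //.
  rewrite {1}(@fps_decomp_ord _ 1 (rho s y)) ?expr1 // => -[] // _.
  exact: rho_var0.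
by rewrite /= -[LHS]/(theta rho s) (wildP rho_act _ sP).
Qed.

(** With f = y^m h and rho s y = y e, only e^m = 1 + m a y + ... contributes in degree m + 1,
    because rho s h - h has order at least 2. *)
Lemma wild_diff_ord s m f : s \in P -> (forall i, (i < m)%N -> fps_coef f i = 0) ->
  (forall i, (i <= m)%N -> fps_coef (rho s f - f) i = 0) /\
  fps_coef (rho s f - f) m.+1 = m%:R * a s * fps_coef f m.
Proof.
move=> sP f0; have [e [sy e0 e1]] := wild_var_eq sP.
have {f0} fE := fps_decomp_ord f0; set h := fps_shift m f in fE.
have eX n : fps_coef (e ^+ n) 0 = 1 /\ fps_coef (e ^+ n) 1 = n%:R * a s.
  elim: n => [|n [E0 E1]]; first by rewrite expr0 coef_fps1 mul0r.
  by rewrite exprS coef_fps0M coef_fps1M e0 e1 E0 E1 -natr1 !mul1r mulr1; split=> //; ring.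
have E : rho s f - f = y ^+ m * (e ^+ m * rho s h - h).
  rewrite {1 2}fE (endoM (endo s)) (endoX (endo s)) sy exprMn; ring.
have [E0 E1] := eX m.
have c0 : fps_coef (e ^+ m * rho s h - h) 0 = 0.
  by rewrite coef_fpsB coef_fps0M E0 mul1r rho_coef0 // subrr.
split=> [i|].
  rewrite E coef_varXM leq_eqVlt; case: ltngtP => // -> _.
  by rewrite subnn.
rewrite E coef_varXM ifF ?subSnn; last by rewrite ltnNge leqnSn.
rewrite coef_fpsB coef_fps1M E0 E1 mul1r.
rewrite rho_coef0 // wild_coef1 // fE coef_varXM ltnn subnn; ring.
Qed.

Lemma iter_diff_binomial s n f : iter n (rho s) f =
  \sum_(i < n.+1) iter i (dX s) f *+ 'C(n, i).
Proof.
elim: n => [|n IHn]; first by rewrite big_ord1 mulr1n.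
rewrite iterS IHn (endo_sum (endo s)).
rewrite (eq_bigr (fun i : 'I_n.+1 => iter i (dX s) f *+ 'C(n, i) +
   iter i.+1 (dX s) f *+ 'C(n, i))); last first.
  move=> i _; rewrite iterS -mulrnDl; set v := iter i _ f.
  elim: ('C(n, i)) => [|m IHm]; first by rewrite !mulr0n (endo0 (endo s)).
  by rewrite !mulrS (endoD (endo s)) IHm; ring.
rewrite big_split /= big_ord_recl [RHS]big_ord_recl !bin0 -addrA; congr (_ + _).
rewrite [RHS](eq_bigr (fun i : 'I_n.+1 => iter i.+1 (dX s) f *+ 'C(n, i.+1) +
   iter i.+1 (dX s) f *+ 'C(n, i))); last by move=> i _; rewrite binS mulrnDr.
rewrite big_split /= [X in _ = X + _]big_ord_recr /= bin_small // mulr0n addr0.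
by congr (_ + _); apply: eq_bigr => i _.
Qed.

Let charfps f : f *+ p = 0.
Proof. by rewrite -scaler_nat (pcharf0 pk) scale0r. Qed.

(** In characteristic p, (s - 1)^p = s^p - 1. *)
Lemma iter_diff_p s f : s \in P -> iter p (dX s) f = 0.
Proof.
move=> sP; have := iter_diff_binomial s p f.
rewrite -(fps_actionX rho_act) (wild_expg p_pr pk rho_weak sP) fps_action1 //.
have := prime_gt0 p_pr; case: (p) p_pr charfps => // q q_pr charq _.
rewrite big_ord_recl big_ord_recr /= bin0 binn !mulr1n big1 ?add0r => [|i _].
  by rewrite -{1}[f]addr0 => /addrI <-.
have /dvdnP[c ->] : (q.+1 %| 'C(q.+1, bump 0 i))%N.
  by rewrite prime_dvd_bin //= /bump /= add1n ltnS.
by rewrite mulnC mulrnA charq mul0rn.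
Qed.

Lemma linear_cyclic s f0 : s \in P -> s != 1%g -> has_ord 1 f0 ->
  exists z, [/\ fps_coef z 0 = 0, fps_coef z 1 != 0, rho s z * (1 + z) = z
    & odd p -> forall t, (t * s * t^-1 = s^-1)%g -> rho t f0 = - f0 -> rho t z = - z].
Proof.
move=> sP s1 f0ord; have as0 := acoef_neq0 rho_weak sP s1.
(* Each application of s - 1 raises the order by one as long as the current order is prime to p. *)
have Xord n : (n < p)%N -> has_ord n.+1 (iter n (dX s) f0).
  elim: n => [|n IHn] // lt_np; have [u0 un] := IHn (ltnW lt_np).
  have [E1 E2] := wild_diff_ord sP u0; split=> //.
  rewrite iterS E2 !mulf_neq0 // -(dvdn_pcharf pk).
  by apply/negP => /(dvdn_leq (ltn0Sn n)); rewrite leqNgt lt_np.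
have p_gt1 := prime_gt1 p_pr.
(* s t = t and s G = G + t, so that z = t / (G + t) has s z = t / (G + 2 t). *)
pose G := iter (p - 2) (dX s) f0; pose t := iter p.-1 (dX s) f0.
have p1E : p.-1 = (p - 2).+1 by lia.
have pE : p = p.-1.+1 by lia.
have tE : rho s G = G + t by rewrite /t p1E iterS -/G; ring.
have st : rho s t = t.
  apply/eqP; rewrite -subr_eq0 -[_ - _]/(iter p.-1.+1 (dX s) f0) -pE.
  by rewrite iter_diff_p.
have Gord : has_ord p.-1 G by rewrite p1E; apply: Xord; lia.
have tord : has_ord p.-1.+1 t by apply: Xord; lia.
(* For s alone the denominator G would do as well; adding t makes it fixed by a tame involution that
   negates f0. *)
pose H := G + t.
have Hord : has_ord p.-1 H.
  case: Gord tord => G0 Gp [t0 _]; split=> [i lt_ip|].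
    by rewrite coef_fpsD G0 // t0 ?addr0 // ltnW.
  by rewrite coef_fpsD t0 ?addr0.
have sH : rho s H = H + t by rewrite /H (endoD (endo s)) tE st.
have [z [zH z0 z1]] := has_ord_div Hord tord.
exists z; split=> //.
  apply: (has_ord_inj Hord).
  have : rho s z * rho s H = t by rewrite -(endoM (endo s)) zH st.
  rewrite sH -{1}zH => E.
  by rewrite [RHS]mulrC zH -E; ring.
move=> p_odd tau tau_s tau_f0.
(* tau s = s^-1 tau and s^-1 - 1 = - s^-1 (s - 1), whence the sign and the iterates of s^-1. *)
have tauX n f : rho tau (iter n (dX s) f) = (-1) ^+ n *: iter n (rho s^-1%g) (iter n (dX s) (rho tau f)).
  have sV u : rho s^-1%g (rho s u) = u by rewrite -fps_actionM // mulVg fps_action1.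
  elim: n f => [|n IHn] f; first by rewrite expr0 scale1r.
  rewrite iterSr IHn (endoB (endo tau)) -(fps_actionM rho_act).
  have -> : (tau * s = s^-1 * tau)%g by rewrite -tau_s mulgKV.
  rewrite (fps_actionM rho_act); set u := rho tau f.
  have -> : rho s^-1%g u - u = - rho s^-1%g (rho s u - u).
    by rewrite (endoB (endo _)) sV opprB.
  have XN m v : iter m (dX s) (- v) = - iter m (dX s) v.
    by elim: m => // m IHm; rewrite iterS IHm /= (endoN (endo s)); ring.
  have Xs m v : iter m (dX s) (rho s^-1%g v) = rho s^-1%g (iter m (dX s) v).
    elim: m => // m IHm; rewrite iterS IHm /= (endoB (endo _)) -!(fps_actionM rho_act).
    by rewrite mulgV mulVg.
  have sN m v : iter m (rho s^-1%g) (- v) = - iter m (rho s^-1%g) v.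
    by elim: m => // m IHm; rewrite iterS IHm /= (endoN (endo _)).
  by rewrite XN Xs sN -iterSr -iterSr exprS mulN1r scaleNr scalerN.
have sVt : rho s^-1%g t = t by rewrite -{1}st -(fps_actionM rho_act) mulVg fps_action1.
have sVG : rho s^-1%g G = G - t.
  by rewrite -[G in RHS](fps_action1 rho_act) -(mulVg s) (fps_actionM rho_act) tE (endoD (endo _)) sVt addrK.
have itN m v : iter m (rho s^-1%g) (- v) = - iter m (rho s^-1%g) v.
  by elim: m => // m IHm; rewrite iterS IHm /= (endoN (endo _)).
have XN m v : iter m (dX s) (- v) = - iter m (dX s) v.
  by elim: m => // m IHm; rewrite iterS IHm /= (endoN (endo s)); ring.
have tau_t : rho tau t = - t.
  rewrite tauX tau_f0 XN itN -/t.
  have -> : iter p.-1 (rho s^-1%g) t = t by elim: p.-1 => // m IHm; rewrite iterS IHm.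
  have ev : odd p.-1 = false by move: p_odd; rewrite {1}pE /= => /negPf.
  by rewrite -signr_odd ev expr0 scale1r.
have tau_G : rho tau G = G + t *+ 2.
  rewrite tauX tau_f0 XN itN -/G.
  have -> m : iter m (rho s^-1%g) G = G - t *+ m.
    elim: m => [|m IHm]; first by rewrite subr0.
    rewrite iterS IHm (endoB (endo _)) sVG mulrSr opprD.
    have -> : rho s^-1%g (t *+ m) = t *+ m.
      by elim: (m) => [|n IHn]; rewrite ?(endo0 (endo _)) // mulrS (endoD (endo _)) IHn sVt.
    by ring.
  have od : odd (p - 2) by rewrite oddB // p_odd.
  rewrite -signr_odd od expr1 scaleN1r opprK.
  congr (_ + _); apply/eqP; rewrite eq_sym -addr_eq0 -mulrnDr subnKC //.
  by rewrite charfps.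
have tauH : rho tau H = H by rewrite /H (endoD (endo _)) tau_t tau_G mulr2n; ring.
apply: (has_ord_inj Hord); rewrite mulrC -{1}tauH -(endoM (endo _)) zH tau_t -zH; ring.
Qed.

Section CharTwo.
Hypothesis p2 : p = 2%N.

Let addff f : f + f = 0.
Proof. by rewrite -mulr2n -p2 charfps. Qed.
Let addcc (c : k) : c + c = 0.
Proof. by rewrite -mulr2n -p2 -mulr_natr (pcharf0 pk) mulr0. Qed.
Let oppc (c : k) : - c = c.
Proof. by apply/eqP; rewrite eq_sym -addr_eq0 addcc. Qed.

Lemma diff_shift2 s h : s \in P -> fps_coef (rho s h - h) 2 = a s * fps_coef h 1.
Proof.
move=> sP; pose c := (fps_coef h 0)%:A : fps k.
have h0 i : (i < 1)%N -> fps_coef (h - c) i = 0.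
  by case: i => // _; rewrite coef_fpsB coef_fpsZ /= mulr1 subrr.
have [_] := wild_diff_ord sP h0.
rewrite (endoB (endo s)) (endoA (endo s)) mul1r.
have -> : fps_coef (h - c) 1 = fps_coef h 1 by rewrite coef_fpsB coef_fpsZ /= mulr0 subr0.
move=> <-.
by congr (fps_coef _ _); ring.
Qed.

Lemma wild_var_diff s : s \in P -> exists u, [/\ rho s y - y = y ^+ 2 * u,
  fps_coef u 0 = a s & fps_coef u 1 = fps_coef (rho s y) 3].
Proof.
move=> sP; exists (fps_shift 2 (rho s y - y)); split; rewrite ?coef_fpsB /= ?subr0 //.
have [|y0 _] := @wild_diff_ord s 1 y sP; first by case.
by apply: fps_decomp_ord => i lt_i2; apply: y0; rewrite -ltnS.
Qed.

(** The involution s fixes U = rho s y - y = y^2 u. After division of this relation by y^2, the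
    coefficient of degree 2 reads a u_1 + a^3 = 0. *)
Lemma wild_coef3 s : s \in P -> fps_coef (rho s y) 3 = a s ^+ 2.
Proof.
move=> sP; have [->|s1] := eqVneq s 1%g; first by rewrite acoef1 // fps_action1 // expr0n.
have as0 := acoef_neq0 rho_weak sP s1.
have [u [UE u0 u1]] := wild_var_diff sP; set U := rho s y - y in UE.
have sy : rho s y = y + U by rewrite /U; ring.
have XU : rho s U - U = 0.
  have := iter_diff_p y sP; suff H n : n = 2%N -> iter n (dX s) y = rho s U - U by rewrite (H p).
  by move=> ->.
have : y ^+ 2 * (rho s u - u + y ^+ 2 * u ^+ 2 * rho s u) = y ^+ 2 * 0.
  rewrite mulr0 -XU {1 2}UE (endoM (endo s)) (endoX (endo s)) sy.
  have -> : (y + U) ^+ 2 = y ^+ 2 + U ^+ 2.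
    rewrite sqrrD -addrA; congr (_ + _).
    by rewrite mulr2n addff add0r.
  by rewrite UE; ring.
move/fps_varX_inj => E.
have := congr1 (fun f => fps_coef f 2) E; rewrite coef_fps0 coef_fpsD diff_shift2 //.
rewrite -[y ^+ 2 * u ^+ 2 * _]mulrA coef_varXM ltnn subnn coef_fps0M rho_coef0 // u1.
rewrite expr2 coef_fps0M u0 => F.
apply: (mulfI as0); apply/eqP; rewrite -subr_eq0 oppc; apply/eqP.
by rewrite -[RHS]F; ring.
Qed.

Lemma diff_coef3 s f : s \in P -> fps_coef f 0 = 0 ->
  fps_coef (rho s f - f) 3 = a s ^+ 2 * fps_coef f 1.
Proof.
move=> sP f0; have fE : f = y * fps_shift 1 f.
  by rewrite {1}(@fps_decomp_ord _ 1 f) ?expr1 // => -[].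
set h := fps_shift 1 f in fE.
have -> : rho s f - f = (rho s y - y) * rho s h + y * (rho s h - h).
  by rewrite {1 2}fE (endoM (endo s)); ring.
have [u [-> u0 u1]] := wild_var_diff sP.
rewrite coef_fpsD coef_varM diff_shift2 // -mulrA coef_varXM -[(3 < 2)%N]/false -[(3 - 2)%N]/1%N coef_fps1M.
rewrite u0 u1 rho_coef0 // wild_coef1 // wild_coef3 // addrAC addcc add0r.
by congr (_ * _).
Qed.

(** G is the combination of the two differences whose y^2-coefficient 2 a_2 f_1 vanishes. Its
    y^3-coefficient is a_2 (a_1 + a_2) f_1, where f_1 is that of y in f0, so G has order 3; t = s1 G
    - G has order 4 and is fixed by s1 and s2. Hence t / G is a parameter moved homographically by
    both. *)
Lemma linear_klein s1 s2 f0 (c := a s2 / a s1) :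
  s1 \in P -> s2 \in P -> s1 != 1%g -> s2 != 1%g -> s1 != s2 -> has_ord 1 f0 ->
  exists z, [/\ fps_coef z 0 = 0, fps_coef z 1 != 0, rho s1 z * (1 + z) = z,
     rho s2 z * (1 + c *: z) = z
   & forall t, (t * s1 * t^-1 = s2)%g -> (t * s2 * t^-1 = s1 * s2)%g ->
     c ^+ 2 = 1 + c -> rho t f0 = c *: f0 -> rho t z = c *: z].
Proof.
move=> P1 P2 n1 n2 n12 f0ord.
have a10 := acoef_neq0 rho_weak P1 n1; have a20 := acoef_neq0 rho_weak P2 n2.
have a12 : a s1 + a s2 != 0.
  rewrite -[a s2]oppc subr_eq0; apply: contraNneq n12 => /(acoef_inj rho_weak P1 P2).
  by move/eqP.
have XX s f : s \in P -> rho s (rho s f - f) = rho s f - f.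
  move=> sP; apply/eqP; rewrite -subr_eq0; apply/eqP.
  have := iter_diff_p f sP.
  suff H n : n = 2%N -> iter n (dX s) f = rho s (rho s f - f) - (rho s f - f) by rewrite (H p).
  by move=> ->.
have comm f : rho s1 (rho s2 f) = rho s2 (rho s1 f).
  have /abelemP[//|/centsP C _] := wild_abelem p_pr pk rho_act rho_weak.
  by rewrite -!(fps_actionM rho_act) (C _ P1 _ P2).
pose X1 f := rho s1 f - f; pose X2 f := rho s2 f - f.
pose t := X1 (X2 f0); pose G := c *: X1 f0 + X2 f0.
have tE : t = X2 (X1 f0).
  by rewrite /t /X1 /X2 (endoB (endo _)) (endoB (endo _)) comm; ring.
have s1t : rho s1 t = t by rewrite /t /X1 XX.
have s2t : rho s2 t = t by rewrite tE /X2 XX.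
have s1G : rho s1 G = G + t.
  rewrite /G (endoD (endo _)) (endoZ (endo _)) [rho s1 (X1 _)]XX // -addrA.
  by congr (_ + _); rewrite /t {1}/X1; ring.
have s2G : rho s2 G = G + c *: t.
  rewrite /G (endoD (endo _)) (endoZ (endo _)) [rho s2 (X2 _)]XX // addrAC -scalerDr tE.
  by congr (_ *: _ + _); rewrite /X2; ring.
case: f0ord => f00 f01.
have [X1a X1b] := wild_diff_ord P1 f00; have [X2a X2b] := wild_diff_ord P2 f00.
have Gord : has_ord 3 G.
  split=> [[|[|[|]]] // _|]; rewrite coef_fpsD coef_fpsZ.
  - by rewrite X1a // X2a // mulr0 addr0.
  - by rewrite X1a // X2a // mulr0 addr0.
  - rewrite X1b X2b !mul1r mulrA /c divfK //; exact: addcc.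
  rewrite !diff_coef3 ?(f00 0%N) //.
  set w := fps_coef f0 1.
  have -> : c * (a s1 ^+ 2 * w) + a s2 ^+ 2 * w = a s2 * (a s1 + a s2) * w.
    by rewrite /c; field.
  by rewrite !mulf_neq0.
have [tord tord4] : (forall i, (i < 4)%N -> fps_coef t i = 0) /\ fps_coef t 4 = a s1 * fps_coef G 3.
  have tG : t = rho s1 G - G by rewrite s1G; ring.
  case: Gord => G0 _; have [E1 E2] := wild_diff_ord P1 G0.
  split=> [i lt_i4|]; first by rewrite tG E1.
  by rewrite {1}tG E2; congr (_ * _); rewrite -[3%N]/(2 + 1)%N natrD -{1}p2 (pcharf0 pk) add0r mul1r.
have {tord4}tord : has_ord 4 t by split=> //; rewrite tord4 mulf_neq0 //; case: Gord.
(* In the case of the last clause, tau sends t to c t and G to G + c t with c^3 = 1; c^2 is the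
   multiple of t that makes H fixed by tau. *)
pose H := G + c ^+ 2 *: t.
have Hord : has_ord 3 H.
  case: Gord tord => G0 G3 [t0 _]; split=> [i lt_i|]; rewrite coef_fpsD coef_fpsZ.
    by rewrite G0 // t0 ?mulr0 ?addr0 // ltnW.
  by rewrite t0 // mulr0 addr0.
have [z [zH z0 z1]] := has_ord_div Hord tord.
exists z; split=> //.
- apply: (has_ord_inj Hord).
  have E : rho s1 z * rho s1 H = t by rewrite -(endoM (endo _)) zH s1t.
  have {}E : rho s1 z * (H + z * H) = t.
    rewrite -[RHS]E zH; congr (_ * _).
    by rewrite /H (endoD (endo _)) (endoZ (endo _)) s1G s1t addrAC.
  by rewrite [RHS]mulrC zH -E; ring.
- apply: (has_ord_inj Hord).
  have E : rho s2 z * rho s2 H = t by rewrite -(endoM (endo _)) zH s2t.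
  have {}E : rho s2 z * (H + c *: (z * H)) = t.
    rewrite -[RHS]E zH; congr (_ * _).
    by rewrite /H (endoD (endo _)) (endoZ (endo _)) s2G s2t addrAC.
  by rewrite [RHS]mulrC zH -E; fps_ring.
move=> tau ts1 ts2 c2 tf0.
have tX1 f : rho tau (X1 f) = X2 (rho tau f).
  by rewrite /X1 /X2 (endoB (endo _)) -!(fps_actionM rho_act) -ts1 mulgKV.
have tX2 f : rho tau (X2 f) = X1 (X2 (rho tau f)) + X1 (rho tau f) + X2 (rho tau f).
  have -> : rho tau (X2 f) = rho s1 (rho s2 (rho tau f)) - rho tau f.
    rewrite /X2 (endoB (endo _)) -!(fps_actionM rho_act); congr (rho _ _ - _).
    by rewrite -ts2 mulgKV.
  by rewrite /X1 /X2 (endoB (endo _)); ring.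
have XZ s f : rho s (c *: f) - c *: f = c *: (rho s f - f).
  by rewrite (endoZ (endo _)) scalerBr.
have c3 : c ^+ 3 = 1.
  by rewrite exprS c2 mulrDr mulr1 -expr2 c2 addrCA addcc addr0.
have X1Z f : X1 (c *: f) = c *: X1 f by exact: XZ.
have X2Z f : X2 (c *: f) = c *: X2 f by exact: XZ.
have X2D f g : X2 (f + g) = X2 f + X2 g by exact: XD.
have X22 f : X2 (X2 f) = 0 by rewrite {1}/X2 XX // subrr.
have X12 f : X2 (X1 f) = X1 (X2 f).
  by rewrite /X1 /X2 (endoB (endo _)) (endoB (endo _)) comm; ring.
have X10' : X1 0 = 0 by rewrite /X1 (endo0 (endo _)) subr0.
have tt : rho tau t = c *: t.
  rewrite /t tX1 tX2 tf0; set v := c *: f0.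
  rewrite (X2D (X1 (X2 v) + X1 v) (X2 v)) (X2D (X1 (X2 v)) (X1 v)) X22 (X12 (X2 v)) X22.
  by rewrite X10' add0r addr0 X12 /v X2Z X1Z.
have tG : rho tau G = G + c *: t.
  rewrite {1}/G (endoD (endo _)) (endoZ (endo _)) tX1 tX2 tf0 !X2Z !X1Z -/t scalerA -expr2 c2.
  rewrite /G scalerDl scale1r.
  have -> : X2 f0 + c *: X2 f0 + (c *: t + c *: X1 f0 + c *: X2 f0) =
    (c *: X2 f0 + c *: X2 f0) + (c *: X1 f0 + X2 f0 + c *: t) by ring.
  by rewrite addff add0r.
have tH : rho tau H = H.
  rewrite /H (endoD (endo _)) (endoZ (endo _)) tG tt scalerA -exprSr c3 -addrA -scalerDl.
  by rewrite addrC [c + 1]addrC -c2 addrC.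
apply: (has_ord_inj Hord).
by rewrite mulrC -{1}tH -(endoM (endo _)) zH tt -zH; fps_ring.
Qed.

End CharTwo.
End Linearization.

(** * Homographic lifts *)

Section MobiusLifts.
Variables (p : nat) (p_pr : prime p) (k : fieldType) (A : cln_alg p_pr k).
Variables (gT : finGroupType) (rho : gT -> fps k -> fps k).
Hypothesis rho_act : fps_action rho.
Local Notation r := (cln_res A).
Local Notation M := (fun a : A => r a = 0).
Local Notation y := (fps_var A).
Implicit Types (T F : fps A -> fps A) (al be ga de c : A).

(** The homography y -> (be + al y) / (de + ga y), written without division; be in M makes the
    substitution converge. *)
Definition mobius al be ga de T :=
  [/\ fps_endo T, r be = 0, r de != 0 & T y * (de%:A + ga *: y) = be%:A + al *: y].

Lemma mobius_exists al be ga de : r be = 0 -> r de != 0 -> exists T, mobius al be ga de T.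
Proof.
move=> be0 de0; have [de' deK] := cln_unit de0.
have [e eK] : exists e, (de%:A + ga *: y) * e = 1.
  by apply: (@fps_inv _ _ de'); rewrite coef_fpsD !coef_fpsZ /= mulr0 addr0 mulr1.
have [|T [Te Ty]] := @subst_exists A M (res_kerP r) (@cln_sep _ _ _ A) (@cln_cauchy _ _ _ A)
   (e * (be%:A + al *: y)).
  rewrite coef_fps0M coef_fpsD !coef_fpsZ /= mulr0 addr0 mulr1 rmorphM.
  by rewrite be0 mulr0.
exists T; split=> //; rewrite Ty mulrC mulrA eK mul1r //.
Qed.

Lemma mobius_coef0 al be ga de T : mobius al be ga de T -> r (fps_coef (T y) 0) = 0.
Proof.
case=> _ be0 de0 /(congr1 (fun f => r (fps_coef f 0))).
rewrite coef_fps0M !coef_fpsD !coef_fpsZ /= !mulr0 !addr0 !mulr1 rmorphM be0 => /eqP.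
by rewrite mulf_eq0 (negPf de0) orbF => /eqP.
Qed.

Lemma cln_endo_eq F T : fps_endo F -> fps_endo T -> F y = T y ->
  r (fps_coef (F y) 0) = 0 -> F =1 T.
Proof. exact: (@endo_eq A M (res_kerP r) (@cln_sep _ _ _ A)). Qed.

Lemma cln_endo_coef0 F f : fps_endo F -> r (fps_coef (F y) 0) = 0 ->
  r (fps_coef f 0) = 0 -> r (fps_coef (F f) 0) = 0.
Proof. exact: (endo_var_coef0 (res_kerP r)). Qed.

Lemma fps_cancel (u f g : fps A) : r (fps_coef u 0) != 0 -> f * u = g * u -> f = g.
Proof.
case/(fps_unit (@cln_unit _ _ _ A)) => v uv /(congr1 (fun w => w * v)).
by rewrite -!mulrA uv !mulr1.
Qed.

Variables (psi : fps A -> fps A) (z : fps k).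
Hypotheses (psi_endo : fps_endo psi) (psi0 : fps_coef (psi y) 0 = 0).
Hypothesis psiz : fps_map r (psi y) = z.
Local Notation along := (lifts_along r rho psi).
Local Notation lift_on := (lift_on r rho psi).

Lemma mobius_along g al be ga de T : mobius al be ga de T ->
  rho g z * ((r de)%:A + r ga *: z) = r al *: z -> along g T.
Proof.
move=> mT E; have [Te be0 de0 Ty] := mT; have T0 := mobius_coef0 mT.
apply: lifts_along_var => //; rewrite psiz.
have z0 : fps_coef z 0 = 0 by rewrite -psiz /= psi0 rmorph0.
have := congr1 (fun f => fps_map r (psi f)) Ty.
rewrite !(endoM psi_endo, endoD psi_endo, endoA psi_endo, endoZ psi_endo).
rewrite !(fps_mapM, fps_mapD, fps_mapZ, fps_map1) be0 scale0r add0r psiz -E.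
have [v vK] : exists v, ((r de)%:A + r ga *: z) * v = 1.
  apply: (@fps_inv _ _ (r de)^-1).
  by rewrite coef_fpsD !coef_fpsZ z0 /= mulr0 addr0 mulr1 divff.
by move/(congr1 (fun w => w * v)); rewrite -!mulrA vK !mulr1.
Qed.

Lemma lift_cyclic s F : fps_endo F -> along s F -> (forall f, iter #[s]%g F f = f) ->
  exists R, lift_on <[s]>%g R /\ R s =1 F.
Proof.
move=> Fe Fs Fn; have [||||||R [RP _ Rs]] := @lift_extend A k r gT rho rho_act psi 1%G _ s F
  (lift_on1 r rho_act psi) => //.
- by apply: (subsetP (norms1 [set: gT])); rewrite inE.
- by apply/trivgP; apply: subsetIl.
by exists R; split=> //; rewrite mul1g in RP.
Qed.

(* (1 + sqrt c)^n = mob_e n c + mob_f n c sqrt c, so these are the entries of *)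
(* the n-th power of the matrix (1, c; 1, 1).                                 *)
Definition mob_e n c : A := \sum_(j < n.+1) c ^+ j *+ 'C(n, j.*2).
Definition mob_f n c : A := \sum_(j < n) c ^+ j *+ 'C(n, j.*2.+1).

Lemma mob_fS n c : mob_f n.+1 c = mob_f n c + mob_e n c.
Proof.
rewrite /mob_f /mob_e [X in X + _](_ : _ = \sum_(j < n.+1) c ^+ j *+ 'C(n, j.*2.+1)).
  by rewrite -big_split /=; apply: eq_bigr => j _; rewrite binS mulrnDr.
by rewrite big_ord_recr /= bin_small ?addr0 // ltnS -addnn leq_addr.
Qed.

Lemma mob_eS n c : mob_e n.+1 c = mob_e n c + c * mob_f n c.
Proof.
rewrite {1}/mob_e big_ord_recl /= bin0 expr0 mulr1n.
rewrite (eq_bigr (fun j : 'I_n.+1 => c ^+ j.+1 *+ 'C(n, j.+1.*2) + c ^+ j.+1 *+ 'C(n, j.*2.+1))).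
  rewrite big_split /= addrA; congr (_ + _).
    rewrite /mob_e [RHS]big_ord_recl /= bin0; congr (_ + _).
    rewrite big_ord_recr /= bin_small ?addr0; last by rewrite -addnn addSn ltnS leq_addr.
    by apply: eq_bigr => j _.
  rewrite big_ord_recr /= bin_small ?addr0 ?mulr_sumr; last first.
    by rewrite ltnS -addnn leq_addr.
  by apply: eq_bigr => j _; rewrite exprS mulrnAr.
by move=> j _; rewrite /bump /= add1n doubleS binS mulrnDr.
Qed.

Lemma mob_iter c F n : mobius 1 c 1 1 F ->
  iter n F y * ((mob_e n c)%:A + mob_f n c *: y) = (c * mob_f n c)%:A + mob_e n c *: y.
Proof.
case=> Fe c0 _; rewrite !scale1r => Fy.
have y1 : r (fps_coef (1 + y) 0) != 0.
  by rewrite coef_fpsD /= addr0 rmorph1 oner_eq0.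
elim: n => [|n IHn].
  rewrite /mob_e /mob_f big_ord1 big_ord0 /= bin0 mulr0 !scale0r addr0 add0r.
  by rewrite !scale1r mulr1.
have /= := congr1 F IHn; rewrite !(endoM Fe, endoD Fe, endoA Fe, endoZ Fe) => E.
rewrite mob_fS mob_eS; apply: (fps_cancel y1).
set e := mob_e n c in E *; set f := mob_f n c in E *; set u := F (iter n F y) in E *.
have -> : ((e + c * f)%:A + (f + e) *: y) = e *: (1 + y) + f *: (c%:A + y) by fps_ring.
have -> : (c * (f + e))%:A + (e + c * f) *: y = (c * f) *: (1 + y) + e *: (c%:A + y) by fps_ring.
rewrite -{1 2}Fy.
have -> : u * (e *: (1 + y) + f *: (F y * (1 + y))) * (1 + y) =
  (u * (e%:A + f *: F y)) * (1 + y) * (1 + y) by fps_ring.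
by rewrite E; fps_ring.
Qed.

Lemma mob_res n c : r c = 0 -> r (mob_e n c) = 1.
Proof.
move=> c0; elim: n => [|n IHn]; first by rewrite /mob_e big_ord1 /= rmorph1.
by rewrite mob_eS rmorphD rmorphM c0 mul0r addr0.
Qed.

(** When [mob_f p c] vanishes the p-th power of the matrix is scalar, and this scalar is a unit
    because it reduces to 1. *)
Lemma mob_order c F : mobius 1 c 1 1 F -> mob_f p c = 0 -> forall f, iter p F f = f.
Proof.
move=> mF fp0; have [Fe c0 _ _] := mF.
have E := mob_iter p mF; rewrite fp0 mulr0 !scale0r addr0 add0r in E.
have itp : iter p F y = y.
  apply: (@fps_cancel ((mob_e p c)%:A)); last by rewrite E fps_scaleE mulrC.
  by rewrite coef_fpsZ /= mulr1 mob_res // oner_eq0.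
apply: cln_endo_eq; rewrite ?itp //=; first exact: fps_endo_iter.
exact: rmorph0.
Qed.

(** t lifts to y -> -y: conjugating the matrix (1, c; 1, 1) by diag(-1, 1) gives its adjugate,
    whence F T F = T. *)
Lemma lift_dihedral s t c F (R : gT -> fps A -> fps A) : lift_on <[s]>%g R -> R s =1 F -> mobius 1 c 1 1 F ->
  (t * s * t^-1 = s^-1)%g -> #[t]%g = 2%N -> (<[s]> :&: <[t]> = 1)%g ->
  rho t z = - z -> exists R', lift_on (<[s]> * <[t]>)%g R'.
Proof.
move=> RP Rs mF tst ot ti tz; have [Fe c0 _ Fy] := mF; rewrite !scale1r in Fy.
have [T mT] : exists T, mobius (-1) 0 0 1 T.
  by apply: mobius_exists; rewrite ?rmorph0 ?rmorph1 ?oner_eq0.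
have [Te _ _] := mT; rewrite scale0r scale1r scale0r addr0 mulr1 add0r scaleN1r => Ty.
have F0 := mobius_coef0 mF; have T0 := mobius_coef0 mT.
have TT f : T (T f) = f.
  apply: (@cln_endo_eq (T \o T) id) => /=; rewrite ?Ty ?(endoN Te) ?Ty ?opprK //.
  - exact: fps_endo_comp.
  - exact: rmorph0.
have FTF : forall f, F (T (F f)) = T f.
  apply: (@cln_endo_eq (F \o (T \o F)) T) => //=.
  - by apply: fps_endo_comp => //; apply: fps_endo_comp.
  - have := congr1 (fun f => F (T f)) Fy.
    rewrite !(endoM Te, endoD Te, endoA Te, endo1 Te) Ty.
    rewrite !(endoM Fe, endoD Fe, endoA Fe, endo1 Fe, endoN Fe) => E.
    set u := F (T (F y)) in E *.
    (* 1 - c is the determinant of the matrix of F. *)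
    apply: (@fps_cancel ((1 - c)%:A)).
      by rewrite coef_fpsZ /= mulr1 rmorphB rmorph1 c0 subr0 oner_eq0.
    have y1 : r (fps_coef (1 + y) 0) != 0 by rewrite coef_fpsD /= addr0 rmorph1 oner_eq0.
    apply: (fps_cancel y1).
    have -> : u * (1 - c)%:A * (1 + y) = u * ((1 + y) - (c%:A + y)) * (1 + y) by fps_ring.
    rewrite -Fy.
    have -> : u * (1 + y - F y * (1 + y)) = u * (1 - F y) * (1 + y) by ring.
    rewrite E.
    have -> : (c%:A - F y) * (1 + y) = c%:A * (1 + y) - F y * (1 + y) by ring.
    by rewrite Fy; fps_ring.
  - apply: cln_endo_coef0 => //; exact: cln_endo_coef0.
have sP : s \in <[s]>%g := cycle_id s.
have tN : t \in 'N(<[s]>)%g.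
  rewrite -groupV; apply/normP/eqP; rewrite eqEcard cardJg leqnn andbT.
  by rewrite -cycleJ conjgE invgK mulgA tst cycleV.
have [||||||R' [R'P _ _]] := @lift_extend A k r gT rho rho_act psi <[s]>%G R t T RP => //.
- apply: (mobius_along mT); rewrite tz rmorph0 rmorphN1 rmorph1.
  by rewrite scale0r scale1r addr0 mulr1 scaleN1r.
- by move=> f; rewrite ot /= TT.
- apply: (normal_commute RP tN (erefl _)) => f.
  have [R1 RM _ _] := RP.
  rewrite tst Rs -[T (F f)](R1) -(mulVg s) RM ?groupV //.
  by rewrite Rs FTF.
by exists R'.
Qed.

(** The matrix (-1, c; a, 1) has trace 0, so its square is the scalar 1 + a c, a unit. For p = 2 it
    reduces to z -> z / (1 + a z). *)
Lemma mob_involution a c F : mobius (-1) c a 1 F -> forall f, F (F f) = f.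
Proof.
move=> mF; have F0 := mobius_coef0 mF; case: mF => Fe c0 _ Fy.
rewrite scale1r scaleN1r in Fy.
apply: (@cln_endo_eq (F \o F) id) => //=; first exact: fps_endo_comp; last first.
  exact: cln_endo_coef0.
have E := congr1 F Fy.
rewrite !(endoM Fe, endoD Fe, endoA Fe, endoZ Fe, endo1 Fe, endoN Fe) in E.
set u := F (F y) in E *.
apply: (@fps_cancel ((1 + a * c)%:A)).
  by rewrite coef_fpsZ /= mulr1 rmorphD rmorph1 rmorphM c0 mulr0 addr0 oner_eq0.
apply: (@fps_cancel (1 + a *: y)).
  by rewrite coef_fpsD coef_fpsZ /= mulr0 addr0 rmorph1 oner_eq0.
have -> : u * (1 + a * c)%:A * (1 + a *: y) =
  u * (1 + a *: y + a *: (c%:A - y)) * (1 + a *: y) by fps_ring.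
rewrite -Fy.
have -> : u * (1 + a *: y + a *: (F y * (1 + a *: y))) = u * (1 + a *: F y) * (1 + a *: y) by fps_ring.
rewrite E.
have -> : (c%:A - F y) * (1 + a *: y) = c%:A * (1 + a *: y) - F y * (1 + a *: y) by ring.
by rewrite Fy; fps_ring.
Qed.

Lemma mob_comp_involutions a1 a2 c1 c2 F1 F2 :
  mobius (-1) c1 a1 1 F1 -> mobius (-1) c2 a2 1 F2 ->
  F1 (F2 y) * ((1 + a2 * c1)%:A + (a1 - a2) *: y) = (c2 - c1)%:A + (1 + a1 * c2) *: y.
Proof.
case=> e1 _ _ E1 [e2 _ _ E2]; rewrite scale1r scaleN1r in E1; rewrite scale1r scaleN1r in E2.
have E := congr1 F1 E2.
rewrite !(endoM e1, endoD e1, endoA e1, endoZ e1, endo1 e1, endoN e1) in E.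
set u := F1 (F2 y) in E *.
apply: (@fps_cancel (1 + a1 *: y)).
  by rewrite coef_fpsD coef_fpsZ /= mulr0 addr0 rmorph1 oner_eq0.
have -> : u * ((1 + a2 * c1)%:A + (a1 - a2) *: y) * (1 + a1 *: y) =
  u * (1 + a1 *: y + a2 *: (c1%:A - y)) * (1 + a1 *: y) by fps_ring.
rewrite -E1.
have -> : u * (1 + a1 *: y + a2 *: (F1 y * (1 + a1 *: y))) = u * (1 + a2 *: F1 y) * (1 + a1 *: y) by fps_ring.
rewrite E.
have -> : (c2%:A - F1 y) * (1 + a1 *: y) = c2%:A * (1 + a1 *: y) - F1 y * (1 + a1 *: y) by ring.
by rewrite E1; fps_ring.
Qed.

(** For X and Y of trace 0, X Y + Y X is the scalar tr (X Y), here 2 + a1 c2 + a2 c1. When it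
    vanishes the matrices anticommute, so the homographies commute. *)
Lemma mob_commute a1 a2 c1 c2 F1 F2 :
  mobius (-1) c1 a1 1 F1 -> mobius (-1) c2 a2 1 F2 -> 2%:R + a1 * c2 + a2 * c1 = 0 ->
  forall f, F1 (F2 f) = F2 (F1 f).
Proof.
move=> m1 m2 rel; have E12 := mob_comp_involutions m1 m2.
have E21 := mob_comp_involutions m2 m1.
have [e1 c10 _ _] := m1; have [e2 c20 _ _] := m2.
have F10 := mobius_coef0 m1; have F20 := mobius_coef0 m2.
apply: (@cln_endo_eq (F1 \o F2) (F2 \o F1)); try exact: fps_endo_comp; last first.
  exact: (cln_endo_coef0 e1 F10 F20).
have relE : 1 + a1 * c2 = - (1 + a2 * c1).
  by apply/eqP; rewrite -addr_eq0 -rel; apply/eqP; ring.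
rewrite -[_ y]/(F1 (F2 y)) -[RHS]/(F2 (F1 y)).
apply: (@fps_cancel ((1 + a2 * c1)%:A + (a1 - a2) *: y)).
  rewrite !coef_fpsD !coef_fpsZ /= mulr0 mulr1 addr0 rmorphD rmorph1 rmorphM c10 mulr0 addr0.
  exact: oner_neq0.
rewrite E12 relE.
have -> : (1 + a2 * c1)%:A + (a1 - a2) *: y = - ((1 + a1 * c2)%:A + (a2 - a1) *: y).
  by rewrite relE; fps_ring.
by rewrite mulrN E21; fps_ring.
Qed.

Lemma lift_klein s1 s2 a1 a2 c1 c2 F1 F2 :
  mobius (-1) c1 a1 1 F1 -> mobius (-1) c2 a2 1 F2 -> 2%:R + a1 * c2 + a2 * c1 = 0 ->
  along s1 F1 -> along s2 F2 -> #[s1]%g = 2%N -> #[s2]%g = 2%N -> (s1 * s2 = s2 * s1)%g ->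
  (<[s1]> :&: <[s2]> = 1)%g ->
  exists R, [/\ lift_on (<[s1]> * <[s2]>)%g R, R s1 =1 F1 & R s2 =1 F2].
Proof.
move=> m1 m2 rel s1F s2F o1 o2 s12 ti.
have [[e1 _ _ _] [e2 _ _ _]] := (m1, m2).
have [R1 [R1P R1s]] : exists R, lift_on <[s1]>%g R /\ R s1 =1 F1.
  by apply: lift_cyclic => // f; rewrite o1 /= (mob_involution m1).
have N2 : s2 \in 'N(<[s1]>)%g.
  by apply: (subsetP (cent_sub _)); rewrite cent_cycle; apply/cent1P.
have E2 : (s2 * s1 * s2^-1 = s1)%g by rewrite -s12 mulgK.
have [||R [RP RE Rs2]] := lift_extend rho_act R1P N2 ti e2 s2F.
- by move=> f; rewrite o2 /= (mob_involution m2).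
- apply: (normal_commute R1P N2 (erefl _)) => f.
  by rewrite E2 !R1s (mob_commute m1 m2 rel).
by exists R; split=> // f; rewrite RE ?cycle_id.
Qed.

(** For c1 = 2 and c2 = 2 om^2 the commutation relation is 2 (1 + om + om^2) = 0, and scaling y by
    om permutes F1, F2 and F1 F2 cyclically by conjugation. *)
Lemma lift_tetrahedral s1 s2 t om F1 F2 R :
  om ^+ 2 + om + 1 = 0 -> r om ^+ 3 = 1 -> r 2%:R = 0 ->
  mobius (-1) 2%:R 1 1 F1 -> mobius (-1) (2%:R * om ^+ 2) om 1 F2 ->
  lift_on (<[s1]> * <[s2]>)%g R -> R s1 =1 F1 -> R s2 =1 F2 ->
  (s1 * s2 = s2 * s1)%g ->
  (t * s1 * t^-1 = s2)%g -> (t * s2 * t^-1 = s1 * s2)%g -> #[t]%g = 3%N ->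
  ((<[s1]> * <[s2]>) :&: <[t]> = 1)%g -> t \in 'N(<[s1]> * <[s2]>)%g ->
  rho t z = r om *: z -> exists R', lift_on (<[s1]> * <[s2]> * <[t]>)%g R'.
Proof.
move=> om2 rom3 r2 m1 m2 RP Rs1 Rs2 s12 ts1 ts2 ot ti tN tz.
have [e1 _ _ E1] := m1; have [e2 _ _ E2] := m2.
rewrite scale1r scaleN1r scale1r in E1; rewrite scale1r scaleN1r in E2.
have [T mT] : exists T, mobius om 0 0 1 T.
  by apply: mobius_exists; rewrite ?rmorph0 ?rmorph1 ?oner_eq0.
have [Te _ _] := mT; rewrite scale0r scale1r scale0r addr0 mulr1 add0r => Ty.
have F10 := mobius_coef0 m1; have F20 := mobius_coef0 m2; have T0 := mobius_coef0 mT.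
have om3 : om ^+ 3 = 1.
  have : (om - 1) * (om ^+ 2 + om + 1) = 0 by rewrite om2 mulr0.
  move=> H; apply/eqP; rewrite -subr_eq0 -[X in _ == X]H; apply/eqP; ring.
have om2E : om ^+ 2 = - om - 1.
  by apply/eqP; rewrite -subr_eq0 -om2; apply/eqP; ring.
(* The remaining identities hold modulo om^2 + om + 1; q is the explicit quotient. *)
have om0 (q u v : A) : u - v = q * (om ^+ 2 + om + 1) -> u = v.
  by rewrite om2 mulr0 => /eqP; rewrite subr_eq0 => /eqP.
have TTT f : T (T (T f)) = f.
  apply: (@cln_endo_eq (T \o (T \o T)) id) => /=; last first.
  - exact: (cln_endo_coef0 Te T0 (cln_endo_coef0 Te T0 T0)).
  - by rewrite !(Ty, endoZ Te) !scalerA -expr2 -exprSr om3 scale1r.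
  - by do !split.
  - by apply: fps_endo_comp => //; apply: fps_endo_comp.
have TF1 : forall f, T (F1 f) = F2 (T f).
  apply: (@cln_endo_eq (T \o F1) (F2 \o T)) => /=; try exact: fps_endo_comp; last first.
    exact: (cln_endo_coef0 Te T0 F10).
  rewrite Ty (endoZ e2).
  apply: (@fps_cancel (1 + om *: y)).
    by rewrite coef_fpsD coef_fpsZ /= mulr0 addr0 rmorph1 oner_eq0.
  have E := congr1 T E1.
  rewrite !(endoM Te, endoD Te, endoA Te, endoZ Te, endo1 Te, endoN Te, Ty) in E.
  rewrite E -scalerAl E2 scalerBr scalerA.
  by rewrite mulrCA -exprS om3 mulr1.
have TF2 : forall f, T (F2 f) = F1 (F2 (T f)).
  apply: (@cln_endo_eq (T \o F2) (F1 \o (F2 \o T))) => /=.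
  - exact: fps_endo_comp.
  - by apply: fps_endo_comp => //; apply: fps_endo_comp.
  - have E12 := mob_comp_involutions m1 m2.
    rewrite Ty (endoZ e2) (endoZ e1).
    have E := congr1 T E2.
    rewrite !(endoM Te, endoD Te, endoA Te, endoZ Te, endo1 Te, endoN Te, Ty) in E.
    set u := T (F2 y) in E *; set v := F1 (F2 y) in E12 *.
    apply: (@fps_cancel (((1 + om * 2%:R)%:A + (1 - om) *: y))).
      rewrite coef_fpsD !coef_fpsZ /= mulr0 addr0 mulr1 rmorphD rmorph1 rmorphM r2 mulr0 addr0.
      exact: oner_neq0.
    rewrite -scalerAl E12.
    have -> : (1 + om * 2%:R)%:A + (1 - om) *: y = (1 + om * 2%:R) *: (1 + om *: (om *: y)).
      rewrite scalerDr !scalerA; congr (_ + _ *: _).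
      by apply: (om0 (1 - om * 2%:R)); ring.
    rewrite -scalerAr E scalerDr scalerN !scalerA -scaleNr.
    rewrite scalerDr !scalerA; congr (_ *: _ + _ *: _).
      by apply: (om0 (om * 2%:R)); ring.
    by apply: (om0 (- (om * 2%:R))); ring.
  - exact: (cln_endo_coef0 Te T0 F20).
have [R1 RM _ _] := RP.
have G : group_set (<[s1]> * <[s2]>)%g.
  by apply/comm_group_setP/centC; rewrite cent_cycle cycle_subG; apply/cent1P.
have P1 : s1 \in (<[s1]> * <[s2]>)%g.
  by apply/mulsgP; exists s1 1%g; rewrite ?cycle_id ?group1 ?mulg1.
have P2 : s2 \in (<[s1]> * <[s2]>)%g.
  by apply/mulsgP; exists 1%g s2; rewrite ?cycle_id ?group1 ?mul1g.
have [|||R' [R'P _ _]] := @lift_extend A k r gT rho rho_act psi (Group G) R t T RP tN ti Te.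
- apply: (mobius_along mT); rewrite tz !rmorph0 rmorph1.
  by rewrite scale0r scale1r addr0 mulr1.
- by move=> f; rewrite ot /= TTT.
- apply: (@normal_commute2 _ _ _ _ _ _ (Group G) _ _ _ s1 s2 RP tN (erefl _)) => f.
    by rewrite ts1 Rs1 Rs2 TF1.
  by rewrite ts2 RM // Rs1 !Rs2 TF2.
by exists R'.
Qed.

End MobiusLifts.

(** The order suffices: the group structure is recovered later from P and theta, together with its
    action on the coordinate. *)
Lemma liftable_card (p : nat) (gT : finGroupType) : prime p -> liftable_form p gT ->
  [\/ #|gT| = p, odd p /\ #|gT| = p.*2, p = 2%N /\ #|gT| = 4%N | p = 2%N /\ #|gT| = 12%N].
Proof.
move=> p_pr [/card_isog|[[p2 /card_isog]|[p2 /card_isog]]|[p2 /card_isog]].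
- by rewrite cardsT /= card_Zp ?prime_gt0 // => ?; constructor 1.
- rewrite cardsT card_dihedral; last by apply: ltnW.
  by move=> ?; constructor 2; split=> //; case/even_prime: p_pr => // p2'; rewrite p2' in p2.
- by rewrite !cardsT card_prod !card_ord => ?; constructor 3.
- have := @card_Alt 'I_4; rewrite card_ord mul2n => /(_ isT) /(congr1 half).
  by rewrite doubleK cardsT => -> ?; constructor 4.
Qed.

(** * Existence of lifts for the liftable forms *)

Section LiftExistence.
Variables (p : nat) (p_pr : prime p) (k : fieldType) (pk : p \in [pchar k]).
Variables (gT : finGroupType) (rho : gT -> fps k -> fps k).
Hypotheses (rho_act : fps_action rho) (rho_weak : weak_action rho).
Variable A : cln_alg p_pr k.
Local Notation r := (cln_res A).
Local Notation P := (wild_group rho_act).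
Local Notation y := (fps_var k).
Local Notation a := (acoef rho).
Let endo (g : gT) := fps_action_endo rho_act g.

Lemma cln_res_surj (x : k) : exists b : A, r b = x.
Proof. by exists (Witt p_pr (fun=> x))%:A; rewrite cln_res_alg. Qed.

Lemma coordinate_lift (z : fps k) : fps_coef z 0 = 0 -> fps_coef z 1 != 0 ->
  exists psi phi : fps A -> fps A, [/\ fps_endo psi, fps_endo phi,
    fps_coef (psi (fps_var A)) 0 = 0, fps_map r (psi (fps_var A)) = z
    & cancel psi phi /\ cancel phi psi].
Proof.
move=> z0 z1; have /choice[l lK] := cln_res_surj.
pose Z : fps A := Fps (fun i => if i == 0%N then 0 else l (fps_coef z i)).
have [u uK] : exists u, fps_coef Z 1 * u = 1 by apply: cln_unit; rewrite /= lK.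
have [psi [phi [se te sy K1 K2]]] :=
  subst_bijective (res_kerP r) (@cln_sep _ _ _ A) (@cln_cauchy _ _ _ A) (erefl : fps_coef Z 0 = 0) uK.
exists psi, phi; rewrite sy; split=> //.
by apply: fps_eqP => -[|i] /=; rewrite ?rmorph0 ?lK.
Qed.

Lemma setT_lift psi phi (z : fps k) R : fps_endo psi -> fps_endo phi -> cancel psi phi ->
  cancel phi psi -> (forall (Q : {set gT}), #|Q| = #|gT| -> lift_on r rho psi Q R ->
  exists rhoA : gT -> fps A -> fps A, is_lift rho rhoA).
Proof.
move=> se te K1 K2 Q oQ; suff -> : Q = [set: gT] by apply: lift_on_lift K2.
by apply/eqP; rewrite eqEcard subsetT cardsT oQ leqnn.
Qed.

Lemma y_ord : has_ord 1 y.
Proof. by split=> [[]|] //=; rewrite oner_eq0. Qed.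

(** c and om are the only arithmetic input, so the same construction runs over the Eisenstein ring
    and over its truncations. *)
Lemma lift_exists c : r c = 0 -> (odd p -> mob_f p c = 0) ->
  (p = 2%N -> forall w : k, w ^+ 2 + w + 1 = 0 ->
    exists om : A, r om = w /\ om ^+ 2 + om + 1 = 0) ->
  liftable_form p gT -> exists rhoA : gT -> fps A -> fps A, is_lift rho rhoA.
Proof.
move=> c0 cE omE form.
have pG : (p %| #|gT|)%N.
  by case: (liftable_card p_pr form) => [->|[_ ->]|[-> ->]|[-> ->]] //; rewrite -muln2 dvdn_mulr.
have [s sP s1] := wild_neq1 p_pr pk rho_act rho_weak pG.
have os := wild_order p_pr pk rho_weak sP s1.
have [p2|p_odd] := even_prime p_pr; last first.
  have oP : #|P| = p.
    rewrite (card_wild p_pr pk rho_act rho_weak).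
    have odd2 : logn p 2 = 0%N by rewrite logn_prime //; case: eqP p_odd => // ->.
    case: (liftable_card p_pr form) => [->|[_ ->]|[p2 _]|[p2 _]]; try by rewrite p2 in p_odd.
      by rewrite part_pnat_id // pnat_id.
    by rewrite -mul2n p_part lognM ?prime_gt0 // odd2 logn_prime // eqxx expn1.
  have PE : gval P = <[s]>%g.
    by apply/eqP; rewrite eq_sym eqEcard cycle_subG sP oP -orderE os leqnn.
  have mkR (z : fps k) psi : fps_endo psi -> fps_coef (psi (fps_var A)) 0 = 0 ->
      fps_map r (psi (fps_var A)) = z -> rho s z * (1 + z) = z ->
      exists F R, [/\ mobius 1 c 1 1 F, lift_on r rho psi <[s]>%g R & R s =1 F].
    move=> se s0 sz sE.
    have [F mF] : exists F : fps A -> fps A, mobius 1 c 1 1 F.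
      by apply: mobius_exists; rewrite ?rmorph1 ?oner_eq0.
    have [|||R [RP Rs]] := @lift_cyclic _ _ _ A _ _ rho_act psi s F.
    - by case: mF.
    - by apply: (mobius_along rho_act se s0 sz mF); rewrite !rmorph1 !scale1r.
    - by rewrite os => f; exact: (mob_order mF (cE p_odd)).
    by exists F, R.
  case: (liftable_card p_pr form) => [oG|[_ oG]|[p2 _]|[p2 _]]; try by rewrite p2 in p_odd.
    have [z [z0 z1 sz _]] := linear_cyclic p_pr pk rho_weak sP s1 y_ord.
    have [psi [phi [se te s0 sZ [K1 K2]]]] := coordinate_lift z0 z1.
    have [F [R [_ RP _]]] := mkR z psi se s0 sZ sz.
    by apply: (setT_lift z se te K1 K2 _ RP); rewrite -orderE os oG.
  have [||t _ ot] := @Cauchy _ 2 [set: gT] => //.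
    by rewrite cardsT oG -muln2 dvdn_mull.
  have tNP : theta rho t != 1.
    apply/negP => /eqP/(wildP rho_act) tP; have := order_dvdG tP.
    rewrite ot oP dvdn_prime2 // => /eqP p2; by rewrite -p2 in p_odd.
  have tE : theta rho t = -1.
    have : theta rho t ^+ 2 = 1 by rewrite -(thetaX rho_act) -ot expg_order theta1.
    by move/eqP; rewrite sqrf_eq1 (negPf tNP) => /eqP.
  have tt : rho t (rho t y) = y.
    by rewrite -(fps_actionM rho_act) -[(t * t)%g](expgS t 1) -ot expg_order fps_action1.
  (* y - rho t y is an eigenvector of t for -1; its linear coefficient 2 is nonzero as p is odd. *)
  have f0ord : has_ord 1 (y - rho t y).
    split=> [[] // _|]; first by rewrite coef_fpsB rho_coef0 // subrr.
    rewrite coef_fpsB -[fps_coef (rho t y) 1]/(theta rho t) tE opprK.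
    by rewrite /= -(natrD _ 1 1) -(dvdn_pcharf pk) dvdn_prime2 //; apply: contraTneq p_odd => ->.
  have tst : (t * s * t^-1 = s^-1)%g.
    apply: (wild_conj_eq rho_weak sP); rewrite ?groupV //.
    by rewrite (acoefV sP) tE mulN1r.
  have [z [z0 z1 sz tz]] := linear_cyclic p_pr pk rho_weak sP s1 f0ord.
  have {}tz : rho t z = - z.
    by apply: tz => //; rewrite (endoB (endo t)) tt opprB.
  have [psi [phi [se te s0 sZ [K1 K2]]]] := coordinate_lift z0 z1.
  have [F [R [mF RP Rs]]] := mkR z psi se s0 sZ sz.
  have ti : (<[s]> :&: <[t]> = 1)%g.
    by apply: coprime_TIg; rewrite -!orderE os ot coprimen2.
  have [R' R'P] := lift_dihedral rho_act se s0 sZ RP Rs mF tst ot ti tz.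
  by apply: (setT_lift z se te K1 K2 _ R'P); rewrite TI_cardMg // -!orderE os ot oG muln2.
have two0 : 2%:R = 0 :> k by rewrite -p2 (pcharf0 pk).
have oppk (x : k) : - x = x.
  by apply/eqP; rewrite eq_sym -addr_eq0 -mulr2n -mulr_natr two0 mulr0.
have oppfps (f : fps k) : - f = f by apply: fps_eqP => i; apply: oppk.
have r2 : r 2%:R = 0 by rewrite rmorph_nat two0.
have along psi (z : fps k) g (b b' : A) F : fps_endo psi -> fps_coef (psi (fps_var A)) 0 = 0 ->
    fps_map r (psi (fps_var A)) = z -> mobius (-1) b' b 1 F ->
    rho g z * (1 + r b *: z) = z -> lifts_along r rho psi g F.
  move=> se s0 sz mF E; apply: (mobius_along rho_act se s0 sz mF).
  by rewrite rmorph1 scale1r E rmorphN1 scaleN1r oppfps.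
have mobE b b' : r b' = 0 -> exists F : fps A -> fps A, mobius (-1) b' b 1 F.
  by move=> b'0; apply: mobius_exists; rewrite ?rmorph1 ?oner_eq0.
have oPE : #|P| = (2 ^ logn 2 #|gT|)%N by rewrite (card_wild p_pr pk rho_act rho_weak) p_part p2.
have o2 g : g \in P -> g != 1%g -> #[g]%g = 2%N.
  by move=> gP g1; rewrite (wild_order p_pr pk rho_weak gP g1).
have comm g h : g \in P -> h \in P -> (g * h = h * g)%g.
  move=> gP hP; have /abelemP[//|/centsP C _] := wild_abelem p_pr pk rho_act rho_weak.
  exact: C.
case: (liftable_card p_pr form) => [oG|[p_odd _]|[_ oG]|[_ oG]]; first 2 last.
- have oP : #|P| = 4%N by rewrite oPE oG.
  have [s2 P2 ns2] : exists2 g, g \in P & g \notin <[s]>%g.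
    apply/subsetPn; apply: contraTN isT => /subset_leq_card.
    by rewrite oP -orderE o2.
  have n2 : s2 != 1%g by apply: contraNneq ns2 => ->; rewrite group1.
  have n12 : s != s2 by apply: contraNneq ns2 => <-; rewrite cycle_id.
  have [PE ti] := wild_klein p_pr pk rho_weak p2 sP P2 s1 n2 n12 (eq_leq oP).
  have [z [z0 z1 sz1 sz2 _]] := linear_klein p_pr pk rho_weak p2 sP P2 s1 n2 n12 y_ord.
  have [psi [phi [se te s0 sZ [K1 K2]]]] := coordinate_lift z0 z1.
  have [b bE] := cln_res_surj (a s2 / a s).
  (* c1 = 0 and c2 = -2 solve the commutation relation for a1 = 1 and any a2. *)
  have [F1 m1] := mobE 1 0 (rmorph0 _).
  have [|F2 m2] := mobE b (- 2%:R); first by rewrite rmorphN r2 oppr0.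
  have [|||||||R [RP _ _]] := @lift_klein _ _ _ A _ _ rho_act psi s s2 1 b 0 (- 2%:R) F1 F2 m1 m2.
  - by ring.
  - by apply: (along psi z s _ _ _ se s0 sZ m1); rewrite rmorph1 scale1r.
  - by apply: (along psi z s2 _ _ _ se s0 sZ m2); rewrite bE.
  - exact: o2.
  - exact: o2.
  - exact: comm.
  - exact: ti.
  by apply: (setT_lift z se te K1 K2 _ RP); rewrite -PE oP oG.
- have oP : #|P| = 4%N by rewrite oPE oG.
  have [||t _ ot] := @Cauchy _ 3 [set: gT] => //; first by rewrite cardsT oG.
  have tNP : theta rho t != 1.
    by apply/negP => /eqP/(wildP rho_act) tP; have := order_dvdG tP; rewrite ot oP.
  set w := theta rho t in tNP.
  have w2 : w ^+ 2 = 1 + w := theta_cube p_pr pk rho_weak p2 oP tNP.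
  have w3 : w ^+ 3 = 1 by rewrite -(thetaX rho_act) -ot expg_order theta1.
  pose s2 := (t * s * t^-1)%g.
  have P2 : s2 \in P := wild_conj_mem t sP.
  have n2 : s2 != 1%g := wild_conj_neq1 t s1.
  have as0 := acoef_neq0 rho_weak sP s1.
  have aE : a s2 = w * a s by rewrite (acoef_conj t sP).
  have n12 : s != s2.
    by apply: contraNneq tNP => ss; apply/eqP/(mulIf as0); rewrite -aE -ss mul1r.
  have [PE ti] := wild_klein p_pr pk rho_weak p2 sP P2 s1 n2 n12 (eq_leq oP).
  have cE' : a s2 / a s = w by rewrite aE mulfK.
  have ts2 : (t * s2 * t^-1 = s * s2)%g.
    apply: (wild_conj_eq rho_weak P2 (groupM sP P2)).
    by rewrite (acoefD sP P2) aE -/w mulrA -expr2 w2 mulrDl mul1r.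
  (* Up to the factor 3 = 1, this projects y to the eigenspace of t for w. *)
  pose f0 : fps k := y + w ^+ 2 *: rho t y + w *: rho t (rho t y).
  have ttt : rho t (rho t (rho t y)) = y.
    have := fps_actionX rho_act t 3 y; rewrite /= => <-.
    by rewrite -ot expg_order fps_action1.
  have f0ord : has_ord 1 f0.
    split=> [[] // _|]; rewrite !coef_fpsD !coef_fpsZ.
      by rewrite !rho_coef0 //= !mulr0 !addr0.
    rewrite !(rho_coef1 rho_act) -/w /= !mul1r.
    have -> : 1 + w ^+ 2 * w + w * (w * w) = 1 + w ^+ 3 * 2%:R by ring.
    by rewrite two0 mulr0 addr0 oner_neq0.
  have tf0 : rho t f0 = w *: f0.
    rewrite /f0 !(endoD (endo t)) !(endoZ (endo t)) ttt !scalerDr !scalerA -exprS w3 scale1r -expr2.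
    by rewrite addrC addrA.
  have [z [z0 z1 sz1 sz2 tz]] := linear_klein p_pr pk rho_weak p2 sP P2 s1 n2 n12 f0ord.
  rewrite cE' in sz2 tz.
  have {}tz := tz t (erefl _) ts2 w2 tf0.
  have [psi [phi [se te s0 sZ [K1 K2]]]] := coordinate_lift z0 z1.
  have [|om [omr om2]] := omE p2 w.
    by rewrite w2 -addrA [_ + 1]addrC -mulr2n -mulr_natr two0 mulr0.
  have [F1 m1] := mobE 1 2%:R r2.
  have [|F2 m2] := mobE om (2%:R * om ^+ 2); first by rewrite rmorphM r2 mul0r.
  have [|||||||R [RP R1 R2]] := @lift_klein _ _ _ A _ _ rho_act psi s s2 1 om 2%:R (2%:R * om ^+ 2) F1 F2 m1 m2.
  - by rewrite -(mulr0 2%:R) -om2; ring.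
  - by apply: (along psi z s _ _ _ se s0 sZ m1); rewrite rmorph1 scale1r.
  - by apply: (along psi z s2 _ _ _ se s0 sZ m2); rewrite omr.
  - exact: o2.
  - exact: o2.
  - exact: comm.
  - exact: ti.
  have ti' : ((<[s]> * <[s2]>) :&: <[t]> = 1)%g.
    by rewrite -PE; apply: coprime_TIg; rewrite oP -orderE ot.
  have tN : t \in 'N(<[s]> * <[s2]>)%g.
    by rewrite -PE; apply: (subsetP (normal_norm (wild_normal rho_act))); rewrite inE.
  have rom3 : r om ^+ 3 = 1 by rewrite omr.
  have {}tz : rho t z = r om *: z by rewrite omr.
  have [R' R'P] := lift_tetrahedral rho_act se s0 sZ om2 rom3 r2 m1 m2 RP R1 R2
    (comm _ _ sP P2) (erefl _) ts2 ot ti' tN tz.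
  apply: (setT_lift z se te K1 K2 _ R'P).
  by rewrite -PE in ti' *; rewrite TI_cardMg // oP -orderE ot oG.
- have [z [z0 z1 sz _]] := linear_cyclic p_pr pk rho_weak sP s1 y_ord.
  have [psi [phi [se te s0 sZ [K1 K2]]]] := coordinate_lift z0 z1.
  have [F mF] := mobE 1 0 (rmorph0 _).
  have [|||R [RP Rs]] := @lift_cyclic _ _ _ A _ _ rho_act psi s F.
  - by case: mF.
  - by apply: (along psi z s _ _ _ se s0 sZ mF); rewrite rmorph1 scale1r.
  - by rewrite o2 // => f /=; rewrite (mob_involution mF).
  by apply: (setT_lift z se te K1 K2 _ RP); rewrite -orderE os oG.
- by rewrite p2 in p_odd.
Qed.

End LiftExistence.

(** * Witt vectors of a perfect field *)

(** The congruence is proved between universal integer polynomials, by repeated use of [zcong_expS],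
    and then specialised. *)
Lemma exp_cong (p : nat) (R : comNzRingType) (x z : R) j : prime p ->
  exists w, (x + p%:R * z) ^+ (p ^ j) = x ^+ (p ^ j) + (p ^ j.+1)%:R * w.
Proof.
move=> p_pr; pose t : zpoly bool := ZAdd (ZVar true) (ZMul (znat _ p) (ZVar false)).
pose u : zpoly bool := ZVar true.
have H : zcong (p ^ j.+1) (zexp t (p ^ j)) (zexp u (p ^ j)).
  elim: j => [|j IHj].
    by exists (ZVar false) => S e; rewrite !zeval_exp /= zeval_nat !expr1.
  have := zcong_expS (prime_gt0 p_pr) (dvdn_exp (ltn0Sn j) (dvdnn p)) IHj.
  case=> v Hv; exists v => S e; have := Hv S e.
  by rewrite -expnS !zeval_exp -!exprM -!expnSr.
case: H => v Hv; have := Hv R (fun b => if b then x else z).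
by rewrite !zeval_exp /= zeval_nat => ->; eexists.
Qed.

Section WittCoefficients.
Variables (p : nat) (p_pr : prime p).

Lemma ghost_inj_le (B : idomainType) n (x y : nat -> B) : char_zero B ->
  (forall m, (m <= n)%N -> ghost p m x = ghost p m y) ->
  forall m, (m <= n)%N -> x m = y m.
Proof.
move=> B0 xy; elim/ltn_ind => m IHm le_mn.
have := xy m le_mn; rewrite /ghost !big_ord_recr /= subnn expn0 !expr1.
rewrite (eq_bigr (fun i : 'I_m => (p ^ i)%:R * y i ^+ (p ^ (m - i)))); last first.
  by move=> i _; rewrite IHm // ltnW // (leq_trans (ltn_ord i)).
move/addrI/mulfI; apply; apply/eqP => /B0/eqP.
by rewrite expn_eq0 eqn0Ngt prime_gt0.
Qed.

(** Setting the variables of index above n to 0 changes no ghost component up to n, hence, in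
    characteristic 0, no Witt polynomial up to n. *)
Lemma witt_poly_dep (Phi : zpoly nat) n (R : comNzRingType) (x x' : nat * nat -> R) :
  (forall i j, (j <= n)%N -> x (i, j) = x' (i, j)) ->
  zeval x (witt_poly p_pr Phi n) = zeval x' (witt_poly p_pr Phi n).
Proof.
move=> xx'; pose s (v : nat * nat) : zpoly (nat * nat) := if (v.2 <= n)%N then ZVar v else ZZero.
have E (S : comNzRingType) (e : nat * nat -> S) :
    zeval e (witt_poly p_pr Phi n) = zeval e (zsubst s (witt_poly p_pr Phi n)).
  apply: zeval_char_zero => {S}B {}e B0; rewrite zeval_subst.
  pose e' v := zeval e (s v).
  apply: (ghost_inj_le (n := n) (x := fun m => zeval e (witt_poly p_pr Phi m))
    (y := fun m => zeval e' (witt_poly p_pr Phi m)) B0) => // m le_mn.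
  rewrite !witt_polyP; apply: zeval_ext => i; apply: eq_bigr => j _.
  by rewrite /e' /s /= (leq_trans _ le_mn) // -ltnS.
rewrite !E !zeval_subst; apply: zeval_ext => -[i j].
by rewrite /s /=; case: leqP => //= /xx' ->.
Qed.

Lemma witt_op_dep (Phi : zpoly nat) n (R : comNzRingType) (x x' : nat -> witt p_pr R) :
  (forall i j, (j <= n)%N -> witt_coef (x i) j = witt_coef (x' i) j) ->
  witt_coef (witt_op Phi x) n = witt_coef (witt_op Phi x') n.
Proof. by move=> xx'; apply: witt_poly_dep => i j /xx'. Qed.

Variable R : comNzRingType.
Implicit Types x y z : witt p_pr R.

Definition agree n x y := forall i, (i < n)%N -> witt_coef x i = witt_coef y i.

Lemma agreeD n x x' y y' : agree n x x' -> agree n y y' -> agree n (x + y) (x' + y').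
Proof.
move=> xx' yy' i lt_in; apply: witt_op_dep => -[|c] j le_ji;
  [apply: xx' | apply: yy']; exact: leq_ltn_trans lt_in.
Qed.

Lemma agreeN n x x' : agree n x x' -> agree n (- x) (- x').
Proof.
by move=> xx' i lt_in; apply: witt_op_dep => c j le_ji; apply: xx'; apply: leq_ltn_trans lt_in.
Qed.

Lemma agree_sub0 n x y : agree n x y <-> agree n (x - y) 0.
Proof.
split=> [xy|xy0].
  by rewrite -(subrr y); apply: agreeD => //; apply: agreeN.
by rewrite -[x](subrK y) -[y in X in agree _ _ X]add0r; apply: agreeD.
Qed.

Lemma witt_coef0 n : witt_coef (0 : witt p_pr R) n = 0.
Proof.
rewrite -[LHS]/(zeval _ (witt_poly p_pr ZZero n)).
rewrite (@zeval_char_zero _ _ ZZero) // => B e B0 /=.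
apply: (ghost_inj (prime_gt0 p_pr) B0 (x := fun m => zeval e (witt_poly p_pr ZZero m))
   (y := fun=> 0)) => m.
rewrite witt_polyP /= /ghost big1 // => i _.
by rewrite expr0n expn_eq0 eqn0Ngt prime_gt0 // mulr0.
Qed.

Lemma witt_eval_nat (x : nat -> witt p_pr R) n : witt_eval x (znat _ n) = n%:R.
Proof. by elim: n => [|n IHn] //=; rewrite IHn mulrS. Qed.

(* In characteristic p, multiplication by p is the Verschiebung composed with the Frobenius. *)
Lemma witt_mulp x n : p%:R = 0 :> R ->
  witt_coef (p%:R * x) n = if n is m.+1 then witt_coef x m ^+ p else 0.
Proof.
move=> Rp; pose t : zpoly nat := ZMul (znat _ p) (ZVar 0%N).
have /choice[q Hq] := witt_eval_poly p_pr t.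
pose e (v : nat * nat) := witt_coef x v.2.
(* This lists every variable that occurs, so that a single cover of characteristic 0 serves for all
   coefficients up to n. *)
pose s := flatten [seq zvars (q m) | m <- iota 0 n.+1] ++ [seq (0%N, j) | j <- iota 0 n.+1].
have [B [f [e' [B0 fe]]]] := char_zero_cover e s.
pose X i := Witt p_pr (fun j => e' (i, j)).
pose c j := e' (0%N, j).
pose a m := witt_coef (witt_eval X t) m.
pose b m := if m is l.+1 then c l ^+ p else 0.
have p0 : p%:R != 0 :> B.
  by apply/eqP => /B0 pz; have := prime_gt0 p_pr; rewrite pz.
have ga m : ghost p m a = p%:R * ghost p m c.
  rewrite -[LHS]/(witt_ghost m (witt_eval X t)) witt_ghost_eval /=.
  by rewrite zeval_nat.
(* b is the Verschiebung of the p-th powers of c. Its ghost components differ from those of a only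
   by p^(m+1) c_m, which forces a = b modulo p. *)
have gb m : ghost p m b + (p ^ m.+1)%:R * c m = p%:R * ghost p m c.
  rewrite /ghost [X in p%:R * X]big_ord_recr /= subnn expn0 expr1 mulrDr.
  rewrite mulrA -natrM -expnS; congr (_ + _).
  rewrite big_ord_recl /= expr0n expn_eq0 eqn0Ngt prime_gt0 //= mulr0 add0r mulr_sumr.
  apply: eq_bigr => i _; rewrite /bump /= add1n expnS natrM -mulrA; congr (_ * (_ * _)).
  by rewrite -exprM -expnS -subSn // subSS.
have ab m : exists d, a m = b m + p%:R * d.
  elim/ltn_ind: m => m IHm.
  have [S HS] : exists S, \sum_(i < m) (p ^ i)%:R * a i ^+ (p ^ (m - i)) =
     \sum_(i < m) (p ^ i)%:R * b i ^+ (p ^ (m - i)) + (p ^ m.+1)%:R * S.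
    have /choice[g Hg] (i : 'I_m) : exists g, (p ^ i)%:R * a i ^+ (p ^ (m - i)) =
       (p ^ i)%:R * b i ^+ (p ^ (m - i)) + (p ^ m.+1)%:R * g.
      have [d ->] := IHm i (ltn_ord i); have [w ->] := exp_cong (b i) d (m - i) p_pr.
      exists w; rewrite mulrDr mulrA -natrM -expnD addnS subnKC //.
      exact: ltnW.
    exists (\sum_(i < m) g i); rewrite mulr_sumr -big_split /=.
    by apply: eq_bigr => i _; rewrite Hg.
  have := ga m; rewrite -gb /ghost !big_ord_recr /= subnn expn0 !expr1 HS => E.
  exists (c m - S); apply: (@mulfI _ (p ^ m)%:R).
    by rewrite natrX expf_neq0.
  apply: (addrI (\sum_(i < m) (p ^ i)%:R * b i ^+ (p ^ (m - i)) + (p ^ m.+1)%:R * S)).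
  by rewrite E expnSr natrM; ring.
have fa m : (m <= n)%N -> f (a m) = witt_coef (p%:R * x) m.
  move=> le_mn; rewrite /a Hq zeval_morph.
  have -> : p%:R * x = witt_eval (fun=> x) t by rewrite /= witt_eval_nat.
  rewrite Hq; apply: zeval_vars => -[i j] vs /=; rewrite fe //.
  rewrite /s mem_cat; apply/orP; left; apply/flatten_mapP; exists m => //.
  by rewrite mem_iota.
have fc m : (m <= n)%N -> f (c m) = witt_coef x m.
  move=> le_mn; rewrite /c fe // /s mem_cat; apply/orP; right.
  by apply/mapP; exists m; rewrite // mem_iota.
rewrite -fa //; have [d ->] := ab n.
rewrite rmorphD rmorphM rmorph_nat Rp mul0r addr0 /b; case: (n) fc => [|m] fc.
  exact: rmorph0.
by rewrite rmorphXn fc.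
Qed.

Lemma witt_mulpX x n i : p%:R = 0 :> R ->
  witt_coef (p%:R ^+ n * x) i = if (i < n)%N then 0 else witt_coef x (i - n) ^+ (p ^ n).
Proof.
move=> Rp; elim: n i => [|n IHn] i; first by rewrite mul1r expr1 subn0.
rewrite exprS -mulrA witt_mulp //; case: i => // i.
rewrite IHn ltnS subSS; case: ifP => _; last by rewrite -exprM -expnSr.
by rewrite expr0n eqn0Ngt prime_gt0.
Qed.

End WittCoefficients.

Section WittPerfect.
Variables (p : nat) (p_pr : prime p) (k : fieldType) (k_perfect : perfect_of_char p k).
Local Notation W := (witt p_pr k).
Implicit Types x y : W.
Let pk : p%:R = 0 :> k. Proof. by case: k_perfect => /pcharf0. Qed.

(** Perfectness supplies the p-th roots that undo the Frobenius in [witt_mulp]. *)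
Lemma witt_divpX n x : (forall i, (i < n)%N -> witt_coef x i = 0) ->
  exists y, x = p%:R ^+ n * y.
Proof.
elim: n x => [|n IHn] x x0; first by exists x; rewrite mul1r.
have /choice[g gK] : forall c : k, exists d, d ^+ p = c by case: k_perfect.
have [|y yE] := IHn (Witt p_pr (fun i => g (witt_coef x i.+1))).
  move=> i lt_in /=; have := gK (witt_coef x i.+1); rewrite x0 // => /eqP.
  by rewrite expf_eq0 => /andP[_ /eqP].
exists y; rewrite exprS -mulrA -yE; apply: witt_eqP => i.
by rewrite witt_mulp //; case: i => [|i] /=; [rewrite x0 | rewrite gK].
Qed.

Lemma agree_divp n x y : agree n x y <-> exists z, x - y = p%:R ^+ n * z.
Proof.
split=> [/agree_sub0 xy|[z xyE]].
  by apply: witt_divpX => i lt_in; rewrite xy ?witt_coef0.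
by apply/agree_sub0 => i lt_in; rewrite xyE witt_mulpX // lt_in witt_coef0.
Qed.

Lemma witt_separated x : (forall n, exists y, x = p%:R ^+ n * y) -> x = 0.
Proof.
move=> xp; apply: witt_eqP => i; have [y ->] := xp i.+1.
by rewrite witt_mulpX // ltnSn witt_coef0.
Qed.

Lemma witt_complete (u : nat -> W) : (forall n, exists y, u n.+1 - u n = p%:R ^+ n * y) ->
  exists l, forall n, exists y, l - u n = p%:R ^+ n * y.
Proof.
move=> du; have au n : agree n (u n.+1) (u n) by apply/agree_divp.
have aum m n : (m <= n)%N -> agree m (u n) (u m).
  move/subnK => <-; elim: (n - m)%N => // d IHd i lt_im.
  by rewrite addSn au ?IHd // (leq_trans lt_im) // leq_addl.
exists (Witt p_pr (fun i => witt_coef (u i.+1) i)) => n; apply/agree_divp => i lt_in /=.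
by rewrite (aum i.+1 n).
Qed.

Lemma witt_res0 x : witt_red x = 0 -> exists y, x = p%:R * y.
Proof. by move=> x0; rewrite -[p%:R]expr1; apply: witt_divpX => -[]. Qed.

(** If n = m p^e with m prime to p, the coefficient of index e of n is m^(p^e), which is nonzero in
    k. *)
Lemma witt_nat_neq0 n : n%:R = 0 :> W -> n = 0%N.
Proof.
move=> nW; apply/eqP; rewrite eqn0Ngt; apply/negP => n_gt0.
have [[|m] m_p nE] := pfactor_coprime p_pr n_gt0.
  by rewrite nE mul0n in n_gt0.
have := congr1 (fun w => witt_coef w (logn p n)) nW.
rewrite nE natrM mulrC natrX witt_mulpX // -nE ltnn subnn witt_coef0 => /eqP.
rewrite expf_eq0 -/(witt_red (m.+1%:R : W)) rmorph_nat => /andP[_].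
rewrite -(dvdn_pcharf (proj1 k_perfect)) => p_m.
by rewrite prime_coprime // p_m in m_p.
Qed.

Lemma witt_cube_root (w : k) : p = 2%N -> w ^+ 3 = 1 -> exists l : W, witt_red l = w /\ l ^+ 3 = 1.
Proof.
move=> p2 w3; pose x : W := Witt p_pr (fun=> w).
have [z xE] : exists z, x ^+ 3 - 1 = p%:R * z.
  by apply: witt_res0; rewrite rmorphB rmorphXn rmorph1 -[X in X ^+ 3]/w w3 subrr.
(* x is an arbitrary lift of w. Since w^4 = w, each x^(4^n) lifts w too, and the sequence converges
   because x^3 = 1 modulo 2. *)
pose u n := x ^+ (4 ^ n).
have u3 n : exists y, u n ^+ 3 = 1 + p%:R ^+ n.+1 * y.
  have [y yE] := exp_cong 1 z (2 * n) p_pr.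
  exists (p%:R ^+ n * y); rewrite /u -exprM mulnC exprM.
  have -> : x ^+ 3 = 1 + p%:R * z by rewrite -xE; ring.
  have -> : (4 ^ n = p ^ (2 * n))%N by rewrite expnM p2.
  by rewrite yE expr1n natrX mulrA -exprD; congr (1 + p%:R ^+ _ * y); lia.
have [l Hl] : exists l, forall n, exists y, l - u n = p%:R ^+ n * y.
  apply: witt_complete => n; have [y yE] := u3 n.
  exists (u n * p%:R * y); rewrite /u expnS exprM -/(u n).
  rewrite (_ : x ^+ 4 ^+ (4 ^ n) = u n * u n ^+ 3); last first.
    by rewrite -exprS /u -!exprM mulnC.
  by rewrite yE exprS; ring.
exists l; split.
  have [y ly] := Hl 1%N; rewrite -[l](subrK (u 1%N)) ly rmorphD rmorphM rmorphXn.
  by rewrite rmorph_nat pk expr1 mul0r add0r /u rmorphXn -[LHS]/(w ^+ 4) exprS w3 mulr1.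
apply/eqP; rewrite -subr_eq0; apply/eqP/witt_separated => n.
have [[y ly] [y' uy]] := (Hl n, u3 n).
exists (y * (l ^+ 2 + l * u n + u n ^+ 2) + p%:R * y').
have -> : l ^+ 3 - 1 = (l - u n) * (l ^+ 2 + l * u n + u n ^+ 2) + (u n ^+ 3 - 1) by ring.
by rewrite ly uy [p%:R ^+ n.+1]exprS; ring.
Qed.

End WittPerfect.

(** * Eisenstein extensions of the Witt vectors *)

Section QuotientAlgebra.
Variables (K : comNzRingType) (T : comAlgType K) (I : T -> Prop).
Hypotheses (I_ideal : is_ideal I) (I_proper : ~ I 1).

(* The proofs are phantom arguments, which the ring structure depends on. *)
Definition ideal_pred of is_ideal I & ~ I 1 : {pred T} := fun a => `[< I a >].
Local Notation S := (ideal_pred I_ideal I_proper).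

Fact ideal_pred_closed : idealr_closed S.
Proof.
have [I0 ID IM] := I_ideal; split.
- by apply/asboolP.
- by apply/negP => /asboolP.
- by move=> a u v /asboolP uI /asboolP vI; apply/asboolP/ID => //; apply: IM.
Qed.

HB.instance Definition _ := isIdealr.Build T S ideal_pred_closed.

Definition quot_alg := {ideal_quot S}.
HB.instance Definition _ := GRing.ComNzRing.on quot_alg.

Definition quot_pi (a : T) : quot_alg := (\pi_({ideal_quot S}) a)%qT.

Fact quot_pi_additive : zmod_morphism quot_pi.
Proof. by move=> a b; rewrite /quot_pi rmorphB. Qed.
Fact quot_pi_multiplicative : monoid_morphism quot_pi.
Proof. by split=> [|a b]; rewrite /quot_pi ?rmorph1 ?rmorphM. Qed.
HB.instance Definition _ := GRing.isZmodMorphism.Build T quot_alg quot_pi quot_pi_additive.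
HB.instance Definition _ := GRing.isMonoidMorphism.Build T quot_alg quot_pi quot_pi_multiplicative.

Definition quot_scale (c : K) (x : quot_alg) : quot_alg := quot_pi c%:A * x.

Fact quot_scaleA a b x : quot_scale a (quot_scale b x) = quot_scale (a * b) x.
Proof. by rewrite /quot_scale mulrA -rmorphM -scalerAl mul1r scalerA. Qed.
Fact quot_scale1 : left_id 1 quot_scale.
Proof. by move=> x; rewrite /quot_scale scale1r rmorph1 mul1r. Qed.
Fact quot_scaleDr : right_distributive quot_scale +%R.
Proof. by move=> a x y; rewrite /quot_scale mulrDr. Qed.
Fact quot_scaleDl x : {morph quot_scale^~ x : a b / a + b}.
Proof. by move=> a b; rewrite /quot_scale scalerDl rmorphD mulrDl. Qed.
HB.instance Definition _ := GRing.Zmodule_isLmodule.Build K quot_alg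
  quot_scaleA quot_scale1 quot_scaleDr quot_scaleDl.
Fact quot_scaleAl (a : K) (x y : quot_alg) : a *: (x * y) = a *: x * y.
Proof. exact: mulrA. Qed.
HB.instance Definition _ := GRing.Lmodule_isLalgebra.Build K quot_alg quot_scaleAl.
HB.instance Definition _ := GRing.Lalgebra_isComAlgebra.Build K quot_alg.

Lemma quot_pi_surj (x : quot_alg) : exists a, quot_pi a = x.
Proof. by exists (generic_quotient.repr x); rewrite /quot_pi reprK. Qed.

Lemma quot_piZ c a : quot_pi (c *: a) = c *: quot_pi a.
Proof. by rewrite -[a in LHS]mul1r scalerAl rmorphM. Qed.

Lemma quot_pi_alg c : quot_pi c%:A = c%:A.
Proof. by rewrite quot_piZ rmorph1. Qed.

Lemma quot_pi_eq0 a : quot_pi a = 0 <-> I a.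
Proof.
rewrite -(rmorph0 quot_pi) /quot_pi; split=> [/eqP|aI].
  by rewrite -Quotient.idealrBE subr0 => /asboolP.
by apply/eqP; rewrite -Quotient.idealrBE subr0; apply/asboolP.
Qed.

Section Lift.
Variables (U : nzRingType) (f : {rmorphism T -> U}) (fI : forall a, I a -> f a = 0).

Definition quot_lift (x : quot_alg) : U := f (generic_quotient.repr x).

Lemma quot_liftE a : quot_lift (quot_pi a) = f a.
Proof.
apply/eqP; rewrite -subr_eq0 -rmorphB; apply/eqP/fI/quot_pi_eq0.
by rewrite rmorphB /quot_lift /= {1}/quot_pi reprK subrr.
Qed.

Lemma quot_lift_additive : zmod_morphism quot_lift.
Proof.
move=> x y; have [[a <-] [b <-]] := (quot_pi_surj x, quot_pi_surj y).
by rewrite -rmorphB !quot_liftE rmorphB.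
Qed.
Lemma quot_lift_multiplicative : monoid_morphism quot_lift.
Proof.
split=> [|x y]; first by rewrite -(rmorph1 quot_pi) quot_liftE rmorph1.
have [[a <-] [b <-]] := (quot_pi_surj x, quot_pi_surj y).
by rewrite -rmorphM !quot_liftE rmorphM.
Qed.
End Lift.

End QuotientAlgebra.

(** * Complete local algebras with principal maximal ideal *)

Section Uniformizer.
Variables (p : nat) (p_pr : prime p) (k : fieldType).
Local Notation W := (witt p_pr k).
Variables (A : comAlgType W) (res : {rmorphism A -> k}) (u : A).
Hypothesis res_alg : forall w : W, res w%:A = witt_red w.
Hypothesis res_ker : forall a, res a = 0 <-> exists b, a = u * b.
Hypothesis u_sep : forall a, (forall n, exists b, a = u ^+ n * b) -> a = 0.
Hypothesis u_complete : forall v : nat -> A, (forall n, exists b, v n.+1 - v n = u ^+ n * b) ->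
  exists l, forall n, exists b, l - v n = u ^+ n * b.
Implicit Types a b : A.

Lemma unif_geometric a : exists b, (1 - u * a) * b = 1.
Proof.
have [|l Hl] := u_complete (v := fun n => \sum_(i < n) (u * a) ^+ i).
  by move=> n; exists (a ^+ n); rewrite big_ord_recr /= addrAC subrr add0r exprMn.
exists l; apply/eqP; rewrite -subr_eq0; apply/eqP/u_sep => n.
have [b lE] := Hl n; exists ((1 - u * a) * b - a ^+ n).
have E := subrXX 1 (u * a) n.
rewrite expr1n in E.
have {}E : 1 - (u * a) ^+ n = (1 - u * a) * \sum_(i < n) (u * a) ^+ i.
  by rewrite E; congr (_ * _); apply: eq_bigr => i _; rewrite expr1n mul1r.
rewrite -[l](subrK (\sum_(i < n) (u * a) ^+ i)) lE mulrDr -E exprMn; ring.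
Qed.

Lemma unif_unit a : res a != 0 -> exists b, a * b = 1.
Proof.
move=> a0; pose b : A := (Witt p_pr (fun=> (res a)^-1))%:A.
have [|c cE] := (res_ker (a * b - 1)).1 _.
  by rewrite rmorphB rmorphM rmorph1 res_alg [witt_red _]/((res a)^-1) mulfV // subrr.
have [d dE] := unif_geometric (- c).
exists (b * d); rewrite mulrA -dE; congr (_ * _).
by rewrite mulrN opprK -cE; ring.
Qed.

Lemma unif_max_ideal a : res a = 0 <-> max_ideal a.
Proof.
split=> [a0 [b ab]|a_max].
  have /eqP := congr1 res ab; rewrite rmorphM a0 mul0r rmorph1 eq_sym.
  by rewrite oner_eq0.
by apply: contrapT => /eqP/unif_unit.
Qed.

Lemma unif_local : local_ring A.
Proof.
have E := unif_max_ideal; split=> [|a b /E a0 /E b0|a b /E b0]; apply/E.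
- exact: rmorph0.
- by rewrite rmorphD /= a0 b0 addr0.
- by rewrite rmorphM /= b0 mulr0.
Qed.

Lemma unif_ideal_pow n a : ideal_pow (@max_ideal A) n a <-> exists b, a = u ^+ n * b.
Proof.
split=> [|[b ->]].
  elim: n a => [|n IHn] a; first by exists a; rewrite mul1r.
  apply: (@ideal_gen_min _ _ (fun a => exists b, a = u ^+ n.+1 * b)).
    split=> [|x y [c ->] [d ->]|x y [c ->]]; first by exists 0; rewrite mulr0.
      by exists (c + d); rewrite mulrDr.
    by exists (x * c); rewrite mulrCA.
  move=> _ [c [d [/unif_max_ideal/res_ker[c' ->] /IHn[d' ->] ->]]].
  by exists (c' * d'); rewrite exprS; ring.
apply: ideal_powMr; elim: n => [|n IHn] //; rewrite exprS; apply: ideal_powS => //.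
by apply/unif_max_ideal/res_ker; exists 1; rewrite mulr1.
Qed.

(** u is allowed to be nilpotent, so that the same lemmas serve for discrete valuation rings and for
    their truncations. *)
Lemma unif_val a : a != 0 -> exists n b c, a = u ^+ n * b /\ b * c = 1.
Proof.
move=> a0.
have [n [[b aE] nb]] : exists n, (exists b, a = u ^+ n * b) /\ ~ exists b, a = u ^+ n.+1 * b.
  apply: contrapT => H; case/eqP: a0; apply: u_sep => n; elim: n => [|n IHn].
    by exists a; rewrite mul1r.
  by apply: contrapT => H'; apply: H; exists n.
have [|c bc] := @unif_unit b; last by exists n, b, c.
apply/eqP => /res_ker[b' bE]; apply: nb; exists b'.
by rewrite aE bE exprSr mulrA.
Qed.

Lemma unif_ideal (I : A -> Prop) : is_ideal I -> (exists2 a, I a & a != 0) ->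
  exists n, [/\ I (u ^+ n), (forall m, I (u ^+ m) -> (n <= m)%N)
    & forall a, I a -> exists b, a = u ^+ n * b].
Proof.
move=> [I0 ID IM] [a Ia a0]; have [m [b [c [aE bc]]]] := unif_val a0.
have In m' b' c' : I (u ^+ m' * b') -> b' * c' = 1 -> I (u ^+ m').
  by move=> H bc'; rewrite -[u ^+ m']mulr1 -bc' mulrA mulrC; apply: IM.
have Pm : exists n, `[< I (u ^+ n) >] by exists m; apply/asboolP/(In m b c) => //; rewrite -aE.
case: (ex_minnP Pm) => n /asboolP nI n_min; exists n; split=> //.
  by move=> m' /asboolP; apply: n_min.
move=> x Ix; have [->|x0] := eqVneq x 0; first by exists 0; rewrite mulr0.
have [m' [b' [c' [xE bc']]]] := unif_val x0.
have nm : (n <= m')%N by apply/n_min/asboolP/(In m' b' c') => //; rewrite -xE.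
by exists (u ^+ (m' - n) * b'); rewrite mulrA -exprD subnKC.
Qed.

Lemma unif_noetherian : noetherian A.
Proof.
move=> I I_id; have [I0 ID IM] := I_id.
have [nz|z] := pselect (exists2 a, I a & a != 0).
  have [n [In _ IP]] := unif_ideal I_id nz.
  exists [:: u ^+ n] => a; split=> [/IP[b ->]|].
    by rewrite mulrC; have [_ _] := ideal_gen_ideal (fun b => b \in [:: u ^+ n]);
      apply; apply: ideal_gen_incl; rewrite inE.
  by apply: ideal_gen_min => // b; rewrite inE => /eqP ->.
exists [::] => a; split=> [Ia|].
  have -> : a = 0 by apply/eqP/negP => /negP a0; apply: z; exists a.
  by have [] := ideal_gen_ideal (fun b : A => b \in [::]).
exact: ideal_gen_min.
Qed.

Lemma unif_complete : complete_ring A.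
Proof.
split=> [a Ha|v Hv]; first by apply: u_sep => n; apply/unif_ideal_pow.
have [l Hl] : exists l, forall n, exists b, l - v n = u ^+ n * b.
  by apply: u_complete => n; apply/unif_ideal_pow.
by exists l => n; apply/unif_ideal_pow.
Qed.

Lemma unif_artinian n : u ^+ n = 0 -> artinian A.
Proof.
move=> un J J_id J_decr.
have Jd m m' : (m <= m')%N -> forall a, J m' a -> J m a.
  move/subnK => <-; elim: (m' - m)%N => // d IHd a; rewrite addSn => /J_decr; exact: IHd.
have [nz|/existsNP[m Hm]] := pselect (forall m, exists2 a, J m a & a != 0); last first.
  exists m => m' le_mm' a Jma; have -> : a = 0.
    by apply/eqP/negP => /negP a0; apply: Hm; exists a.
  by case: (J_id m').
have /choice[v Hv] m := unif_ideal (J_id m) (nz m).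
have v_le m : (v m <= n)%N.
  have [_ H _] := Hv m; apply: H; rewrite un; by case: (J_id m).
have v_mono m m' : (m <= m')%N -> (v m <= v m')%N.
  by move=> le_mm'; have [_ H _] := Hv m; apply/H/(Jd _ _ le_mm'); case: (Hv m').
have [m Hm] : exists m, forall m', (m <= m')%N -> v m' = v m.
  (* n - v m bounds the number of jumps that v can still make. *)
  have bound d : forall m, (n - v m <= d)%N -> exists m, forall m', (m <= m')%N -> v m' = v m.
    elim: d => [|d IHd] m0 le_d.
      exists m0 => m' le_mm'; apply/eqP; rewrite eqn_leq (v_mono _ _ le_mm') andbT.
      by apply: leq_trans (v_le m') _; rewrite -subn_eq0 -leqn0.
    have [H|/existsNP[m1 /not_implyP[le01 ne01]]] := pselect (forall m', (m0 <= m')%N -> v m' = v m0).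
      by exists m0.
    apply: (IHd m1); have := v_mono _ _ le01; have := v_le m1; lia.
  exact: (bound n 0%N (leq_subr _ _)).
exists m => m' le_mm' a Jma; have [_ _ /(_ a Jma)[b ->]] := Hv m.
have [Jv _ _] := Hv m'; rewrite -(Hm m' le_mm') mulrC.
by case: (J_id m') => _ _; apply.
Qed.

Definition unif_cln : cln_alg p_pr k :=
  ClnAlg unif_local unif_noetherian unif_complete unif_max_ideal res_alg.

End Uniformizer.

Lemma adic_telescope (A : comNzRingType) (u : A) (v : nat -> A) :
  (forall n, exists b, v n.+1 - v n = u ^+ n * b) ->
  forall n m, (n <= m)%N -> exists b, v m - v n = u ^+ n * b.
Proof.
move=> dv n m /subnK <-; elim: (m - n)%N => [|j [b IHj]].
  by exists 0; rewrite subrr mulr0.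
have [c cE] := dv (j + n)%N; exists (u ^+ j * c + b).
rewrite addSn -[v _](subrK (v (j + n)%N)) cE -addrA IHj addnC exprD; ring.
Qed.

Section Truncation.
Variables (p : nat) (p_pr : prime p) (k : fieldType).
Local Notation W := (witt p_pr k).
Variables (A : comAlgType W) (res : {rmorphism A -> k}) (u : A) (N : nat).
Hypothesis res_alg : forall w : W, res w%:A = witt_red w.
Hypothesis res_ker : forall a, res a = 0 <-> exists b, a = u * b.

(** The exponent N + 1 keeps the ideal proper even for N = 0. *)
Definition pow_ideal a := exists b, a = u ^+ N.+1 * b.

Fact pow_ideal_ideal : is_ideal pow_ideal.
Proof.
split=> [|a b [c ->] [d ->]|a b [c ->]]; first by exists 0; rewrite mulr0.
  by exists (c + d); rewrite mulrDr.
by exists (a * c); rewrite mulrCA.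
Qed.

Let res_u : res u = 0.
Proof. by apply/res_ker; exists 1; rewrite mulr1. Qed.

Fact pow_ideal_res a : pow_ideal a -> res a = 0.
Proof. by case=> b ->; rewrite rmorphM rmorphXn /= res_u expr0n mul0r. Qed.

Fact pow_ideal_proper : ~ pow_ideal 1.
Proof. by move/pow_ideal_res/eqP; rewrite rmorph1 oner_eq0. Qed.

Definition trunc_alg := quot_alg pow_ideal_ideal pow_ideal_proper.
HB.instance Definition _ := GRing.ComAlgebra.on trunc_alg.

Definition trunc_pi : A -> trunc_alg := @quot_pi _ _ _ pow_ideal_ideal pow_ideal_proper.
HB.instance Definition _ := GRing.RMorphism.on trunc_pi.

Lemma trunc_pi_surj x : exists a, trunc_pi a = x.
Proof. exact: quot_pi_surj. Qed.

Definition trunc_res : trunc_alg -> k :=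
  @quot_lift _ _ _ pow_ideal_ideal pow_ideal_proper _ res.
HB.instance Definition _ := GRing.isZmodMorphism.Build trunc_alg k trunc_res
  (@quot_lift_additive _ _ _ pow_ideal_ideal pow_ideal_proper _ _ pow_ideal_res).
HB.instance Definition _ := GRing.isMonoidMorphism.Build trunc_alg k trunc_res
  (@quot_lift_multiplicative _ _ _ pow_ideal_ideal pow_ideal_proper _ _ pow_ideal_res).

Lemma trunc_resE a : trunc_res (trunc_pi a) = res a.
Proof. exact: (quot_liftE _ _ pow_ideal_res). Qed.

Fact trunc_res_alg (w : W) : trunc_res w%:A = witt_red w.
Proof. by rewrite -[w%:A]quot_pi_alg trunc_resE res_alg. Qed.

Fact trunc_res_ker (a : trunc_alg) : trunc_res a = 0 <-> exists b, a = trunc_pi u * b.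
Proof.
have [a' <-] := trunc_pi_surj a; rewrite trunc_resE.
split=> [/res_ker[b ->]|[b]]; first by exists (trunc_pi b); rewrite -rmorphM.
have [b' <-] := trunc_pi_surj b.
move/(congr1 trunc_res); rewrite trunc_resE => ->.
by rewrite rmorphM /= trunc_resE res_u mul0r.
Qed.

Lemma trunc_nilp : trunc_pi u ^+ N.+1 = 0.
Proof. by rewrite -rmorphXn; apply/quot_pi_eq0; exists 1; rewrite mulr1. Qed.

Fact trunc_sep (a : trunc_alg) : (forall n, exists b, a = trunc_pi u ^+ n * b) -> a = 0.
Proof. by move/(_ N.+1) => [b ->]; rewrite trunc_nilp mul0r. Qed.

Fact trunc_complete (v : nat -> trunc_alg) :
  (forall n, exists b, v n.+1 - v n = trunc_pi u ^+ n * b) ->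
  exists l, forall n, exists b, l - v n = trunc_pi u ^+ n * b.
Proof.
move=> dv; exists (v N.+1) => n; have [le_nN|lt_Nn] := leqP n N.+1.
  exact: adic_telescope.
have [b vE] := adic_telescope dv (ltnW lt_Nn).
by exists 0; rewrite mulr0 -opprB vE trunc_nilp mul0r oppr0.
Qed.

Definition trunc_cln : cln_alg p_pr k :=
  unif_cln trunc_res_alg trunc_res_ker trunc_sep trunc_complete.

Lemma trunc_artinian : artinian trunc_cln.
Proof. exact: unif_artinian trunc_res_alg trunc_res_ker trunc_sep trunc_complete _ trunc_nilp. Qed.

End Truncation.

Section Eisenstein.
Variables (p : nat) (p_pr : prime p) (k : fieldType) (k_perfect : perfect_of_char p k).
Local Notation W := (witt p_pr k).
Variables (E : {poly W}) (d : nat).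
Hypotheses (E_monic : E \is monic) (E_size : size E = d.+1) (d_gt0 : (0 < d)%N).
Hypotheses (E0 : E`_0 = p%:R) (E_mid : forall i, (i < d)%N -> exists w, E`_i = p%:R * w).
Implicit Types P Q : {poly W}.

Import Pdiv.CommonRing Pdiv.RingMonic.
Local Notation rmod P := (rmodp P E).

Let pk : p%:R = 0 :> k. Proof. by case: k_perfect => /pcharf0. Qed.

Definition eis_ideal P := exists Q, P = E * Q.

Fact eis_ideal_ideal : is_ideal eis_ideal.
Proof.
split=> [|a b [c ->] [e ->]|a b [c ->]]; first by exists 0; rewrite mulr0.
  by exists (c + e); rewrite mulrDr.
by exists (a * c); rewrite mulrCA.
Qed.

Lemma eis_ideal_rmod P : eis_ideal P <-> rmod P = 0.
Proof.
split=> [[Q ->]|P0]; first by rewrite mulrC rmodp_mull.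
by exists (rdivp P E); rewrite [LHS](rdivp_eq E_monic) P0 addr0 mulrC.
Qed.

Lemma rmod_size P : (size (rmod P) <= d)%N.
Proof. by rewrite -ltnS -E_size ltn_rmodpN0 // monic_neq0. Qed.

Fact eis_proper : ~ eis_ideal 1.
Proof.
move/eis_ideal_rmod/eqP; rewrite rmodp_small ?oner_eq0 //.
by rewrite size_poly1 E_size.
Qed.

Definition eis_alg := quot_alg eis_ideal_ideal eis_proper.
HB.instance Definition _ := GRing.ComAlgebra.on eis_alg.

Definition eis_pi : {poly W} -> eis_alg := @quot_pi _ _ _ eis_ideal_ideal eis_proper.
HB.instance Definition _ := GRing.RMorphism.on eis_pi.

Lemma eis_pi_surj x : exists P, eis_pi P = x.
Proof. exact: quot_pi_surj. Qed.

Definition eis_red : {rmorphism {poly W} -> k} := @witt_red _ p_pr k \o coefp 0.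

Fact eis_red_ideal P : eis_ideal P -> eis_red P = 0.
Proof. by case=> Q ->; rewrite rmorphM /= E0 rmorph_nat pk mul0r. Qed.

Definition eis_res : eis_alg -> k := @quot_lift _ _ _ eis_ideal_ideal eis_proper _ eis_red.
HB.instance Definition _ := GRing.isZmodMorphism.Build eis_alg k eis_res
  (@quot_lift_additive _ _ _ eis_ideal_ideal eis_proper _ _ eis_red_ideal).
HB.instance Definition _ := GRing.isMonoidMorphism.Build eis_alg k eis_res
  (@quot_lift_multiplicative _ _ _ eis_ideal_ideal eis_proper _ _ eis_red_ideal).

Definition eis_unif := eis_pi 'X.
Local Notation u := eis_unif.

Lemma eis_resE P : eis_res (eis_pi P) = witt_red P`_0.
Proof. exact: (quot_liftE _ _ eis_red_ideal). Qed.

Lemma eis_piE : eis_pi E = 0.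
Proof. by apply/quot_pi_eq0; exists 1; rewrite mulr1. Qed.

Fact eis_res_alg (w : W) : eis_res w%:A = witt_red w.
Proof. by rewrite -[w%:A]quot_pi_alg eis_resE alg_polyC coefC. Qed.

Lemma eis_head P : exists Q, eis_pi P = (P`_0)%:A + u * eis_pi Q.
Proof.
exists (\poly_(i < (size P).-1) P`_i.+1); rewrite -[_%:A]quot_pi_alg -rmorphM -rmorphD.
congr (eis_pi _); apply/polyP => -[|i]; rewrite alg_polyC coefD coefC coefXM //= ?addr0 //.
rewrite add0r coef_poly; case: ltnP => // ge.
by rewrite nth_default //; lia.
Qed.

(** E vanishes in the quotient and has constant term p, so p is minus the sum of its other terms,
    all multiples of u. *)
Lemma eis_p : exists b, p%:R = u * b :> eis_alg.
Proof.
have [Q EQ] := eis_head E; exists (- eis_pi Q); apply/eqP.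
rewrite mulrN -addr_eq0; move: EQ; rewrite eis_piE E0 => /esym/eqP.
by rewrite scaler_nat.
Qed.

Fact eis_res_ker (a : eis_alg) : eis_res a = 0 <-> exists b, a = u * b.
Proof.
have [P <-] := eis_pi_surj a; split=> [|[b]].
  rewrite eis_resE => /(witt_res0 k_perfect)[w Pw]; have [Q ->] := eis_head P.
  have [b pb] := eis_p; exists (b * w%:A + eis_pi Q).
  by rewrite mulrDr mulrA -pb Pw !mulr_natl scalerMnl.
have [Q <-] := eis_pi_surj b; rewrite -rmorphM => ->.
by rewrite eis_resE coefXM; apply: rmorph0.
Qed.

(** With [eis_p], this identifies the u-adic and p-adic topologies, so that separation and
    completeness pass from W to the remainders modulo E. *)
Lemma eis_ud : exists b, u ^+ d = p%:R * b.
Proof.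
have /choice[w Hw] i : exists w, (i < d)%N -> E`_i = p%:R * w.
  have [lt_id|] := ltnP i d; last by exists 0.
  by have [w] := E_mid lt_id; exists w.
exists (- eis_pi (\poly_(i < d) w i)); apply/eqP; rewrite mulrN -addr_eq0.
rewrite -(rmorph_nat eis_pi) -rmorphM -rmorphXn -rmorphD.
rewrite -eis_piE; apply/eqP; congr (eis_pi _); apply/polyP => i.
rewrite coefD coefXn mulr_natl coefMn coef_poly.
have [lt_id|le_di] := ltnP i d; first by rewrite Hw // ltn_eqF // add0r mulr_natl.
rewrite mul0rn addr0; have [->|ne] := eqVneq i d; last by rewrite nth_default // E_size; lia.
by have /monicP := E_monic; rewrite /lead_coef E_size /= => ->.
Qed.

Lemma eis_udX n : exists b, u ^+ (d * n) = p%:R ^+ n * b.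
Proof. by have [b ub] := eis_ud; exists (b ^+ n); rewrite exprM ub exprMn. Qed.

Lemma eis_pX n : exists b, p%:R ^+ n = u ^+ n * b.
Proof. by have [b pb] := eis_p; exists (b ^+ n); rewrite pb exprMn. Qed.

Lemma eis_pi_rmod P : eis_pi (rmod P) = eis_pi P.
Proof.
rewrite [in RHS](rdivp_eq E_monic P) rmorphD rmorphM /=.
by rewrite eis_piE mulr0 add0r.
Qed.

Lemma eis_pi_eq P Q : eis_pi P = eis_pi Q -> rmod P = rmod Q.
Proof.
move=> /eqP; rewrite -subr_eq0 -rmorphB => /eqP/quot_pi_eq0/eis_ideal_rmod.
by rewrite rmodpB // => /eqP; rewrite subr_eq0 => /eqP.
Qed.

Lemma eis_pi_mulp n P Q : eis_pi P = p%:R ^+ n * eis_pi Q -> rmod P = p%:R ^+ n *: rmod Q.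
Proof.
move=> PQ; rewrite -rmodpZ //; apply: eis_pi_eq; rewrite PQ.
by rewrite -mul_polyC rmorphM polyC_exp polyC_natr rmorphXn rmorph_nat.
Qed.

Fact eis_sep (a : eis_alg) : (forall n, exists b, a = u ^+ n * b) -> a = 0.
Proof.
have [P <-] := eis_pi_surj a; move=> H.
rewrite -eis_pi_rmod; suff -> : rmod P = 0 by rewrite rmorph0.
apply/polyP => i; rewrite coef0; apply: (witt_separated k_perfect) => n.
have [[b Pb] [c uc]] := (H (d * n)%N, eis_udX n).
have [Q QE] := eis_pi_surj (c * b).
exists (rmod Q)`_i; rewrite -coefZ -(@eis_pi_mulp n P) //.
by rewrite [LHS]Pb uc -mulrA QE.
Qed.

Fact eis_complete (v : nat -> eis_alg) : (forall n, exists b, v n.+1 - v n = u ^+ n * b) ->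
  exists l, forall n, exists b, l - v n = u ^+ n * b.
Proof.
move=> dv; have /choice[V VE] n : exists P, eis_pi P = v (d * n)%N by apply: eis_pi_surj.
have dV n : exists Q, rmod (V n.+1) - rmod (V n) = p%:R ^+ n *: rmod Q.
  have [|b vb] := adic_telescope dv (n := (d * n)%N) (m := (d * n.+1)%N).
    by rewrite leq_pmul2l.
  have [c uc] := eis_udX n; have [Q QE] := eis_pi_surj (c * b); exists Q.
  by rewrite -rmodpB //; apply: eis_pi_mulp; rewrite rmorphB /= !VE vb uc -mulrA QE.
have /choice[l Hl] i : exists l, forall n, exists y, l - (rmod (V n))`_i = p%:R ^+ n * y.
  apply: (witt_complete k_perfect) => n; have [Q QE] := dV n.
  by exists (rmod Q)`_i; rewrite -coefB QE coefZ.
pose L := \poly_(i < d) l i; exists (eis_pi L) => n.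
have [b vb] := adic_telescope dv (n := n) (m := (d * n)%N) (leq_pmull _ d_gt0).
have [c pc] := eis_pX n.
have /choice[y Hy] i := Hl i n.
exists (c * eis_pi (\poly_(i < d) y i) + b).
rewrite mulrDr -vb mulrA -pc addrA; congr (_ - _).
rewrite -VE -[eis_pi (V n)]eis_pi_rmod -(rmorph_nat eis_pi) -rmorphXn -rmorphM -rmorphD.
congr (eis_pi _); apply/polyP => i; rewrite coefD -polyC_natr -polyC_exp coefCM !coef_poly.
case: ltnP => [_|le_di]; first by rewrite -Hy subrK.
by rewrite mulr0 add0r nth_default // (leq_trans (rmod_size _)).
Qed.

Definition eis_cln : cln_alg p_pr k :=
  unif_cln eis_res_alg eis_res_ker eis_sep eis_complete.

Lemma eis_nat_neq0 n : n%:R = 0 :> eis_alg -> n = 0%N.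
Proof.
move=> n0; apply: (witt_nat_neq0 k_perfect (n := n)); move: n0.
rewrite -(rmorph_nat eis_pi) => /quot_pi_eq0/eis_ideal_rmod.
rewrite rmodp_small => [|]; last first.
  by rewrite E_size -polyC_natr (leq_ltn_trans (size_polyC_leq1 _)).
by move/polyP/(_ 0%N); rewrite -polyC_natr coefC coef0.
Qed.

End Eisenstein.

Section Model.
Variables (p : nat) (p_pr : prime p) (k : fieldType) (k_perfect : perfect_of_char p k).
Local Notation W := (witt p_pr k).

Lemma mob_f_morph (A B : cln_alg p_pr k) (f : {rmorphism A -> B}) n c :
  f (mob_f n c) = mob_f n (f c).
Proof. by rewrite rmorph_sum; apply: eq_bigr => j _; rewrite rmorphMn rmorphXn. Qed.

Lemma mob_poly_coef i :
  (\sum_(j < p) 'X^j *+ 'C(p, j.*2.+1) : {poly W})`_i = 'C(p, i.*2.+1)%:R.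
Proof.
rewrite coef_sum; have [lt_ip|le_pi] := ltnP i p.
  rewrite (bigD1 (Ordinal lt_ip)) //= coefMn coefXn eqxx big1 ?addr0 // => j ji.
  rewrite coefMn coefXn (_ : (i == j) = false) ?mul0rn //.
  by apply: contraNF ji => /eqP ij; apply/eqP/val_inj.
rewrite bin_small; last by rewrite -addnn; lia.
by apply: big1 => j _; rewrite coefMn coefXn gtn_eqF ?mul0rn // (leq_trans (ltn_ord j)).
Qed.

(** For p odd the degree is (p - 1) / 2. For p = 2 no root has to be adjoined, and X + 2 gives W
    itself. *)
Lemma eisenstein_exists : exists (E : {poly W}) (d : nat),
  [/\ E \is monic, size E = d.+1, (0 < d)%N, E`_0 = p%:R &
      (forall i, (i < d)%N -> exists w, E`_i = p%:R * w) /\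
      (odd p -> E = \sum_(j < p) 'X^j *+ 'C(p, j.*2.+1))].
Proof.
have [p2|p_odd] := even_prime p_pr.
  exists ('X + p%:R%:P), 1%N; split=> //.
  - by rewrite monicE lead_coefDl ?lead_coefX // size_polyX (leq_ltn_trans (size_polyC_leq1 _)).
  - by rewrite size_polyDl size_polyX // (leq_ltn_trans (size_polyC_leq1 _)).
  - by rewrite coefD coefX coefC add0r.
  split=> [[|//] _|p_odd]; last by have := congr1 odd p2; rewrite p_odd.
  by exists 1; rewrite coefD coefX coefC add0r mulr1.
set E := \sum_(j < p) _; have EE i : E`_i = _ := mob_poly_coef i.
have pE : p = (p./2).*2.+1 by rewrite -[LHS]odd_double_half p_odd.
have lead : E`_(p./2) = 1 by rewrite EE -pE binn.
have sE : size E = p./2.+1.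
  apply/eqP; rewrite eqn_leq; apply/andP; split.
    apply/leq_sizeP => j lt; rewrite EE bin_small // {1}pE ltnS.
    by rewrite ltn_double.
  by rewrite ltnNge; apply/negP => /leq_sizeP/(_ _ (leqnn _))/eqP; rewrite lead oner_eq0.
exists E, p./2; split=> //.
- by rewrite monicE /lead_coef sE lead.
- by have := prime_gt1 p_pr; lia.
- by rewrite EE bin1.
split=> // i lt; exists ('C(p, i.*2.+1) %/ p)%:R.
rewrite EE -natrM mulnC divnK // prime_dvd_bin //=.
by rewrite pE ltnS ltn_double.
Qed.

(* The ring W[[c]] / (mob_f p c), or W for p = 2, with its quotients by powers of c. *)
Lemma model_exists : exists (A : cln_alg p_pr k) (c : A),
  [/\ cln_res A c = 0, odd p -> mob_f p c = 0,
      forall n, n%:R = 0 :> A -> n = 0%N,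
      forall a, (forall n, exists b, a = c ^+ n * b) -> a = 0 &
      forall N, exists (B : cln_alg p_pr k) (f : {rmorphism A -> B}),
        [/\ artinian B, cln_res B (f c) = 0 & forall a, f a = 0 -> exists b, a = c ^+ N * b]].
Proof.
have [E [d [E_monic E_size d_gt0 E0 [E_mid E_odd]]]] := eisenstein_exists.
pose A := eis_cln k_perfect E_monic E_size d_gt0 E0 E_mid.
pose c : A := eis_unif E_monic E_size d_gt0.
have res_c : cln_res A c = 0 by rewrite [LHS]eis_resE // coefX; apply: rmorph0.
exists A, c; split=> //.
- move=> p_odd; pose f : {rmorphism {poly W} -> A} := eis_pi E_monic E_size d_gt0.
  transitivity (f E); last exact: eis_piE.
  by rewrite E_odd // rmorph_sum; apply: eq_bigr => j _; rewrite rmorphMn rmorphXn.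
- exact: eis_nat_neq0.
- exact: eis_sep.
move=> N.
have RK : forall a : A, cln_res A a = 0 <-> exists b, a = c * b by apply: eis_res_ker.
have RA := @cln_res_alg _ _ _ A.
exists (trunc_cln N RA RK), (trunc_pi N RK); split.
- exact: trunc_artinian.
- by rewrite [LHS]trunc_resE.
- move=> a /quot_pi_eq0[b ->]; exists (c * b); rewrite exprSr; ring.
Qed.

End Model.

(** * Characteristic of the versal ring *)

Lemma intr_eq0_absz (A : comNzRingType) (m : int) :
  m%:~R = 0 :> A <-> `|m|%N%:R = 0 :> A.
Proof.
case: m => n //; rewrite NegzE mulrNz abszN.
split=> [/eqP|n0]; first by rewrite oppr_eq0 => /eqP.
by rewrite [_%:~R]n0 oppr0.
Qed.

Lemma has_car0 (A : comNzRingType) : (forall n, n%:R = 0 :> A -> n = 0%N) -> has_car A 0.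
Proof.
move=> A0 m; rewrite intr_eq0_absz dvd0z; split=> [/A0/eqP|/eqP-> //].
by rewrite absz_eq0.
Qed.

Lemma has_carp (A : comNzRingType) p : prime p -> p%:R = 0 :> A -> has_car A p.
Proof.
move=> p_pr p0 m; have pA : p \in [pchar A] by rewrite inE p_pr p0 eqxx.
by rewrite intr_eq0_absz dvdzE /= (dvdn_pcharf pA); split=> /eqP.
Qed.

Section Residues.
Variables (p : nat) (p_pr : prime p) (k : fieldType).
Local Notation W := (witt p_pr k).
Implicit Types A B F : cln_alg p_pr k.

Lemma artinian_nilpotent A : artinian A ->
  exists N, forall a, ideal_pow (@max_ideal A) N a -> a = 0.
Proof.
case/(_ (ideal_pow (@max_ideal A))) => [n|n a|m Hm].
- exact: ideal_powP.
- exact: ideal_pow_decr.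
exists m => a am; have [sep _] := cln_complete A; apply: sep => n.
by have [/Hm|/ltnW/ideal_pow_decr] := leqP m n; apply.
Qed.

(** This serves to see that the maximal ideal of each [fd_ring] is nilpotent. *)
Lemma ideal_pow_surj A B (f : {lrmorphism A -> B}) n b : (forall b, exists a, f a = b) ->
  ideal_pow (@max_ideal B) n b -> exists2 a, ideal_pow (@max_ideal A) n a & f a = b.
Proof.
move=> f_surj; elim: n b => [|n IHn] b; first by have [a <-] := f_surj b; exists a.
apply: (@ideal_gen_min _ _ (fun b => exists2 a, ideal_pow (@max_ideal A) n.+1 a & f a = b)) => [|_ [b1 [b2 [b1M /IHn[a2 a2n <-] ->]]]].
  split=> [|_ _ [a1 a1n <-] [a2 a2n <-]|b1 _ [a2 a2n <-]].
  - by exists 0; [exact: ideal_pow0 | exact: rmorph0].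
  - by exists (a1 + a2); [exact: ideal_powD | exact: rmorphD].
  - have [a1 <-] := f_surj b1.
    by exists (a1 * a2); [exact: ideal_powM | exact: rmorphM].
have [a1 a1E] := f_surj b1; exists (a1 * a2); last by rewrite rmorphM /= a1E.
apply: ideal_powS => //; apply/cln_res_ker; rewrite -(cln_res_morph f) a1E.
exact/cln_res_ker.
Qed.

Lemma residue_artinian F : (forall a, cln_res F a = 0 -> a = 0) -> artinian F.
Proof.
move=> F_inj J J_id _.
have [nz|/existsNP[m Hm]] := pselect (forall m, exists2 a, J m a & a <> 0).
  exists 0%N => n _ a _; have [b Jb b0] := nz n.
  have [|c bc] := @cln_unit _ _ _ F b; first by apply/eqP => /F_inj.
  have [_ _ JM] := J_id n; rewrite -[a]mulr1 -bc mulrCA mulrC; exact: JM.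
exists m => n _ a Ja; have -> : a = 0 by apply: contrapT => a0; apply: Hm; exists a.
by case: (J_id n).
Qed.

Section ResidueMap.
Variables (B F : cln_alg p_pr k).
Hypothesis F_inj : forall a, cln_res F a = 0 -> a = 0.

(* The proof is a phantom argument, which the morphism structure depends on. *)
Definition residue_map of (forall a, cln_res F a = 0 -> a = 0) : B -> F :=
  fun b => (Witt p_pr (fun=> cln_res B b) : W)%:A.
Local Notation q := (residue_map F_inj).

Lemma residue_mapE b : cln_res F (q b) = cln_res B b.
Proof. by rewrite cln_res_alg. Qed.

Lemma residue_inj a b : cln_res F a = cln_res F b -> a = b.
Proof. by move/eqP; rewrite -subr_eq0 -rmorphB => /eqP/F_inj/eqP; rewrite subr_eq0 => /eqP. Qed.

Lemma cln_resZ A (w : W) a : cln_res A (w *: a) = witt_red w * cln_res A a.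
Proof. by rewrite -mulr_algl rmorphM cln_res_alg. Qed.

Fact residue_map_additive : zmod_morphism q.
Proof. by move=> a b; apply: residue_inj; rewrite rmorphB !residue_mapE rmorphB. Qed.
Fact residue_map_multiplicative : monoid_morphism q.
Proof.
by split=> [|a b]; apply: residue_inj; rewrite ?rmorphM ?residue_mapE ?rmorphM ?rmorph1.
Qed.
Fact residue_map_scalable : scalable q.
Proof. by move=> w b; apply: residue_inj; rewrite residue_mapE [LHS]cln_resZ [RHS]cln_resZ residue_mapE. Qed.
HB.instance Definition _ := GRing.isZmodMorphism.Build B F q residue_map_additive.
HB.instance Definition _ := GRing.isMonoidMorphism.Build B F q residue_map_multiplicative.
HB.instance Definition _ := GRing.isScalable.Build W B F *:%R q residue_map_scalable.

Definition residue_hom : {lrmorphism B -> F} := q.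

End ResidueMap.

(** w <> 1 because 3 <> 0 in characteristic 2, so l - 1 is a unit and can be cancelled from l^3 - 1
    = 0. *)
Lemma cln_omega A : perfect_of_char p k -> p = 2%N -> forall w : k, w ^+ 2 + w + 1 = 0 ->
  exists om : A, cln_res A om = w /\ om ^+ 2 + om + 1 = 0.
Proof.
move=> k_perfect p2 w w0.
have w3 : w ^+ 3 = 1.
  have E : w ^+ 3 - 1 = (w - 1) * (w ^+ 2 + w + 1) by ring.
  by apply/eqP; rewrite -subr_eq0 E w0 mulr0.
have [l [lw l3]] := witt_cube_root p_pr k_perfect p2 w3.
exists l%:A; rewrite cln_res_alg; split=> //.
have p0 : p%:R = 0 :> k by case: k_perfect => /pcharf0.
have [|c cE] := @cln_unit _ _ _ A (l%:A - 1).
  rewrite rmorphB cln_res_alg rmorph1 [witt_red l]lw subr_eq0; apply/eqP => w1.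
  have /eqP : (w ^+ 2 + w + 1) - p%:R * w = 1 by rewrite p2 w1; ring.
  by rewrite w0 p0 mul0r subr0 eq_sym oner_eq0.
have E : (l%:A - 1) * (l%:A ^+ 2 + l%:A + 1) = 0 :> A.
  transitivity ((l%:A : A) ^+ 3 - 1); first by ring.
  by rewrite exprZn l3 expr1n scale1r subrr.
by have := congr1 ( *%R c) E; rewrite mulrA [c * _]mulrC cE mul1r mulr0.
Qed.

End Residues.

Section Versal.
Variables (p : nat) (p_pr : prime p) (k : fieldType) (k_perfect : perfect_of_char p k).
Variables (gT : finGroupType) (rho : gT -> fps k -> fps k).
Hypotheses (rho_act : fps_action rho) (rho_weak : weak_action rho).
Implicit Types A B R : cln_alg p_pr k.

Let pk : p \in [pchar k]. Proof. by case: k_perfect. Qed.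

Lemma lifts_car0 : liftable_form p gT -> lifts_to_car0 p_pr rho.
Proof.
move=> form; have [A [c [c0 cE A0 _ _]]] := model_exists p_pr k_perfect.
exists A; split; first exact: has_car0.
exact: (lift_exists pk rho_act rho_weak c0 cE (cln_omega A k_perfect) form).
Qed.

Lemma not_lifts_carp2 : (p %| #|gT|)%N -> ~ liftable_form p gT -> ~ lifts_to_carp2 p_pr rho.
Proof.
move=> pG form [A [/artinian_nilpotent[N A_nil] [A_car [rhoA A_lift]]]].
apply/form/(nilpotent_lift_form pk rho_act rho_weak pG A_nil A_lift)/eqP.
(* p = 0 in A would make p^2 divide p. *)
move=> /(A_car p); rewrite dvdzE /= => /dvdn_leq.
have := prime_gt1 p_pr; rewrite -mulnn; nia.
Qed.

Lemma fd_ring_nilpotent R (xi : formal_def rho R) n b :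
  ideal_pow (@max_ideal (fd_ring xi n)) n.+1 b -> b = 0.
Proof. by case/(ideal_pow_surj (fd_proj_surj (n:=n))) => a an <-; apply/fd_proj_ker. Qed.

Lemma formal_def_car R (xi : formal_def rho R) : (p %| #|gT|)%N -> ~ liftable_form p gT ->
  has_car R p.
Proof.
move=> pG form; apply: has_carp => //; have [sep _] := cln_complete R; apply: sep.
case=> // n; apply/(fd_proj_ker xi); rewrite rmorph_nat; apply: contrapT => /eqP p0.
exact/form/(nilpotent_lift_form pk rho_act rho_weak pG (@fd_ring_nilpotent R xi n) (fd_liftP xi n) p0).
Qed.

Lemma fd_ring0_res R (xi : formal_def rho R) b : cln_res (fd_ring xi 0) b = 0 -> b = 0.
Proof.
move=> b0; apply: (@fd_ring_nilpotent R xi 0); apply/ideal_pow1; first exact: cln_local.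
exact/cln_res_ker.
Qed.

Lemma lift_equiv_refl A (R : gT -> fps A -> fps A) : lift_equiv R R.
Proof. by exists id; split=> //; split=> //; exists id. Qed.

(* Over the residue field of R there is only one lift, so formal smoothness   *)
(* along B -> k turns any lift to B into a morphism R -> B.                   *)
Lemma smooth_morphism R (xi : formal_def rho R) B (rhoB : gT -> fps B -> fps B) :
  formally_smooth xi -> artinian B -> is_lift rho rhoB -> exists f : {lrmorphism R -> B}, True.
Proof.
move=> smooth B_art B_lift; pose F := fd_ring xi 0.
have F_inj := @fd_ring0_res R xi; pose q := residue_hom B F_inj.
have F_lift := fd_liftP xi 0%N.
have [] := smooth F B (residue_artinian F_inj) B_art q _ (fd_proj xi 0) (@fd_lift _ _ _ _ _ _ xi 0) rhoB F_lift B_lift.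
- move=> a; have [b bE] := cln_res_surj B (cln_res F a).
  by exists b; apply: (residue_inj F_inj); rewrite residue_mapE.
- exists 0%N, idfun; split=> //; exists (@fd_lift _ _ _ _ _ _ xi 0); split=> //.
    by move=> g f; rewrite !(_ : forall h, fps_map idfun h = h) // => h; apply: fps_eqP.
  exact: lift_equiv_refl.
- exists (@fd_lift _ _ _ _ _ _ xi 0); split=> //; last exact: lift_equiv_refl.
  move=> g f; have [[_ FE] [_ BE]] := (F_lift, B_lift).
  have qE h : fps_map (cln_res F) (fps_map q h) = fps_map (cln_res B) h.
    by apply: fps_eqP => n; apply: residue_mapE.
  have := FE g (fps_map q f); rewrite qE -BE -qE => /(congr1 (@fps_coef _)) E.
  by apply: fps_eqP => n; apply: (residue_inj F_inj); apply: (congr1 (fun h => h n) E).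
by move=> f _; exists f.
Qed.

(** No morphism between R and the model ring A is constructed: both map to each truncation B, so an
    integer that vanishes in R is divisible in A by every power of c, hence is 0. *)
Lemma versal_car R : (p %| #|gT|)%N -> versal_ring rho R -> has_car R 0 \/ has_car R p.
Proof.
move=> pG [xi [smooth _]]; have [form|form] := pselect (liftable_form p gT); last first.
  by right; apply: formal_def_car form.
left; apply: has_car0 => n n0; have [A [c [c0 cE A0 sep trunc]]] := model_exists p_pr k_perfect.
apply: A0; apply: sep => N; have [B [f [B_art fc f_ker]]] := trunc N.
have [|rhoB B_lift] := lift_exists pk rho_act rho_weak fc _ (cln_omega B k_perfect) form.
  by move=> p_odd; rewrite -mob_f_morph cE // rmorph0.
have [h _] := smooth_morphism smooth B_art B_lift.
by apply: f_ker; rewrite rmorph_nat -(rmorph_nat h) n0 rmorph0.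
Qed.

End Versal.

Theorem mainTheorem2 (p : nat) (p_pr : prime p) (k : fieldType)
    (k_perfect : perfect_of_char p k)
    (gT : finGroupType) (rho : gT -> fps k -> fps k)
    (rho_action : fps_action rho) (rho_faithful : faithful_action rho)
    (p_dvd_G : (p %| #|gT|)%N) (rho_weak : weak_action rho) :
  [/\ liftable_form p gT -> lifts_to_car0 p_pr rho,
      ~ liftable_form p gT -> ~ lifts_to_carp2 p_pr rho
    & forall R : cln_alg p_pr k, versal_ring rho R ->
        has_car R 0 \/ has_car R p].
Proof.
split=> [||R]; [exact: lifts_car0 | exact: not_lifts_carp2 | exact: versal_car].
Qed.
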